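(* Let $r_n$ and $c_n$ denote the numbers of relaxed binary trees and of compacted binary trees of size $n$, respectively. Then, as $n\to\infty$, \[ c_n=\Theta\!\left(n!\,4^n e^{3a_1 n^{1/3}} n^{3/4}\right)\qquad\text{and}\qquad r_n=\Theta\!\left(n!\,4^n e^{3a_1 n^{1/3}} n\right), \] where $a_1\approx-2.338$ is the largest root of the Airy function $\mathrm{Ai}$.
   Context: A (rooted, plane) binary tree is either a leaf or an internal node with an ordered pair (left, right) of binary subtrees; its size is its number of internal nodes. Postorder traverses the left subtree, then the right subtree, then the root. A relaxed binary tree of size $n$ is obtained from a binary tree $T$ with $n$ internal nodes (called its spine) by keeping the left-most leaf of $T$ and turning every other leaf $\ell$ into a pointer to a vertex of $T$ which is either an internal node or the left-most leaf and which precedes $\ell$ in postorder. It is regarded as a directed acyclic graph whose vertices are the internal nodes of $T$ and the left-most leaf; each internal node has a left and a right out-edge, going to the corresponding child in $T$ if that child is an internal node or the left-most leaf, and otherwise to the target of the pointer replacing that child. Two relaxed trees are equal iff they have the same spine and the same pointer targets. For each vertex $u$ of a relaxed tree define a binary tree $B(u)$ recursively in postorder: if $u$ is the left-most leaf, $B(u)$ is a single leaf; otherwise, if the left and right out-neighbours of $u$ are $v,w$, $B(u)$ is the binary tree with left subtree $B(v)$ and right subtree $B(w)$. A compacted binary tree of size $n$ is a relaxed binary tree of size $n$ such that $B(u)$ and $B(v)$ are non-isomorphic for all distinct vertices $u\neq v$. The Airy function $\mathrm{Ai}$ is the unique solution of $\mathrm{Ai}''(x)=x\,\mathrm{Ai}(x)$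 with $\mathrm{Ai}(x)\to0$ as $x\to+\infty$ (with the standard normalization); all its zeros are real and negative, and $a_1$ is the largest one. *)

(* Defs.v *)
From Stdlib Require Import Reals Lra Lia List Arith.
From Coquelicot Require Import Coquelicot.
Import ListNotations.
Open Scope R_scope.

Inductive bintree : Type :=
| Leaf : bintree
| Node : bintree -> bintree -> bintree.

(** A "pointer tree": the spine of a relaxed tree in which every leaf
    carries a natural-number label.  Vertices of the relaxed tree (the
    left-most leaf and the internal nodes) are numbered 0,1,2,... in
    postorder (the left-most leaf is always vertex 0).  The label of a
    non-left-most leaf is the number of the vertex it points to; the
    label of the left-most leaf is fixed to 0 (it carries no data). *)
Inductive ptree : Type :=
| PLeaf : nat -> ptree
| PNode : ptree -> ptree -> ptree.

Fixpoint psize (t : ptree) : nat :=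
  match t with
  | PLeaf _ => 0
  | PNode l r => S (psize l + psize r)
  end.

(** Postorder walk.  [k] = number of vertices already visited,
    [lm] = we are on the left-most branch.  Returns (validity, new k).
    A pointer leaf may only point to a vertex preceding it in postorder,
    i.e. one of the vertices 0..k-1. *)
Fixpoint pwalk (t : ptree) (k : nat) (lm : bool) : bool * nat :=
  match t with
  | PLeaf j => if lm then (Nat.eqb j 0, S k) else (Nat.ltb j k, k)
  | PNode l r =>
      let (b1, k1) := pwalk l k lm in
      let (b2, k2) := pwalk r k1 false in
      (andb b1 b2, S k2)
  end.

Definition is_relaxed (n : nat) (t : ptree) : Prop :=
  psize t = n /\ fst (pwalk t 0 true) = true.

(** Computation of B(u) for all vertices u, in postorder.  [env] is the
    list of B(v) for the vertices v already visited (index = vertex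
    number).  Returns B of the current vertex (or of the pointer target,
    for a pointer leaf) and the extended list. *)
Fixpoint Bwalk (t : ptree) (env : list bintree) (lm : bool)
  : bintree * list bintree :=
  match t with
  | PLeaf j => if lm then (Leaf, env ++ [Leaf]) else (nth j env Leaf, env)
  | PNode l r =>
      let (bl, e1) := Bwalk l env lm in
      let (br, e2) := Bwalk r e1 false in
      (Node bl br, e2 ++ [Node bl br])
  end.

Definition Blist (t : ptree) : list bintree := snd (Bwalk t [] true).

(** compacted binary trees of size n: B(u) pairwise distinct
    (isomorphism of plane binary trees is equality) *)
Definition is_compacted (n : nat) (t : ptree) : Prop :=
  is_relaxed n t /\ NoDup (Blist t).

Definition has_card {T : Type} (P : T -> Prop) (k : nat) : Prop :=
  exists l : list T, NoDup l /\ (forall t, P t <-> In t l) /\ length l = k.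

(** Airy-type functions: nonzero solutions of y'' = x y tending to 0 at
    +oo (these are exactly the nonzero multiples of Ai). *)
Definition airy_like (f : R -> R) : Prop :=
  (exists f' : R -> R, forall x, is_derive f x (f' x) /\ is_derive f' x (x * f x))
  /\ is_lim f p_infty 0
  /\ (exists x, f x <> 0).

Definition largest_zero (f : R -> R) (a : R) : Prop :=
  f a = 0 /\ forall x, f x = 0 -> x <= a.

Definition bigTheta (u g : nat -> R) : Prop :=
  exists C1 C2 : R, 0 < C1 /\ 0 < C2 /\ exists N : nat, forall n : nat,
    (N <= n)%nat -> C1 * g n <= u n <= C2 * g n.

(* Main.v *)
(* Reading the spine in postorder turns a relaxed tree into a Dyck-like path: a pointer leaf is an up
   step, an internal node a down step, and a pointer read after [m] down steps has [m + 1] targets.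
   A relaxed tree fails to be compacted exactly when some node with two pointer children repeats the
   pair of children of an earlier node, which removes [m - 1] choices per such cherry.  With [sg = 0]
   (relaxed) or [sg = 1] (compacted) the numbers [u n m] of prefixes with [n] leaves and [m] nodes obey
     u n m = (m + 1) u (n-1) m + u n (m-1) - sg (m - 1) u (n-2) (m-1),
   and recording which prefixes end with a node turns this into a system with nonnegative coefficients,
   so that super- and subsolutions bound the solution from above and below.

   Put [t = n + m], [k = n - m + 1], [h = (2/t)^(1/3)], [z = h k].  Dividing [u n m] by
     n! 2^t exp (3 a1 / h - 3 kappa ln h -+ sqrt h)
   and by the polynomial gauge [1 - h z^2/3 + beta h^2 z], the Airy function [Ai (a1 + z)] satisfies the
   recurrence up to a relative error [O(h^4)], while the factor [exp (-+ sqrt h)] provides a margin of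
   order [h^(7/2)].  This is enough for bounded [z]; for larger [z] the linear term [h^(3/2) z] added to
   (or subtracted from) the profile dominates all errors, thanks to the decay of [Ai], so no separate
   treatment of high paths is needed.  The result follows by reading off [m = n], where [h = n^(-1/3)]. *)

(* The estimate is shaped by the boundary k = 0, where the profile vanishes: near it the margin is
   only of order h^(7/2) z, so the error must be O(h^4 z) as well. Hence no term in [y'] of order up
   to h^4 may survive at z = 0, and later terms gain a factor z from h = z/k with k >= 1. This
   demand produces the gauge. The term - h z^2/3 cancels the drift (4/3) h^3 z y', to which (m +
   1)/n, about 1 - h^2 z, contributes h^3 z y' and the change of scale from t to t - 1 the other
   third; [beta] removes the multiple of h^4 y' left at z = 0, and [kappa] the multiple of h^3 y.
   The price is a gauge that may turn negative once h z^2 exceeds 3; in the supersolution the linear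
   correction restores positivity. Since dh/dt is about - h^4/6, the terms 3 a1/h and - 3 kappa ln h
   have derivatives a1 h^2/2 and kappa h^3/2, the first corrections to the logarithmic growth per
   step. The exponent of n is kappa - 1/3: [kappa] from the growth, - 1/3 from the barrier at k = 1,
   which is of order h. This is 1 for relaxed and 3/4 for compacted trees. *)
Require Import Defs.
From Stdlib Require Import Reals Arith Factorial Lra Lia Psatz List Permutation Bool ClassicalEpsilon.
From Coquelicot Require Import Coquelicot.
Open Scope R_scope.

(** * Counting relaxed and compacted trees *)

Section Combinatorics.

Import ListNotations.
Local Open Scope nat_scope.

(** * Cardinalities of predicates *)

Lemma has_card_unique {T : Type} (P : T -> Prop) j k : has_card P j -> has_card P k -> j = k.
Proof.
intros [l [Nl [Hl <-]]] [l' [Nl' [Hl' <-]]]. apply Permutation_length, NoDup_Permutation; try easy.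
intros x. rewrite <- Hl, <- Hl'. tauto.
Qed.

Lemma has_card_ext {T : Type} (P Q : T -> Prop) k :
  (forall x, P x <-> Q x) -> has_card P k -> has_card Q k.
Proof.
intros H [l [N [E L]]]. exists l. repeat split; try easy; intros; [apply E, H|apply H, E]; easy.
Qed.

Lemma has_card_empty {T : Type} (P : T -> Prop) : (forall x, ~ P x) -> has_card P 0.
Proof.
intros H. exists []. split; [constructor|]. split; [|easy]. intros x. split; [apply H|easy].
Qed.

Lemma has_card_image {T U : Type} (f : T -> U) (P : T -> Prop) (Q : U -> Prop) k :
  (forall x x', P x -> P x' -> f x = f x' -> x = x') ->
  (forall v, Q v <-> exists x, P x /\ v = f x) -> has_card P k -> has_card Q k.
Proof.
intros inj HQ [l [N [E L]]]. exists (map f l). rewrite length_map. split; [|split; [|easy]].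
- assert (I : forall x x', In x l -> In x' l -> f x = f x' -> x = x') by (intros; apply inj; try apply E; easy).
  clear E L. induction N as [|a l Ha N IH]; simpl; constructor.
  + intros H. apply in_map_iff in H. destruct H as [x [e Hx]]. apply Ha.
    rewrite (I a x); simpl; auto.
  + apply IH. intros; apply I; simpl; auto.
- intros v. rewrite HQ, in_map_iff. split; intros [x [A B]]; exists x; split; auto; now apply E.
Qed.

Lemma has_card_union {T : Type} (P Q : T -> Prop) j k :
  (forall x, P x -> Q x -> False) -> has_card P j -> has_card Q k ->
  has_card (fun x => P x \/ Q x) (j + k).
Proof.
intros D [l [N [E L]]] [l' [N' [E' L']]]. exists (l ++ l'). rewrite length_app. split; [|split; [|lia]].
- apply NoDup_app; try easy. intros x Hx Hx'. apply (D x); [now apply E|now apply E'].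
- intros x. rewrite in_app_iff, E, E'. tauto.
Qed.

Lemma has_card_split {T : Type} (P : T -> Prop) (q : T -> bool) k : has_card P k ->
  exists i j, i + j = k /\ has_card (fun x => P x /\ q x = true) i /\ has_card (fun x => P x /\ q x = false) j.
Proof.
intros [l [N [E L]]].
exists (length (filter q l)), (length (filter (fun x => negb (q x)) l)). split; [|split].
- rewrite <- L. apply filter_length.
- exists (filter q l). split; [now apply NoDup_filter|]. split; [|easy].
  intros x. rewrite filter_In, E. tauto.
- exists (filter (fun x => negb (q x)) l). split; [now apply NoDup_filter|]. split; [|easy].
  intros x. rewrite filter_In, E. destruct (q x); simpl; intuition congruence.
Qed.

Lemma has_card_sigma {T U : Type} (P : T -> Prop) (F : T -> U -> Prop) j k :
  has_card P j -> (forall x, P x -> has_card (F x) k) ->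
  has_card (fun p : T * U => P (fst p) /\ F (fst p) (snd p)) (j * k).
Proof.
intros [l [N [E <-]]] H.
apply has_card_ext with (fun p => In (fst p) l /\ F (fst p) (snd p)); [intros; now rewrite E|].
assert (H' : forall x, In x l -> has_card (F x) k) by (intros; now apply H, E). clear P E H.
induction N as [|a l Ha N IH]; simpl.
- apply has_card_empty. intros x [[] _].
- apply has_card_ext with (fun p => (fst p = a /\ F a (snd p)) \/ (In (fst p) l /\ F (fst p) (snd p))).
  { intros [x v]. simpl. split; [intros [[-> ?]|[? ?]]; auto|intros [[<- |?] ?]; auto]. }
  apply has_card_union.
  + intros [x v] [e _] [Hx _]. simpl in *. now subst.
  + apply has_card_image with (f := fun v => (a, v)) (P := F a); [congruence| |apply H'; now left].
    intros [x v]. simpl. split; [intros [-> ?]; eauto|intros [w [? [= -> ->]]]; auto].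
  + apply IH. intros; apply H'; now right.
Qed.

Lemma has_card_lt k : has_card (fun j => j < k) k.
Proof.
exists (seq 0 k). split; [apply seq_NoDup|]. split; [|apply length_seq].
intros j. rewrite in_seq. lia.
Qed.

(** * Lists of the values B(u) in postorder *)

Definition bintree_eq_dec (a b : bintree) : {a = b} + {a <> b}.
Proof. decide equality. Defined.

(** The shape of the environments that [Bwalk] builds on a valid spine. Distinctness stays a
    separate [NoDup], so that relaxed and compacted trees share this invariant. *)
Inductive wfenv : list bintree -> Prop :=
| wfenv_leaf : wfenv [Leaf]
| wfenv_snoc env x y : wfenv env -> In x env -> In y env -> wfenv (env ++ [Node x y]).

Lemma wfenv_closed env x y : wfenv env -> In (Node x y) env -> In x env /\ In y env.
Proof.
induction 1 as [|env a b W IH Ha Hb]; intros H.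
- destruct H as [H|[]]. discriminate.
- rewrite in_app_iff in *. destruct H as [H|[H|[]]].
  + destruct (IH H). rewrite !in_app_iff. auto.
  + injection H as -> ->. rewrite !in_app_iff. auto.
Qed.

Lemma wfenv_shape env : wfenv env ->
  exists ns, env = Leaf :: ns /\ forall b, In b ns -> exists x y, b = Node x y.
Proof.
induction 1 as [|env a b W [ns [-> IH]] Ha Hb].
- exists []. split; [easy|]. intros b [].
- exists (ns ++ [Node a b]). split; [easy|]. intros c Hc. rewrite in_app_iff in Hc.
  destruct Hc as [Hc|[<-|[]]]; eauto.
Qed.

Lemma node_neq_left x y : Node x y <> x.
Proof. revert y. induction x as [|a IHa b IHb]; intros y H; [discriminate|]. injection H as H _. now apply (IHa b). Qed.

Lemma node_neq_right x y : Node x y <> y.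
Proof. revert x. induction y as [|a IHa b IHb]; intros x H; [discriminate|]. injection H as _ H. now apply (IHb a). Qed.

(** Children of older entries are older entries themselves, and no tree is its own child, so the
    newest entry of a duplicate-free environment has no parent yet. *)
Lemma wfenv_last_not_child env c x y : wfenv (env ++ [c]) -> NoDup (env ++ [c]) ->
  x = c \/ y = c -> ~ In (Node x y) (env ++ [c]).
Proof.
intros W N E H.
assert (Nc : ~ In c env).
{ apply NoDup_remove_2 in N. now rewrite app_nil_r in N. }
inversion W as [e|env' a b W' Ha Hb e].
- destruct env as [|? [|]]; simpl in e; try discriminate. injection e as <-.
  simpl in H. destruct H as [H|[]]. discriminate.
- apply app_inj_tail in e. destruct e as [-> <-].
  rewrite in_app_iff in H. destruct H as [H|[H|[]]].
  + destruct (wfenv_closed _ _ _ W' H). destruct E; subst; auto.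
  + injection H as -> ->. destruct E as [E|E]; symmetry in E; [now apply node_neq_left in E|now apply node_neq_right in E].
Qed.

Fixpoint index (x : bintree) (l : list bintree) : nat :=
  match l with
  | [] => 0
  | a :: l => if bintree_eq_dec x a then 0 else S (index x l)
  end.

Lemma index_spec x l : In x l -> index x l < length l /\ nth (index x l) l Leaf = x.
Proof.
induction l as [|a l IH]; simpl; [easy|]. destruct (bintree_eq_dec x a) as [-> |n]; [split; [lia|easy]|].
intros [e|H]; [congruence|]. destruct (IH H). split; [lia|easy].
Qed.

(** Without duplicates a value determines its index, so these pairs correspond to the nodes present,
    that is, to all entries except the leaf. This is the origin of the factor [m - 1] in the
    compacted recurrence. *)
Lemma child_pairs_card env : wfenv env -> NoDup env ->
  has_card (fun p : nat * nat => fst p < length env /\ snd p < length env /\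
    In (Node (nth (fst p) env Leaf) (nth (snd p) env Leaf)) env) (length env - 1).
Proof.
intros W N. destruct (wfenv_shape env W) as [ns [E H]].
set (f := fun b => match b with Node x y => (index x env, index y env) | Leaf => (0, 0) end).
assert (S : has_card (fun b => In b ns) (length env - 1)).
{ exists ns. split; [rewrite E in N; now inversion N|]. split; [tauto|]. rewrite E. simpl. lia. }
assert (IN : forall b, In b ns -> In b env) by (intros; rewrite E; now right).
apply (has_card_image f) with (3 := S).
- intros b b' Hb Hb' e. destruct (H b Hb) as [x [y ->]]. destruct (H b' Hb') as [x' [y' ->]].
  destruct (wfenv_closed env x y W (IN _ Hb)) as [A1 A2]. destruct (wfenv_closed env x' y' W (IN _ Hb')) as [A1' A2'].
  unfold f in e. injection e as e1 e2.
  destruct (index_spec x env A1) as [_ B1]. destruct (index_spec y env A2) as [_ B2].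
  destruct (index_spec x' env A1') as [_ B1']. destruct (index_spec y' env A2') as [_ B2'].
  congruence.
- intros [i j]. simpl. split.
  + intros [Hi [Hj Hin]]. exists (Node (nth i env Leaf) (nth j env Leaf)). split.
    * rewrite E in Hin at 3. destruct Hin as [e|]; [discriminate|easy].
    * unfold f. assert (U : forall i, i < length env -> i = index (nth i env Leaf) env).
      { intros k Hk. destruct (index_spec (nth k env Leaf) env) as [K1 K2]; [now apply nth_In|].
        apply (proj1 (NoDup_nth env Leaf) N); auto. }
      now rewrite <- !U.
  + intros [b [Hb e]]. destruct (H b Hb) as [x [y ->]].
    destruct (wfenv_closed env x y W (IN _ Hb)) as [A1 A2]. injection e as -> ->.
    destruct (index_spec x env A1) as [C1 B1]. destruct (index_spec y env A2) as [C2 B2].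
    rewrite B1, B2. auto.
Qed.

(** * Stacks of subtrees met in a postorder reading *)

Definition is_nil {A : Type} (l : list A) : bool := match l with [] => true | _ => false end.

Definition total (st : list ptree) : nat := list_sum (map psize st).

(* A stack, top first, holds the subtrees completed at some moment of a postorder reading; the bottom one contains the left-most leaf. *)
Fixpoint swalk (st : list ptree) : bool * nat :=
  match st with
  | [] => (true, 0)
  | t :: rest => let (b, k) := swalk rest in
      let (b', k') := pwalk t k (is_nil rest) in (andb b b', k')
  end.

Fixpoint senv (st : list ptree) : list bintree :=
  match st with
  | [] => []
  | t :: rest => snd (Bwalk t (senv rest) (is_nil rest))
  end.

Definition topB (t : ptree) (rest : list ptree) : bintree :=
  fst (Bwalk t (senv rest) (is_nil rest)).

Lemma swalk_node l r rest :
  swalk (PNode l r :: rest) = (fst (swalk (r :: l :: rest)), S (snd (swalk (r :: l :: rest)))).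
Proof.
simpl. destruct (swalk rest) as [b k]. destruct (pwalk l k (is_nil rest)) as [b1 k1].
destruct (pwalk r k1 false) as [b2 k2]. simpl. now rewrite andb_assoc.
Qed.

Lemma senv_node l r rest :
  senv (PNode l r :: rest) = senv (r :: l :: rest) ++ [Node (topB l rest) (topB r (l :: rest))].
Proof.
unfold topB. simpl. destruct (Bwalk l (senv rest) (is_nil rest)) as [bl e1]. simpl.
destruct (Bwalk r e1 false) as [br e2]. easy.
Qed.

Lemma topB_node l r rest : topB (PNode l r) rest = Node (topB l rest) (topB r (l :: rest)).
Proof.
unfold topB. simpl. destruct (Bwalk l (senv rest) (is_nil rest)) as [bl e1]. simpl.
destruct (Bwalk r e1 false) as [br e2]. easy.
Qed.

Lemma swalk_leaf j t rest :
  swalk (PLeaf j :: t :: rest) =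
    (andb (fst (swalk (t :: rest))) (Nat.ltb j (snd (swalk (t :: rest)))), snd (swalk (t :: rest))).
Proof.
change (swalk (PLeaf j :: t :: rest)) with
  (let (b, k) := swalk (t :: rest) in (andb b (Nat.ltb j k), k)).
destruct (swalk (t :: rest)); easy.
Qed.

Lemma swalk_total st : st <> [] -> snd (swalk st) = S (total st).
Proof.
assert (P : forall t k lm, snd (pwalk t k lm) = (if lm then S k else k) + psize t).
{ induction t as [j|l IHl r IHr]; intros k lm; simpl; [destruct lm; simpl; lia|].
  specialize (IHl k lm). destruct (pwalk l k lm) as [b1 k1]. specialize (IHr k1 false).
  destruct (pwalk r k1 false) as [b2 k2]. simpl in *. destruct lm; lia. }
induction st as [|t rest IH]; [easy|]. intros _. unfold total in *. simpl.
destruct rest as [|t' rest].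
- specialize (P t 0 true). simpl in *. destruct (pwalk t 0 true). simpl in *. lia.
- destruct (swalk (t' :: rest)) as [b k]. simpl in IH. specialize (IH ltac:(easy)).
  specialize (P t k false). simpl. destruct (pwalk t k false) as [b' k']. simpl in *. lia.
Qed.

(** A valid pointer is in range, so [nth] returns a member and not its default. The assertions [A]
    and [B] treat subtrees off and on the left-most branch; only the latter start from the empty
    environment. *)
Lemma senv_wf st : st <> [] -> fst (swalk st) = true ->
  wfenv (senv st) /\ length (senv st) = snd (swalk st).
Proof.
assert (A : forall t env, wfenv env -> fst (pwalk t (length env) false) = true ->
  wfenv (snd (Bwalk t env false)) /\ In (fst (Bwalk t env false)) (snd (Bwalk t env false)) /\
  incl env (snd (Bwalk t env false)) /\
  length (snd (Bwalk t env false)) = snd (pwalk t (length env) false)).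
{ induction t as [j|l IHl r IHr]; intros env W V; simpl in *.
  - apply Nat.ltb_lt in V. split; [easy|]. split; [now apply nth_In|]. split; [apply incl_refl|easy].
  - specialize (IHl env W). destruct (pwalk l (length env) false) as [b1 k1].
    destruct (Bwalk l env false) as [bl e1]. simpl in *.
    specialize (IHr e1). destruct (pwalk r k1 false) as [b2 k2] eqn:Er.
    simpl in V. apply andb_true_iff in V. destruct V as [-> ->].
    destruct (IHl eq_refl) as [W1 [I1 [S1 L1]]]. rewrite L1, Er in IHr.
    destruct (Bwalk r e1 false) as [br e2]. simpl in *.
    destruct (IHr W1 eq_refl) as [W2 [I2 [S2 L2]]].
    split; [apply wfenv_snoc; auto|]. split; [apply in_or_app; right; now left|].
    split; [intros x Hx; apply in_or_app; left; auto|]. rewrite length_app. simpl. lia. }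
assert (B : forall t, fst (pwalk t 0 true) = true ->
  wfenv (snd (Bwalk t [] true)) /\ In (fst (Bwalk t [] true)) (snd (Bwalk t [] true)) /\
  length (snd (Bwalk t [] true)) = snd (pwalk t 0 true)).
{ induction t as [j|l IHl r _]; intros V; simpl in *.
  - split; [apply wfenv_leaf|]. split; [now left|easy].
  - destruct (pwalk l 0 true) as [b1 k1].
    destruct (Bwalk l [] true) as [bl e1]. simpl in *.
    destruct (pwalk r k1 false) as [b2 k2] eqn:Er.
    simpl in V. apply andb_true_iff in V. destruct V as [-> ->].
    destruct (IHl eq_refl) as [W1 [I1 L1]].
    destruct (A r e1 W1) as [W2 [I2 [S2 L2]]]; [now rewrite L1, Er|].
    rewrite L1, Er in L2. destruct (Bwalk r e1 false) as [br e2]. simpl in *.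
    split; [apply wfenv_snoc; auto|]. split; [apply in_or_app; right; now left|].
    rewrite length_app. simpl. lia. }
induction st as [|t rest IH]; [easy|]. intros _ V.
destruct rest as [|t' rest].
- simpl in *. destruct (B t) as [W [_ L]].
  + now destruct (pwalk t 0 true).
  + rewrite L. split; [easy|]. now destruct (pwalk t 0 true).
- change (senv (t :: t' :: rest)) with (snd (Bwalk t (senv (t' :: rest)) false)).
  change (swalk (t :: t' :: rest)) with (let (b, k) := swalk (t' :: rest) in
     let (b', k') := pwalk t k false in (andb b b', k')) in *.
  destruct (swalk (t' :: rest)) as [b k]. destruct (pwalk t k false) as [b' k'] eqn:Et.
  simpl in V. apply andb_true_iff in V. destruct V as [-> ->].
  destruct (IH ltac:(easy) eq_refl) as [W L]. cbn [snd] in L.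
  destruct (A t _ W) as [W2 [_ [_ L2]]]; [now rewrite L, Et|].
  split; [easy|]. rewrite L2, L, Et. easy.
Qed.

(* [n] counts the pointer leaves read so far, [m] the completed internal nodes; [cp] asks for distinct [B]'s. *)
Definition stack_ok (cp : bool) (n m : nat) (st : list ptree) : Prop :=
  length st + m = n + 1 /\ total st = m /\ fst (swalk st) = true /\ (cp = true -> NoDup (senv st)).

Definition leaf_top (st : list ptree) : Prop := exists j rest, st = PLeaf j :: rest.
Definition node_top (st : list ptree) : Prop := exists l r rest, st = PNode l r :: rest.

Definition merge (st : list ptree) : list ptree :=
  match st with r :: l :: rest => PNode l r :: rest | _ => st end.
Definition duplicates (st : list ptree) : bool :=
  match st with
  | r :: l :: rest => if in_dec bintree_eq_dec (Node (topB l rest) (topB r (l :: rest))) (senv st) then true else false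
  | _ => false
  end.

Lemma stack_ok_outside cp n m st : n < m -> ~ stack_ok cp n m st.
Proof.
intros H [A [B _]]. destruct st; simpl in *; [unfold total in B; simpl in B; lia|lia].
Qed.

Lemma stack_ok_origin cp : has_card (stack_ok cp 0 0) 1.
Proof.
exists [[PLeaf 0]]. split; [constructor; [easy|constructor]|]. split; [|easy].
intros st. split.
- intros [A [B [C _]]]. destruct st as [|t [|]]; simpl in *; try lia.
  destruct t as [j|]; unfold total in B; simpl in *; [|lia].
  destruct j; [now left|discriminate].
- intros [<-|[]]. repeat split; simpl; auto. intros _. constructor; [easy|constructor].
Qed.

(** The leaf may point to any of the [m + 1] vertices already read. It is never the left-most leaf:
    a stack consisting of that leaf alone has n = 0. *)
Lemma leaf_top_card cp n m k : 1 <= n -> has_card (stack_ok cp (n - 1) m) k ->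
  has_card (fun st => stack_ok cp n m st /\ leaf_top st) (k * (m + 1)).
Proof.
intros Hn H.
apply (has_card_image (fun p : list ptree * nat => PLeaf (snd p) :: fst p)) with
  (P := fun p => stack_ok cp (n - 1) m (fst p) /\ snd p < m + 1).
- intros [a i] [b j] _ _ e. simpl in e. congruence.
- assert (Q : forall j rest, stack_ok cp n m (PLeaf j :: rest) <-> stack_ok cp (n - 1) m rest /\ j < m + 1).
  { intros j rest. destruct rest as [|t rest].
    - unfold stack_ok, total; simpl. split; [intros [? [? _]]; lia|intros [[? [? _]] _]; lia].
    - unfold stack_ok. rewrite swalk_leaf, (swalk_total (t :: rest)) by easy.
      change (total (PLeaf j :: t :: rest)) with (total (t :: rest)).
      change (senv (PLeaf j :: t :: rest)) with (senv (t :: rest)). simpl fst. simpl length.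
      rewrite andb_true_iff, Nat.ltb_lt.
      split; [intros [? [? [[? ?] ?]]]|intros [[? [? [? ?]]] ?]]; repeat split; auto; lia. }
  intros st. split.
  + intros [S [j [rest ->]]]. apply Q in S. exists (rest, j). simpl. tauto.
  + intros [[rest j] [S ->]]. simpl in *. split; [now apply Q|]. now exists j, rest.
- apply (has_card_sigma (stack_ok cp (n - 1) m) (fun _ j => j < m + 1)); [easy|]. intros; apply has_card_lt.
Qed.

(** [merge] is a bijection from the stacks with one node fewer; for compacted trees only those
    merges are kept that append a new value to the environment. *)
Lemma node_top_card cp n m k : 1 <= m <= n ->
  has_card (fun st => stack_ok cp n (m - 1) st /\ andb cp (duplicates st) = false) k ->
  has_card (fun st => stack_ok cp n m st /\ node_top st) k.
Proof.
intros Hm H.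
assert (L : forall st, stack_ok cp n (m - 1) st -> exists r l rest, st = r :: l :: rest).
{ intros st [A _]. destruct st as [|r [|l rest]]; simpl in *; try lia. eauto. }
assert (Q : forall l r rest, stack_ok cp n m (PNode l r :: rest) <->
  stack_ok cp n (m - 1) (r :: l :: rest) /\ andb cp (duplicates (r :: l :: rest)) = false).
{ intros l r rest. unfold stack_ok, duplicates. rewrite swalk_node, senv_node.
  destruct (swalk (r :: l :: rest)) as [b k']. 
  assert (T : total (PNode l r :: rest) = S (total (r :: l :: rest))) by (unfold total; simpl; lia).
  rewrite T. simpl length. simpl fst.
  set (env := senv (r :: l :: rest)). set (c := Node (topB l rest) (topB r (l :: rest))).
  assert (ND : NoDup (env ++ [c]) <-> NoDup env /\ ~ In c env).
  { split.
    - intros N. pose proof (NoDup_remove_2 _ _ _ N) as N2. pose proof (NoDup_remove_1 _ _ _ N) as N1.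
      now rewrite app_nil_r in *.
    - intros [N1 N2]. apply NoDup_app; [easy|repeat constructor; easy|].
      intros x Hx [<-|[]]. auto. }
  rewrite ND. destruct (in_dec bintree_eq_dec c env) as [I|I]; destruct cp; simpl;
    intuition (try lia; try congruence; auto). }
apply (has_card_image merge) with (3 := H).
- intros st st' [S _] [S' _]. destruct (L _ S) as [r [l [rest ->]]]. destruct (L _ S') as [r' [l' [rest' ->]]].
  simpl. congruence.
- intros st. split.
  + intros [S [l [r [rest ->]]]]. exists (r :: l :: rest). split; [now apply Q|easy].
  + intros [st' [[S D] ->]]. destruct (L _ S) as [r [l [rest ->]]]. simpl. split; [now apply Q|].
    now exists l, r, rest.
Qed.

(* A node duplicates an earlier one only if both its children are pointers: an internal child would be the last vertex of the environment. *)
Lemma duplicates_card n m k : 1 <= m <= n -> 2 <= n -> has_card (stack_ok true (n - 2) (m - 1)) k ->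
  has_card (fun st => stack_ok true n (m - 1) st /\ duplicates st = true) (k * (m - 1)).
Proof.
intros Hm Hn H.
set (F := fun (st : list ptree) (p : nat * nat) => fst p < m /\ snd p < m /\
    In (Node (nth (fst p) (senv st) Leaf) (nth (snd p) (senv st) Leaf)) (senv st)).
assert (NE : forall st, stack_ok true (n - 2) (m - 1) st -> st <> []).
{ intros st [A [B _]] ->. unfold total in B. simpl in *. lia. }
assert (LE : forall st, stack_ok true (n - 2) (m - 1) st -> wfenv (senv st) /\ NoDup (senv st) /\ length (senv st) = m).
{ intros st S. pose proof (NE st S) as N. destruct S as [A [B [C D]]].
  destruct (senv_wf st N C) as [W E]. rewrite (swalk_total st N) in E. repeat split; auto. lia. }
apply (has_card_image (fun p : list ptree * (nat * nat) => PLeaf (snd (snd p)) :: PLeaf (fst (snd p)) :: fst p)) with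
  (P := fun p => stack_ok true (n - 2) (m - 1) (fst p) /\ F (fst p) (snd p)).
- intros [a [i j]] [b [i' j']] _ _ e. simpl in e. congruence.
- assert (Q : forall i j t rest, let st := t :: rest in
    stack_ok true n (m - 1) (PLeaf j :: PLeaf i :: st) <-> stack_ok true (n - 2) (m - 1) st /\ i < m /\ j < m).
  { intros i j t rest st. subst st. unfold stack_ok. rewrite !swalk_leaf.
    change (total (PLeaf j :: PLeaf i :: t :: rest)) with (total (t :: rest)).
    change (senv (PLeaf j :: PLeaf i :: t :: rest)) with (senv (t :: rest)). cbn [fst snd length].
    rewrite (swalk_total (t :: rest)) by easy.
    rewrite !andb_true_iff, !Nat.ltb_lt.
    split; [intros [? [? [[[? ?] ?] ?]]]|intros [[? [? [? ?]]] [? ?]]]; repeat split; auto; lia. }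
  intros st. split.
  + intros [S D]. unfold duplicates in D. destruct st as [|r [|l rest]]; try discriminate.
    destruct (in_dec _ _ _) as [I|]; [clear D|discriminate].
    pose proof S as [_ [_ [V N]]]. specialize (N eq_refl).
    destruct (senv_wf (r :: l :: rest) ltac:(easy) V) as [W _].
    destruct r as [j|rl rr].
    2:{ exfalso. rewrite senv_node, <- (topB_node rl rr (l :: rest)) in *. revert I. apply wfenv_last_not_child; auto. }
    destruct l as [i|ll lr].
    2:{ exfalso. change (senv (PLeaf j :: PNode ll lr :: rest)) with (senv (PNode ll lr :: rest)) in *.
        rewrite senv_node, <- (topB_node ll lr rest) in *. revert I. apply wfenv_last_not_child; auto. }
    destruct rest as [|t rest].
    (* Here the lower leaf is the left-most one: the environment contains no node that could be
       repeated. *)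
    { exfalso. simpl in I. destruct I as [I|[]]. discriminate. }
    apply Q in S. destruct S as [S [Hi Hj]]. exists (t :: rest, (i, j)). split; [|easy].
    split; [easy|]. unfold F. simpl fst; simpl snd. split; [easy|]. split; [easy|]. exact I.
  + intros [[st' [i j]] [[S [Hi [Hj I]]] ->]]. simpl fst in *; simpl snd in *.
    pose proof (NE st' S) as N. destruct st' as [|t rest]; [easy|].
    split; [now apply Q|]. unfold duplicates.
    destruct (in_dec _ _ _) as [|I']; [easy|]. exfalso. apply I'. exact I.
- apply (has_card_sigma (stack_ok true (n - 2) (m - 1)) F); [easy|]. intros st S.
  destruct (LE st S) as [W [N E]]. pose proof (child_pairs_card _ W N) as C. rewrite E in C. exact C.
Qed.

Lemma stack_top st : st <> [] -> leaf_top st \/ node_top st.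
Proof.
destruct st as [|[j|l r] rest]; [easy|left; now exists j, rest|right; now exists l, r, rest].
Qed.

Lemma top_split_card cp n m j k :
  m <= n -> has_card (fun st => stack_ok cp n m st /\ leaf_top st) j ->
  has_card (fun st => stack_ok cp n m st /\ node_top st) k -> has_card (stack_ok cp n m) (j + k).
Proof.
intros Hm Hj Hk.
apply has_card_ext with (fun st => (stack_ok cp n m st /\ leaf_top st) \/ (stack_ok cp n m st /\ node_top st)).
- intros st. split; [tauto|]. intros S.
  assert (N : st <> []) by (intros ->; destruct S as [A [B _]]; unfold total in B; simpl in *; lia).
  destruct (stack_top st N); tauto.
- apply has_card_union; [|easy|easy].
  intros st [_ [i [rest ->]]] [_ [l [r [rest' e]]]]. discriminate.
Qed.

Lemma node_top_bottom cp n : has_card (fun st => stack_ok cp n 0 st /\ node_top st) 0.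
Proof.
apply has_card_empty. intros st [[_ [B _]] [l [r [rest ->]]]]. unfold total in B. simpl in B. lia.
Qed.

(** Finiteness comes from the recurrence itself, by induction on [n + m], and not from an
    enumeration of trees; the counts are then extracted by description. *)
Lemma stack_finite cp n m :
  (exists k, has_card (stack_ok cp n m) k) /\ (exists k, has_card (fun st => stack_ok cp n m st /\ node_top st) k).
Proof.
assert (A : forall i n m, n + m <= i -> (exists k, has_card (stack_ok cp n m) k) /\
  (exists k, has_card (fun st => stack_ok cp n m st /\ node_top st) k)).
2:{ apply (A (n + m)). lia. }
clear n m. induction i as [|i IH]; intros n m Hi.
- replace n with 0 by lia. replace m with 0 by lia. split; [exists 1; apply stack_ok_origin|exists 0; apply node_top_bottom].
- destruct (le_lt_dec m n) as [L|L].
  2:{ split; exists 0; apply has_card_empty; intros st H; [|destruct H as [H _]]; now apply stack_ok_outside in H. }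
  assert (D : exists k, has_card (fun st => stack_ok cp n m st /\ node_top st) k).
  { destruct (Nat.eq_dec m 0) as [-> |E]; [exists 0; apply node_top_bottom|].
    destruct (IH n (m - 1)) as [[k Hk] _]; [lia|].
    destruct (has_card_split _ (fun st => andb cp (duplicates st)) k Hk) as [i1 [i2 [_ [_ H2]]]].
    exists i2. apply node_top_card; [lia|easy]. }
  split; [|easy]. destruct D as [k Hk].
  destruct (Nat.eq_dec n 0) as [-> |E].
  { replace m with 0 by lia. exists 1; apply stack_ok_origin. }
  destruct (IH (n - 1) m) as [[k' Hk'] _]; [lia|].
  exists (k' * (m + 1) + k). apply top_split_card; [easy| |easy]. apply leaf_top_card; [lia|easy].
Qed.

Definition stack_count cp n m : nat := proj1_sig (constructive_indefinite_description _ (proj1 (stack_finite cp n m))).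
Definition node_count cp n m : nat := proj1_sig (constructive_indefinite_description _ (proj2 (stack_finite cp n m))).

Lemma stack_count_spec cp n m : has_card (stack_ok cp n m) (stack_count cp n m).
Proof. apply (proj2_sig (constructive_indefinite_description _ _)). Qed.

Lemma node_count_spec cp n m : has_card (fun st => stack_ok cp n m st /\ node_top st) (node_count cp n m).
Proof. apply (proj2_sig (constructive_indefinite_description _ _)). Qed.

Lemma stack_count_step cp n m : 1 <= n -> m <= n ->
  stack_count cp n m = (m + 1) * stack_count cp (n - 1) m + node_count cp n m.
Proof.
intros Hn Hm. apply (has_card_unique (stack_ok cp n m)); [apply stack_count_spec|].
rewrite (Nat.mul_comm (m + 1)). apply top_split_card; [easy| |apply node_count_spec].
apply leaf_top_card; [easy|apply stack_count_spec].
Qed.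

Lemma node_count_relaxed n m : 1 <= m <= n -> node_count false n m = stack_count false n (m - 1).
Proof.
intros Hm. apply (has_card_unique (fun st => stack_ok false n m st /\ node_top st)); [apply node_count_spec|].
apply node_top_card; [easy|]. apply has_card_ext with (stack_ok false n (m - 1)); [|apply stack_count_spec].
intros st. simpl. tauto.
Qed.

(** Written additively to stay clear of truncated subtraction. *)
Lemma node_count_compacted n m : 2 <= n -> 1 <= m <= n ->
  node_count true n m + (m - 1) * stack_count true (n - 2) (m - 1) = stack_count true n (m - 1).
Proof.
intros Hn Hm.
destruct (has_card_split _ duplicates _ (stack_count_spec true n (m - 1))) as [i [j [E [Hi Hj]]]].
pose proof (duplicates_card n m _ Hm Hn (stack_count_spec true (n - 2) (m - 1))) as D.
rewrite (has_card_unique _ _ _ Hi D) in E.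
apply (node_top_card true n m j Hm) in Hj.
rewrite (has_card_unique _ _ _ Hj (node_count_spec true n m)) in E. lia.
Qed.

(** For m = n the length condition leaves one tree on the stack: the complete spine. *)
Lemma stack_singleton_card cp n k : has_card (stack_ok cp n n) k <-> has_card (fun t => stack_ok cp n n [t]) k.
Proof.
assert (A : forall k, has_card (fun t => stack_ok cp n n [t]) k -> has_card (stack_ok cp n n) k).
{ clear k. intros k. apply (has_card_image (fun t => [t])); [congruence|].
  intros st. split; [|intros [t [S ->]]; easy].
  intros S. pose proof S as [L _]. destruct st as [|t [|]]; simpl in L; try lia. eauto. }
split; [|apply A]. intros H. revert H.
apply (has_card_image (fun st => match st with t :: _ => t | [] => PLeaf 0 end)).
- intros st st' [L _] [L' _]. destruct st as [|t [|]]; simpl in L; try lia. destruct st' as [|t' [|]]; simpl in L'; try lia. congruence.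
- intros t. split; [intros S; now exists [t]|]. intros [st [S ->]].
  pose proof S as [L _]. destruct st as [|t' [|]]; simpl in L; try lia. easy.
Qed.

Lemma relaxed_stack n t : is_relaxed n t <-> stack_ok false n n [t].
Proof.
unfold is_relaxed, stack_ok, total. simpl. destruct (pwalk t 0 true). simpl. rewrite Nat.add_0_r.
intuition (try lia; try discriminate).
Qed.

Lemma compacted_stack n t : is_compacted n t <-> stack_ok true n n [t].
Proof.
unfold is_compacted, is_relaxed, Blist, stack_ok, total. simpl. destruct (pwalk t 0 true). simpl. rewrite Nat.add_0_r.
intuition lia.
Qed.

End Combinatorics.

(** * The Airy function *)

Lemma mean_value (f df : R -> R) (a b : R) :
  a < b -> (forall x, a <= x <= b -> is_derive f x (df x)) ->
  exists c, a <= c <= b /\ f b - f a = df c * (b - a).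
Proof.
intros ab H.
destruct (MVT_gen f a b df) as [c [Hc E]].
- rewrite Rmin_left, Rmax_right by lra; intros x Hx; apply H; lra.
- rewrite Rmin_left, Rmax_right by lra; intros x Hx.
  apply derivable_continuous_pt. exists (df x). now apply is_derive_Reals, H.
- rewrite Rmin_left, Rmax_right in Hc by lra. now exists c.
Qed.

Lemma derive_nonneg_le (f df : R -> R) (a b : R) :
  a <= b -> (forall x, a <= x <= b -> is_derive f x (df x)) ->
  (forall x, a <= x <= b -> 0 <= df x) -> f a <= f b.
Proof.
intros [ab| ->] H P; [|lra].
destruct (mean_value f df a b ab H) as [c [Hc E]].
specialize (P c Hc). nra.
Qed.

Lemma derive_nonpos_ge (f df : R -> R) (a b : R) :
  a <= b -> (forall x, a <= x <= b -> is_derive f x (df x)) ->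
  (forall x, a <= x <= b -> df x <= 0) -> f b <= f a.
Proof.
intros [ab| ->] H P; [|lra].
destruct (mean_value f df a b ab H) as [c [Hc E]].
specialize (P c Hc). nra.
Qed.

Lemma continuous_bounded (f : R -> R) (a b : R) :
  a <= b -> (forall x, a <= x <= b -> continuity_pt f x) ->
  exists C, 0 < C /\ forall x, a <= x <= b -> Rabs (f x) <= C.
Proof.
intros ab H.
destruct (continuity_ab_maj f a b ab H) as [M [HM _]].
destruct (continuity_ab_min f a b ab H) as [m [Hm _]].
exists (Rabs (f M) + Rabs (f m) + 1). split.
{ pose proof (Rabs_pos (f M)); pose proof (Rabs_pos (f m)); lra. }
intros x Hx. specialize (HM x Hx). specialize (Hm x Hx).
pose proof (Rle_abs (f M)). pose proof (Rle_abs (- f m)). rewrite Rabs_Ropp in *.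
pose proof (Rabs_pos (f M)); pose proof (Rabs_pos (f m)).
apply Rabs_le; lra.
Qed.

Lemma continuous_pos_bounded_below (f : R -> R) (a b : R) :
  a <= b -> (forall x, a <= x <= b -> continuity_pt f x) ->
  (forall x, a <= x <= b -> 0 < f x) ->
  exists c, 0 < c /\ forall x, a <= x <= b -> c <= f x.
Proof.
intros ab H P.
destruct (continuity_ab_min f a b ab H) as [m [Hm mab]].
exists (f m). split; [now apply P|]. exact Hm.
Qed.

Section Airy.

Variables (y y' : R -> R) (a1 : R).
Hypothesis dy : forall x, is_derive y x (y' x).
Hypothesis dy' : forall x, is_derive y' x (x * y x).
Hypothesis y_lim : is_lim y p_infty 0.
Hypothesis y_a1 : y a1 = 0.
Hypothesis y_pos : forall x, a1 < x -> 0 < y x.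

Lemma airy_cont x : continuity_pt y x.
Proof.
apply derivable_continuous_pt. exists (y' x). now apply is_derive_Reals.
Qed.

Lemma airy'_cont x : continuity_pt y' x.
Proof.
apply derivable_continuous_pt. exists (x * y x). now apply is_derive_Reals.
Qed.

Lemma airy_not_bounded_below c x0 : 0 < c -> ~ (forall x, x0 <= x -> c <= y x).
Proof.
intros Hc H.
apply is_lim_spec in y_lim. destruct (y_lim (mkposreal c Hc)) as [M HM]. simpl in HM.
set (x := Rmax x0 M + 1).
assert (x0 <= x) by (unfold x; pose proof (Rmax_l x0 M); lra).
assert (M < x) by (unfold x; pose proof (Rmax_r x0 M); lra).
specialize (HM x H1). specialize (H x H0).
rewrite Rminus_0_r in HM. pose proof (Rle_abs (y x)). lra.
Qed.

(** To the right of 0 the function is convex, so a positive slope would persist and keep [y] away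
    from its limit 0. *)
Lemma airy_decreasing_right x : 0 <= x -> a1 < x -> y' x <= 0.
Proof.
intros x0 xa. destruct (Rle_or_lt (y' x) 0) as [|P]; [easy|exfalso].
apply (airy_not_bounded_below (y x) x (y_pos x xa)).
intros z Hz. apply (derive_nonneg_le y y'); [easy|intros; apply dy|].
intros t Ht. apply Rle_trans with (y' x); [lra|].
apply (derive_nonneg_le y' (fun x => x * y x)); [lra|intros; apply dy'|].
intros s Hs. assert (0 < y s) by (apply y_pos; lra). nra.
Qed.

(** If the zero were nonnegative, convexity to its right would yield a positive slope, against
    [airy_decreasing_right]. *)
Lemma airy_zero_neg : a1 < 0.
Proof.
destruct (Rlt_or_le a1 0) as [|P]; [easy|exfalso].
destruct (mean_value y y' a1 (a1 + 1)) as [c [Hc E]]; [lra|intros; apply dy|].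
assert (Y : 0 < y (a1 + 1)) by (apply y_pos; lra).
rewrite y_a1 in E. replace (a1 + 1 - a1) with 1 in E by ring.
destruct (Req_dec c a1) as [->|N].
- assert (0 < y' a1) by lra.
  assert (Z : y' a1 <= y' (a1 + 1)).
  { apply (derive_nonneg_le y' (fun x => x * y x)); [lra|intros; apply dy'|].
    intros s Hs. destruct (Req_dec s a1) as [->|]; [rewrite y_a1; lra|].
    assert (0 < y s) by (apply y_pos; lra). nra. }
  pose proof (airy_decreasing_right (a1 + 1)). lra.
- pose proof (airy_decreasing_right c). lra.
Qed.

(** Between [a1] and 0 the function is concave: a nonpositive slope at [a1] would force y 0 <= 0. *)
Lemma airy'_zero_pos : 0 < y' a1.
Proof.
destruct (Rlt_or_le 0 (y' a1)) as [|P]; [easy|exfalso].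
pose proof airy_zero_neg.
assert (Z : y 0 <= y a1).
{ apply (derive_nonpos_ge y y'); [lra|intros; apply dy|].
  intros x Hx. apply Rle_trans with (y' a1); [|lra].
  apply (derive_nonpos_ge y' (fun x => x * y x)); [lra|intros; apply dy'|].
  intros s Hs. destruct (Req_dec s a1) as [->|]; [rewrite y_a1; lra|].
  assert (0 < y s) by (apply y_pos; lra). nra. }
pose proof (y_pos 0). lra.
Qed.

(** The derivative of exp (- x) (y' + y) is exp (- x) (x - 1) y >= 0, so a positive value of y' + y
    would remain a lower bound for it, hence for [y], because y' <= 0. *)
Lemma airy_log_derivative_upper x : 1 <= x -> y' x + y x <= 0.
Proof.
intros Hx. pose proof airy_zero_neg as A.
destruct (Rle_or_lt (y' x + y x) 0) as [|P]; [easy|exfalso].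
apply (airy_not_bounded_below (y' x + y x) x P).
intros z Hz.
assert (D : exp (- x) * (y' x + y x) <= exp (- z) * (y' z + y z)).
{ apply (derive_nonneg_le (fun x => exp (- x) * (y' x + y x))
     (fun x => exp (- x) * ((x - 1) * y x))); [easy| |].
  - intros t _. auto_derive.
    + repeat split; first [exact (ex_intro _ _ (dy' t)) | exact (ex_intro _ _ (dy t))].
    + replace (Derive (fun x => y' x) t) with (t * y t) by (symmetry; apply is_derive_unique, dy').
      replace (Derive (fun x => y x) t) with (y' t) by (symmetry; apply is_derive_unique, dy).
      ring.
  - intros t Ht. assert (0 < y t) by (apply y_pos; lra). pose proof (exp_pos (- t)).
    apply Rmult_le_pos; [lra|]. apply Rmult_le_pos; lra. }
assert (y' z <= 0) by (apply airy_decreasing_right; lra).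
assert (exp (- z) <= exp (- x)) by (destruct Hz as [Hz| ->]; [left; apply exp_increasing; lra|lra]).
pose proof (exp_pos (- z)). nra.
Qed.

Lemma airy_decay x : 1 <= x -> y x <= y 1 * exp 1 * exp (- x).
Proof.
intros Hx.
assert (D : exp x * y x <= exp 1 * y 1).
{ apply (derive_nonpos_ge (fun x => exp x * y x) (fun x => exp x * (y' x + y x))); [easy| |].
  - intros t _. auto_derive.
    + eexists; apply dy.
    + replace (Derive (fun x => y x) t) with (y' t) by (symmetry; apply is_derive_unique, dy).
      ring.
  - intros t Ht. pose proof (airy_log_derivative_upper t). pose proof (exp_pos t). nra. }
rewrite exp_Ropp. pose proof (exp_pos x).
apply Rmult_le_reg_l with (exp x); [easy|].
replace (exp x * (y 1 * exp 1 * / exp x)) with (exp 1 * y 1) by (field; lra). easy.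
Qed.

(** By convexity the slope at x is at most, in absolute value, the mean slope over [x - 1, x], hence
    at most y (x - 1). *)
Lemma airy'_decay x : 2 <= x -> Rabs (y' x) <= y 1 * exp 2 * exp (- x).
Proof.
intros Hx. pose proof airy_zero_neg as A.
destruct (mean_value y y' (x - 1) x) as [c [Hc E]]; [lra|intros; apply dy|].
assert (N : y' x <= 0) by (apply airy_decreasing_right; lra).
assert (y' c <= y' x).
{ apply (derive_nonneg_le y' (fun x => x * y x)); [lra|intros; apply dy'|].
  intros s Hs. assert (0 < y s) by (apply y_pos; lra). nra. }
assert (0 < y x) by (apply y_pos; lra).
assert (D : y (x - 1) <= y 1 * exp 1 * exp (- (x - 1))) by (apply airy_decay; lra).
replace (- (x - 1)) with (1 + - x) in D by ring. rewrite exp_plus in D.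
rewrite Rabs_left1 by easy. replace 2 with (1 + 1) by ring. rewrite exp_plus. nra.
Qed.

(** Multiplied by exp (- (x + 1)^2 / 2) the expression is nonincreasing, so from a negative value
    [w] on it would stay at most [w]. As y > 0, this contradicts the decay of [y']. *)
Lemma airy_log_derivative_lower x : 1 <= x -> 0 <= y' x + (x + 1) * y x.
Proof.
intros Hx. pose proof airy_zero_neg as A.
destruct (Rle_or_lt 0 (y' x + (x + 1) * y x)) as [|P]; [easy|exfalso].
set (w := y' x + (x + 1) * y x) in *.
assert (B : forall z, x <= z -> y' z + (z + 1) * y z <= w).
{ intros z Hz.
  set (g := fun x => exp (- ((x + 1) * (x + 1) / 2)) * (y' x + (x + 1) * y x)).
  assert (D : g z <= g x).
  { apply (derive_nonpos_ge g
     (fun x => exp (- ((x + 1) * (x + 1) / 2)) * (- (x * (x + 1) * y x)))); [easy| |].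
    - intros t _. unfold g. auto_derive.
      + repeat split; first [exact (ex_intro _ _ (dy' t)) | exact (ex_intro _ _ (dy t))].
      + replace (Derive (fun x => y' x) t) with (t * y t) by (symmetry; apply is_derive_unique, dy').
        replace (Derive (fun x => y x) t) with (y' t) by (symmetry; apply is_derive_unique, dy).
        unfold Rdiv. field.
    - intros t Ht. assert (0 < y t) by (apply y_pos; lra).
      pose proof (exp_pos (- ((t + 1) * (t + 1) / 2))).
      assert (0 <= t * (t + 1) * y t) by (apply Rmult_le_pos; nra). nra. }
  unfold g in D. fold w in D.
  set (p := exp (- ((z + 1) * (z + 1) / 2))) in *.
  set (q := exp (- ((x + 1) * (x + 1) / 2))) in *.
  assert (p <= q).
  { unfold p, q. destruct Hz as [Hz| ->]; [left; apply exp_increasing; nra|lra]. }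
  assert (0 < p) by apply exp_pos.
  assert (p * (y' z + (z + 1) * y z) <= p * w) by nra.
  nra. }
set (C := y 1 * exp 2).
assert (C0 : 0 < C) by (unfold C; apply Rmult_lt_0_compat; [apply y_pos; lra|apply exp_pos]).
(* Chosen so that C < - w z, hence C exp (- z) < - w because z <= exp z. *)
set (z := Rmax (Rmax x 2) (C / - w + 1)).
assert (x <= z) by (unfold z; eapply Rle_trans; [apply Rmax_l|apply Rmax_l]).
assert (2 <= z) by (unfold z; eapply Rle_trans; [apply Rmax_r|apply Rmax_l]).
assert (C / - w + 1 <= z) by apply Rmax_r.
specialize (B z H). pose proof (airy'_decay z H0) as D. fold C in D.
assert (0 < y z) by (apply y_pos; lra).
assert (- y' z <= C * exp (- z)) by (pose proof (Rle_abs (- y' z)); rewrite Rabs_Ropp in *; lra).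
assert (- w <= C * exp (- z)) by nra.
assert (C < - w * z).
{ assert (C / - w < z) by lra. apply Rmult_lt_compat_l with (r := - w) in H5; [|lra].
  replace (- w * (C / - w)) with C in H5 by (field; lra). easy. }
assert (E : z <= exp z) by (pose proof (exp_ineq1_le z); lra).
rewrite exp_Ropp in H4. pose proof (exp_pos z).
assert (- w * exp z <= C).
{ apply Rmult_le_compat_r with (r := exp z) in H4; [|lra].
  replace (C * / exp z * exp z) with C in H4 by (field; lra). easy. }
nra.
Qed.

(** Continuity covers the stretch from [a1] to 2; the factor [E] absorbs it and turns exp (- (a1 +
    z)) into exp (- z). *)
Lemma airy_exp_bound :
  exists C, 0 < C /\ forall z, 0 <= z ->
    Rabs (y (a1 + z)) <= C * exp (- z) /\ Rabs (y' (a1 + z)) <= C * exp (- z).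
Proof.
pose proof airy_zero_neg as A.
destruct (continuous_bounded y a1 2) as [C1 [P1 H1]]; [lra|intros; apply airy_cont|].
destruct (continuous_bounded y' a1 2) as [C2 [P2 H2]]; [lra|intros; apply airy'_cont|].
set (C3 := y 1 * exp 2).
assert (C30 : 0 < C3) by (unfold C3; apply Rmult_lt_0_compat; [apply y_pos; lra|apply exp_pos]).
set (E := exp (2 - a1)).
assert (E1 : 1 <= E) by (unfold E; pose proof (exp_ineq1_le (2 - a1)); lra).
exists ((C1 + C2 + C3) * E). split; [apply Rmult_lt_0_compat; lra|].
assert (K : forall z v, 0 <= z -> (a1 + z <= 2 -> Rabs v <= C1 + C2) ->
   (2 <= a1 + z -> Rabs v <= C3 * exp (- (a1 + z))) ->
   Rabs v <= (C1 + C2 + C3) * E * exp (- z)).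
{ intros z v z0 K1 K2. destruct (Rle_or_lt (a1 + z) 2) as [L|L].
  - assert (1 <= E * exp (- z)).
    { unfold E. rewrite <- exp_plus. pose proof (exp_ineq1_le (2 - a1 + - z)). lra. }
    specialize (K1 L). nra.
  - assert (L2 : 2 <= a1 + z) by lra. specialize (K2 L2).
    assert (exp (- (a1 + z)) <= E * exp (- z)).
    { unfold E. rewrite <- exp_plus. left. apply exp_increasing. lra. }
    pose proof (exp_pos (- (a1 + z))). nra. }
intros z z0. split.
- apply K; [easy| |].
  + intros L. specialize (H1 (a1 + z)). lra.
  + intros L. pose proof (airy_decay (a1 + z)) as D.
    assert (0 <= y (a1 + z)) by (left; apply y_pos; lra).
    rewrite Rabs_pos_eq by easy. unfold C3.
    assert (0 < y 1) by (apply y_pos; lra).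
    assert (exp 1 <= exp 2) by (left; apply exp_increasing; lra).
    pose proof (exp_pos (- (a1 + z))).
    eapply Rle_trans; [apply D; lra|]. apply Rmult_le_compat_r; [lra|]. nra.
- apply K; [easy| |].
  + intros L. specialize (H2 (a1 + z)). lra.
  + intros L. unfold C3. apply airy'_decay. lra.
Qed.

Lemma airy_increasing_near_zero :
  exists d, 0 < d /\ forall z, 0 <= z <= d -> y' a1 / 2 <= y' (a1 + z).
Proof.
pose proof airy'_zero_pos as P.
destruct (airy'_cont a1 (y' a1 / 2)) as [d [Hd H]]; [lra|].
exists (d / 2). split; [lra|]. intros z Hz.
destruct (Req_dec z 0) as [->|N]; [rewrite Rplus_0_r; lra|].
assert (B : Rabs (y' (a1 + z) - y' a1) < y' a1 / 2).
{ apply H. split.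
  - split; [exact I|]. lra.
  - simpl. unfold Rdist. replace (a1 + z - a1) with z by ring. rewrite Rabs_pos_eq; lra. }
apply Rabs_def2 in B. lra.
Qed.

Lemma airy_linear_lower M :
  exists c, 0 < c /\ forall z, 0 <= z <= M -> c * z <= y (a1 + z).
Proof.
pose proof airy'_zero_pos as P.
destruct airy_increasing_near_zero as [d [d0 Hd]].
assert (L : forall z, 0 <= z <= d -> y' a1 / 2 * z <= y (a1 + z)).
{ intros z Hz.
  assert (y a1 - y' a1 / 2 * (a1 - a1) <= y (a1 + z) - y' a1 / 2 * (a1 + z - a1)); [|rewrite y_a1 in *; lra].
  apply (derive_nonneg_le (fun x => y x - y' a1 / 2 * (x - a1)) (fun x => y' x - y' a1 / 2)); [lra| |].
  - intros x _. auto_derive; [eexists; apply dy|].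
    replace (Derive (fun x => y x) x) with (y' x) by (symmetry; apply is_derive_unique, dy). ring.
  - intros x Hx. specialize (Hd (x - a1)). replace (a1 + (x - a1)) with x in Hd by ring. lra. }
destruct (Rle_or_lt M d) as [Md|Md].
{ exists (y' a1 / 2). split; [lra|]. intros; apply L; lra. }
destruct (continuous_pos_bounded_below y (a1 + d) (a1 + M)) as [c [c0 Hc]].
- lra.
- intros; apply airy_cont.
- intros; apply y_pos; lra.
- exists (Rmin (y' a1 / 2) (c / M)). split.
  { apply Rmin_pos; [lra|]. apply Rdiv_lt_0_compat; lra. }
  intros z Hz. destruct (Rle_or_lt z d) as [|Z].
  + specialize (L z). pose proof (Rmin_l (y' a1 / 2) (c / M)). nra.
  + specialize (Hc (a1 + z)). pose proof (Rmin_r (y' a1 / 2) (c / M)).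
    assert (c / M * z <= c).
    { replace c with (c / M * M) at 2 by (field; lra).
      apply Rmult_le_compat_l; [left; apply Rdiv_lt_0_compat; lra|lra]. }
    assert (c <= y (a1 + z)) by (apply Hc; lra). nra.
Qed.

Lemma airy_log_derivative_bound :
  exists C, 0 < C /\ forall z, 0 <= z -> 0 <= y' (a1 + z) + C * (1 + z) * y (a1 + z).
Proof.
pose proof airy'_zero_pos as P. pose proof airy_zero_neg as A.
destruct airy_increasing_near_zero as [d [d0 Hd]].
destruct (airy_linear_lower (1 - a1)) as [c [c0 Hc]].
destruct (continuous_bounded y' a1 1) as [C2 [P2 H2]]; [lra|intros; apply airy'_cont|].
set (C := C2 / (c * d)).
assert (C0 : 0 < C) by (apply Rdiv_lt_0_compat; nra).
exists (C + 1). split; [lra|]. intros z z0.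
assert (Y : 0 <= y (a1 + z)).
{ destruct z0 as [z0| <-]; [left; apply y_pos; lra|rewrite Rplus_0_r, y_a1; lra]. }
destruct (Rle_or_lt z d) as [Z|Z].
{ specialize (Hd z). assert (0 <= (C + 1) * (1 + z) * y (a1 + z)) by (apply Rmult_le_pos; nra). lra. }
destruct (Rle_or_lt (a1 + z) 1) as [Z1|Z1].
- specialize (Hc z). specialize (H2 (a1 + z)).
  assert (- C2 <= y' (a1 + z)).
  { assert (Rabs (y' (a1 + z)) <= C2) by (apply H2; lra). pose proof (Rle_abs (- y' (a1 + z))).
    rewrite Rabs_Ropp in *. lra. }
  assert (c * d <= y (a1 + z)) by nra.
  assert (C2 = C * (c * d)) by (unfold C; field; lra).
  assert (C * (c * d) <= C * y (a1 + z)) by (apply Rmult_le_compat_l; lra).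
  assert (0 <= (C * z + (1 + z)) * y (a1 + z)) by (apply Rmult_le_pos; nra).
  nra.
- assert (L := airy_log_derivative_lower (a1 + z)).
  assert (0 <= y' (a1 + z) + (a1 + z + 1) * y (a1 + z)) by (apply L; lra).
  assert (0 <= (C * (1 + z) - a1) * y (a1 + z)) by (apply Rmult_le_pos; nra).
  nra.
Qed.

(** The previous bound in integrated form: y (a1 + z) exp (C (z + z^2/2)) is nondecreasing. It
    compares the profile at neighbouring heights far from the zero as well as near it. *)
Lemma airy_ratio_bound :
  exists C, 0 < C /\ forall z z', 0 <= z' <= z ->
    y (a1 + z') <= y (a1 + z) * exp (C * (z - z') * (1 + z)).
Proof.
destruct airy_log_derivative_bound as [C [C0 H]].
exists C. split; [easy|]. intros z z' Hz.
set (g := fun z => y (a1 + z) * exp (C * (z + z * z / 2))).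
assert (D : g z' <= g z).
{ apply (derive_nonneg_le g (fun z => (y' (a1 + z) + C * (1 + z) * y (a1 + z)) * exp (C * (z + z * z / 2)))); [lra| |].
  - intros x _. unfold g. auto_derive; [eexists; apply dy|].
    replace (Derive (fun x => y x) (a1 + x)) with (y' (a1 + x)) by (symmetry; apply is_derive_unique, dy).
    unfold Rdiv. field.
  - intros x Hx. apply Rmult_le_pos; [apply H; lra|left; apply exp_pos]. }
unfold g in D.
assert (0 <= y (a1 + z)).
{ destruct (Req_dec z 0) as [->|]; [rewrite Rplus_0_r, y_a1; lra|left; apply y_pos; lra]. }
set (e := exp (C * (z' + z' * z' / 2))) in *.
assert (e0 : 0 < e) by apply exp_pos.
assert (B : exp (C * (z + z * z / 2)) <= exp (C * (z - z') * (1 + z)) * e).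
{ unfold e. rewrite <- exp_plus.
  assert (Q : C * (z + z * z / 2) <= C * (z - z') * (1 + z) + C * (z' + z' * z' / 2)).
  { assert (0 <= C * ((z - z') * (z - z'))) by (apply Rmult_le_pos; [lra|apply Rle_0_sqr]). lra. }
  destruct Q as [Q| ->]; [left; now apply exp_increasing|lra]. }
apply Rmult_le_reg_r with e; [easy|]. nra.
Qed.

End Airy.

(** * The scale h and its behaviour under shifts of t *)

Definition hh (t : R) : R := Rpower (2 / t) (1 / 3).

Lemma hh_pos t : 0 < hh t.
Proof. apply exp_pos. Qed.

Lemma hh_cube t : 0 < t -> hh t ^ 3 = 2 / t.
Proof.
intros Ht. unfold hh. assert (0 < 2 / t) by (apply Rdiv_lt_0_compat; lra).
rewrite <- Rpower_pow by apply exp_pos. rewrite Rpower_mult.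
replace (1 / 3 * INR 3) with 1 by (simpl; field). now apply Rpower_1.
Qed.

Lemma hh_cube_mul t : 0 < t -> hh t ^ 3 * t = 2.
Proof. intros Ht. rewrite hh_cube by easy. field. lra. Qed.

Lemma pow3_le_reg a b : 0 <= b -> a ^ 3 <= b ^ 3 -> a <= b.
Proof.
intros Hb H. destruct (Rle_or_lt a b) as [|L]; [easy|exfalso].
assert (0 < a ^ 2 + a * b + b ^ 2) by nra.
assert (0 < (a - b) * (a ^ 2 + a * b + b ^ 2)) by (apply Rmult_lt_0_compat; lra).
replace ((a - b) * (a ^ 2 + a * b + b ^ 2)) with (a ^ 3 - b ^ 3) in H1 by ring. lra.
Qed.

Lemma hh_le_half t : 16 <= t -> hh t <= / 2.
Proof.
intros Ht. apply pow3_le_reg; [lra|].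
rewrite hh_cube by lra. apply Rmult_le_reg_r with t; [lra|].
unfold Rdiv. rewrite Rmult_assoc, Rinv_l by lra. simpl; lra.
Qed.

Lemma cube_root_expand e q :
  0 <= e <= / 4 -> 0 <= q -> q ^ 3 * (1 - e) = 1 ->
  1 + e / 3 <= q <= 1 + e / 3 + e ^ 2.
Proof.
intros He Hq H.
assert (q ^ 3 = / (1 - e)) by (apply Rmult_eq_reg_r with (1 - e); [rewrite H; field|]; lra).
assert (P3 : 0 <= e * e * e) by (apply Rmult_le_pos; nra).
assert (P4 : 0 <= e * e * e * e) by (apply Rmult_le_pos; nra).
assert (P5 : 0 <= e * e * e * e * e) by (apply Rmult_le_pos; nra).
assert (P6 : 0 <= e * e * e * e * e * e) by (apply Rmult_le_pos; nra).
split; (apply pow3_le_reg; [nra|]); rewrite H0; apply Rmult_le_reg_r with (1 - e); try lra;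
  rewrite Rinv_l by lra.
- replace ((1 + e / 3) ^ 3 * (1 - e)) with (1 - e * e * (18 + 8 * e + e * e) / 27) by field.
  assert (0 <= e * e * (18 + 8 * e + e * e)) by (apply Rmult_le_pos; nra). lra.
- apply Rle_trans with ((1 + e + 3 * e ^ 2) * (1 - e)).
  + assert (0 <= e * e * (2 - 3 * e)) by (apply Rmult_le_pos; nra). nra.
  + apply Rmult_le_compat_r; [lra|]. nra.
Qed.

(** A shift of t by [a] divides the cube of h by 1 - a/t, and a/t = a h^3/2. *)
Lemma hh_ratio_expand a t :
  0 <= a <= 3 -> 16 <= t ->
  let e := a * hh t ^ 3 / 2 in
  1 + e / 3 <= hh (t - a) / hh t <= 1 + e / 3 + e ^ 2.
Proof.
intros Ha Ht e. pose proof (hh_pos t). pose proof (hh_pos (t - a)).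
assert (E : e = a / t) by (unfold e; rewrite hh_cube by lra; field; lra).
apply cube_root_expand.
- rewrite E. split; [apply Rmult_le_pos; [|left; apply Rinv_0_lt_compat]; lra|].
  apply Rmult_le_reg_r with t; [lra|]. unfold Rdiv. rewrite Rmult_assoc, Rinv_l by lra. lra.
- left. now apply Rdiv_lt_0_compat.
- unfold Rdiv. rewrite Rpow_mult_distr, pow_inv, !hh_cube by lra. rewrite E. field. lra.
Qed.

(** * Symbols in the scaling variables *)

(* The bound [k <= t + 1] corresponds to [m >= 0]. *)
Definition Dom (t k : R) : Prop := 32 <= t /\ 1 <= k <= t + 1.

(* Functions of polynomial growth in the scaled height [z = h k], uniformly in [t]. *)
Definition Bd (F : R -> R -> R) : Prop :=
  exists C p, 0 <= C /\ forall t k, Dom t k -> Rabs (F t k) <= C * (1 + hh t * k) ^ p.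

(** The last bound is h^3 k = 2 k/t. Since heights go up to t + 1, it is h^2 z, not z, that stays
    bounded. *)
Lemma Dom_z t k : Dom t k -> 0 < hh t <= / 2 /\ hh t <= hh t * k /\ hh t ^ 2 * (hh t * k) <= 3.
Proof.
intros [Ht Hk]. pose proof (hh_pos t). split; [|split].
- split; [easy|apply hh_le_half; lra].
- nra.
- replace (hh t ^ 2 * (hh t * k)) with (hh t ^ 3 * k) by ring.
  rewrite hh_cube by lra. apply Rmult_le_reg_r with t; [lra|].
  replace (2 / t * k * t) with (2 * k) by (field; lra). lra.
Qed.

Lemma Bd_weaken F C p q : (p <= q)%nat -> 0 <= C ->
  (forall t k, Dom t k -> Rabs (F t k) <= C * (1 + hh t * k) ^ p) ->
  forall t k, Dom t k -> Rabs (F t k) <= C * (1 + hh t * k) ^ q.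
Proof.
intros pq C0 H t k D. eapply Rle_trans; [apply H, D|].
destruct (Dom_z t k D) as [H1 [H2 _]].
apply Rmult_le_compat_l; [easy|]. apply Rle_pow; [lra|easy].
Qed.

Lemma Bd_le F G : (forall t k, Dom t k -> Rabs (F t k) <= Rabs (G t k)) -> Bd G -> Bd F.
Proof.
intros H [C [p [C0 B]]]. exists C, p. split; [easy|].
intros t k D. eapply Rle_trans; [apply H, D|apply B, D].
Qed.

Lemma Bd_ext F G : (forall t k, Dom t k -> F t k = G t k) -> Bd G -> Bd F.
Proof. intros H. apply Bd_le. intros t k D. rewrite H by easy. lra. Qed.

Lemma Bd_bounded F C : (forall t k, Dom t k -> Rabs (F t k) <= C) -> Bd F.
Proof.
intros H. exists (Rabs C), 0%nat. split; [apply Rabs_pos|].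
intros t k D. specialize (H t k D). pose proof (Rle_abs C). simpl. lra.
Qed.

Lemma Bd_const c : Bd (fun _ _ => c).
Proof. apply Bd_bounded with (Rabs c). intros; lra. Qed.

Lemma Bd_h : Bd (fun t _ => hh t).
Proof.
apply Bd_bounded with 1. intros t k D. destruct (Dom_z t k D) as [[? ?] _].
rewrite Rabs_pos_eq; lra.
Qed.

Lemma Bd_z : Bd (fun t k => hh t * k).
Proof.
exists 1, 1%nat. split; [lra|]. intros t k D. destruct (Dom_z t k D) as [[? ?] [? _]].
rewrite Rabs_pos_eq by lra. simpl. lra.
Qed.

Lemma Bd_plus F G : Bd F -> Bd G -> Bd (fun t k => F t k + G t k).
Proof.
intros [C [p [C0 B]]] [C' [p' [C0' B']]]. exists (C + C'), (max p p'). split; [lra|].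
intros t k D. eapply Rle_trans; [apply Rabs_triang|].
pose proof (Bd_weaken F C p (max p p') (Nat.le_max_l _ _) C0 B t k D).
pose proof (Bd_weaken G C' p' (max p p') (Nat.le_max_r _ _) C0' B' t k D). lra.
Qed.

Lemma Bd_mult F G : Bd F -> Bd G -> Bd (fun t k => F t k * G t k).
Proof.
intros [C [p [C0 B]]] [C' [p' [C0' B']]]. exists (C * C'), (p + p')%nat. split; [nra|].
intros t k D. rewrite Rabs_mult, pow_add.
replace (C * C' * _) with ((C * (1 + hh t * k) ^ p) * (C' * (1 + hh t * k) ^ p')) by ring.
apply Rmult_le_compat; try apply Rabs_pos; auto.
Qed.

Lemma Bd_opp F : Bd F -> Bd (fun t k => - F t k).
Proof. apply Bd_le. intros. rewrite Rabs_Ropp. lra. Qed.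

Lemma Bd_minus F G : Bd F -> Bd G -> Bd (fun t k => F t k - G t k).
Proof. intros. apply Bd_plus; [easy|now apply Bd_opp]. Qed.

Lemma Bd_pow F n : Bd F -> Bd (fun t k => F t k ^ n).
Proof. intros H. induction n; simpl; [apply Bd_const|now apply Bd_mult]. Qed.

Lemma Bd_div_const F c : Bd F -> Bd (fun t k => F t k / c).
Proof. intros H. apply Bd_mult; [easy|apply Bd_const]. Qed.

Ltac bd := repeat first
  [ assumption
  | match goal with |- Bd (fun _ _ => ?c) => apply (Bd_const c) end
  | apply Bd_h | apply Bd_z
  | apply Bd_plus | apply Bd_minus | apply Bd_mult | apply Bd_opp | apply Bd_pow | apply Bd_div_const ].

(* [F = c0 + c1 h + c2 h^2 + c3 h^3 + O(h^4)] with coefficients depending on [z]. *)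
Record Ex (F c0 c1 c2 c3 : R -> R -> R) : Prop := mkEx {
  ex0 : Bd c0; ex1 : Bd c1; ex2 : Bd c2; ex3 : Bd c3;
  exr : exists r, Bd r /\ forall t k, Dom t k ->
    F t k = c0 t k + c1 t k * hh t + c2 t k * hh t ^ 2 + c3 t k * hh t ^ 3 + hh t ^ 4 * r t k }.

(** The rules below produce unsimplified coefficients; this lemma exchanges them for the intended
    ones, leaving field identities to check. *)
Lemma Ex_ext F G c0 c1 c2 c3 d0 d1 d2 d3 :
  (forall t k, Dom t k -> F t k = G t k) ->
  (forall t k, Dom t k -> c0 t k = d0 t k) -> (forall t k, Dom t k -> c1 t k = d1 t k) ->
  (forall t k, Dom t k -> c2 t k = d2 t k) -> (forall t k, Dom t k -> c3 t k = d3 t k) ->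
  Ex G d0 d1 d2 d3 -> Ex F c0 c1 c2 c3.
Proof.
intros H H0 H1 H2 H3 [B0 B1 B2 B3 [r [Br E]]].
split; try (eapply Bd_ext; eauto; fail).
exists r. split; [easy|]. intros t k D. rewrite H, H0, H1, H2, H3 by easy. now apply E.
Qed.

Lemma Ex_plus F c0 c1 c2 c3 G d0 d1 d2 d3 : Ex F c0 c1 c2 c3 -> Ex G d0 d1 d2 d3 ->
  Ex (fun t k => F t k + G t k) (fun t k => c0 t k + d0 t k) (fun t k => c1 t k + d1 t k)
    (fun t k => c2 t k + d2 t k) (fun t k => c3 t k + d3 t k).
Proof.
intros [B0 B1 B2 B3 [r [Br E]]] [B0' B1' B2' B3' [r' [Br' E']]].
split; bd. exists (fun t k => r t k + r' t k). split; [bd|].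
intros t k D. rewrite E, E' by easy. ring.
Qed.

Lemma Ex_mult F c0 c1 c2 c3 G d0 d1 d2 d3 : Ex F c0 c1 c2 c3 -> Ex G d0 d1 d2 d3 ->
  Ex (fun t k => F t k * G t k) (fun t k => c0 t k * d0 t k)
    (fun t k => c0 t k * d1 t k + c1 t k * d0 t k)
    (fun t k => c0 t k * d2 t k + c1 t k * d1 t k + c2 t k * d0 t k)
    (fun t k => c0 t k * d3 t k + c1 t k * d2 t k + c2 t k * d1 t k + c3 t k * d0 t k).
Proof.
intros [B0 B1 B2 B3 [r [Br E]]] [B0' B1' B2' B3' [r' [Br' E']]].
split; bd.
exists (fun t k => (c1 t k * d3 t k + c2 t k * d2 t k + c3 t k * d1 t k)
  + hh t * (c2 t k * d3 t k + c3 t k * d2 t k) + hh t ^ 2 * (c3 t k * d3 t k)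
  + r t k * (d0 t k + d1 t k * hh t + d2 t k * hh t ^ 2 + d3 t k * hh t ^ 3 + hh t ^ 4 * r' t k)
  + (c0 t k + c1 t k * hh t + c2 t k * hh t ^ 2 + c3 t k * hh t ^ 3) * r' t k).
split; [bd|].
intros t k D. rewrite E, E' by easy. ring.
Qed.

Lemma Ex_Bd F : Bd F -> Ex F F (fun _ _ => 0) (fun _ _ => 0) (fun _ _ => 0).
Proof.
intros B. split; bd. exists (fun _ _ => 0). split; [bd|]. intros; ring.
Qed.

Lemma Ex_h : Ex (fun t _ => hh t) (fun _ _ => 0) (fun _ _ => 1) (fun _ _ => 0) (fun _ _ => 0).
Proof. split; bd. exists (fun _ _ => 0). split; [bd|]. intros; ring. Qed.

Lemma Ex_opp F c0 c1 c2 c3 : Ex F c0 c1 c2 c3 ->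
  Ex (fun t k => - F t k) (fun t k => - c0 t k) (fun t k => - c1 t k)
    (fun t k => - c2 t k) (fun t k => - c3 t k).
Proof.
intros [B0 B1 B2 B3 [r [Br E]]]. split; bd. exists (fun t k => - r t k). split; [bd|].
intros t k D. rewrite E by easy. ring.
Qed.

Lemma Ex_minus F c0 c1 c2 c3 G d0 d1 d2 d3 : Ex F c0 c1 c2 c3 -> Ex G d0 d1 d2 d3 ->
  Ex (fun t k => F t k - G t k) (fun t k => c0 t k - d0 t k) (fun t k => c1 t k - d1 t k)
    (fun t k => c2 t k - d2 t k) (fun t k => c3 t k - d3 t k).
Proof. intros H H'. apply Ex_plus; [easy|now apply Ex_opp]. Qed.

Lemma Ex_rem F c0 c1 c2 c3 r : Bd c0 -> Bd c1 -> Bd c2 -> Bd c3 -> Bd r ->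
  (forall t k, Dom t k ->
    F t k = c0 t k + c1 t k * hh t + c2 t k * hh t ^ 2 + c3 t k * hh t ^ 3 + hh t ^ 4 * r t k) ->
  Ex F c0 c1 c2 c3.
Proof. intros. split; try easy. now exists r. Qed.

(** Iterated five times this yields Taylor's formula, with d^5 in place of d^5/120. *)
Lemma increment_bound (G G' : R -> R) (d B s : R) :
  (forall u, is_derive G u (G' u)) -> G 0 = 0 ->
  (forall u, 0 <= u <= d \/ d <= u <= 0 -> Rabs (G' u) <= B) ->
  0 <= s <= d \/ d <= s <= 0 -> Rabs (G s) <= B * Rabs d.
Proof.
intros H G0 HB Hs.
assert (B0 : 0 <= B) by (eapply Rle_trans; [apply Rabs_pos|apply (HB s Hs)]).
destruct (Req_dec s 0) as [-> |N].
{ rewrite G0, Rabs_R0. apply Rmult_le_pos; [easy|apply Rabs_pos]. }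
assert (exists c, (0 <= c <= d \/ d <= c <= 0) /\ G s = G' c * s) as [c [Hc E]].
{ destruct Hs as [Hs|Hs].
  - destruct (mean_value G G' 0 s) as [c [Hc E]]; [lra|intros; apply H|].
    exists c. split; [lra|]. rewrite G0 in E. lra.
  - destruct (mean_value G G' s 0) as [c [Hc E]]; [lra|intros; apply H|].
    exists c. split; [lra|]. rewrite G0 in E. lra. }
rewrite E, Rabs_mult. apply Rmult_le_compat; try apply Rabs_pos; [now apply HB|].
destruct Hs; [rewrite !Rabs_pos_eq by lra|rewrite !Rabs_left1 by lra]; lra.
Qed.

(** Take x <= exp x at x = (1 + z)/(2 p + 2) and raise it to the power p. *)
Lemma pow_mult_exp_bounded p : exists C, 0 <= C /\ forall z, 0 <= z -> (1 + z) ^ p * exp (- z / 2) <= C.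
Proof.
exists ((2 * INR p + 2) ^ p * exp (1/2)). split.
{ apply Rmult_le_pos; [apply pow_le; pose proof (pos_INR p); lra|left; apply exp_pos]. }
intros z Hz.
replace (- z / 2) with (1/2 + - ((1 + z) / 2)) by field.
rewrite exp_plus, exp_Ropp.
assert (E : (1 + z) ^ p <= (2 * INR p + 2) ^ p * exp ((1 + z) / 2)).
{ set (a := 2 * INR p + 2).
  assert (a0 : 0 < a) by (unfold a; pose proof (pos_INR p); lra).
  assert (D : (1 + z) / a <= exp ((1 + z) / a)) by (pose proof (exp_ineq1_le ((1 + z) / a)); lra).
  assert (D2 : ((1 + z) / a) ^ p <= exp ((1 + z) / a) ^ p).
  { apply pow_incr. split; [|easy]. apply Rmult_le_pos; [lra|left; now apply Rinv_0_lt_compat]. }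
  assert (D3 : exp ((1 + z) / a) ^ p = exp (INR p * ((1 + z) / a))).
  { generalize ((1 + z) / a). clear. intros x. induction p as [|p IH].
    - simpl. now rewrite Rmult_0_l, exp_0.
    - rewrite S_INR, Rmult_plus_distr_r, exp_plus, <- IH, Rmult_1_l. simpl. ring. }
  assert (D4 : exp (INR p * ((1 + z) / a)) <= exp ((1 + z) / 2)).
  { assert (Q : INR p * ((1 + z) / a) <= (1 + z) / 2).
    { apply Rmult_le_reg_r with a; [easy|].
      replace (INR p * ((1 + z) / a) * a) with (INR p * (1 + z)) by (field; lra).
      unfold a. pose proof (pos_INR p). nra. }
    destruct Q as [Q|Q]; [left; now apply exp_increasing|rewrite Q; lra]. }
  unfold Rdiv in D2 at 1. rewrite Rpow_mult_distr, pow_inv in D2.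
  apply Rmult_le_reg_l with (/ a ^ p); [apply Rinv_0_lt_compat, pow_lt, a0|].
  replace (/ a ^ p * (a ^ p * exp ((1 + z) / 2))) with (exp ((1 + z) / 2))
    by (field; apply pow_nonzero; lra).
  lra. }
pose proof (exp_pos ((1 + z) / 2)). pose proof (exp_pos (1/2)).
replace ((1 + z) ^ p * (exp (1/2) * / exp ((1 + z) / 2)))
  with (exp (1/2) * ((1 + z) ^ p * / exp ((1 + z) / 2))) by ring.
rewrite Rmult_comm with (r1 := (2 * INR p + 2) ^ p). apply Rmult_le_compat_l; [lra|].
apply Rmult_le_reg_r with (exp ((1 + z) / 2)); [easy|].
rewrite Rmult_assoc, Rinv_l by lra. lra.
Qed.

(* Functions of the scaled height that decay exponentially, uniformly in [t]. *)
Definition Be (F : R -> R -> R) : Prop := Bd (fun t k => F t k * exp (hh t * k / 2)).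

Lemma Be_bounded F : Be F -> exists C, 0 <= C /\ forall t k, Dom t k -> Rabs (F t k) <= C.
Proof.
intros [C [p [C0 H]]]. destruct (pow_mult_exp_bounded p) as [C' [C0' H']].
exists (C * C'). split; [nra|]. intros t k D. specialize (H t k D).
destruct (Dom_z t k D) as [? [? _]]. specialize (H' (hh t * k)).
rewrite Rabs_mult, (Rabs_pos_eq (exp _)) in H by (left; apply exp_pos).
replace (- (hh t * k) / 2) with (- (hh t * k / 2)) in H' by field. rewrite exp_Ropp in H'.
pose proof (exp_pos (hh t * k / 2)) as E. set (e := exp (hh t * k / 2)) in *.
apply Rmult_le_reg_r with e; [easy|]. eapply Rle_trans; [apply H|].
rewrite Rmult_assoc. apply Rmult_le_compat_l; [easy|].
apply Rmult_le_reg_r with (/ e); [now apply Rinv_0_lt_compat|].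
rewrite Rmult_assoc, Rinv_r by lra. lra.
Qed.

Lemma Be_plus F G : Be F -> Be G -> Be (fun t k => F t k + G t k).
Proof.
intros H H'. unfold Be. eapply Bd_ext; [|apply (Bd_plus _ _ H H')].
intros; simpl; ring.
Qed.

Lemma Be_mult F G : Bd F -> Be G -> Be (fun t k => F t k * G t k).
Proof.
intros H H'. unfold Be. eapply Bd_ext; [|apply (Bd_mult _ _ H H')].
intros; simpl; ring.
Qed.

Lemma Be_le F G : (forall t k, Dom t k -> Rabs (F t k) <= Rabs (G t k)) -> Be G -> Be F.
Proof.
intros H. apply Bd_le. intros t k D. rewrite !Rabs_mult.
apply Rmult_le_compat_r; [apply Rabs_pos|auto].
Qed.

Lemma Be_exp C : Be (fun t k => C * exp (- (hh t * k / 2))).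
Proof.
unfold Be. apply Bd_ext with (fun _ _ => C); [|apply Bd_const].
intros. rewrite Rmult_assoc, <- exp_plus, Rplus_opp_l, exp_0. ring.
Qed.

(** * A step of the recurrence in the scaled height *)

Definition stepq (a t : R) : R := hh (t - a) / hh t.

Lemma hh_step a t : hh (t - a) = hh t * stepq a t.
Proof. unfold stepq. pose proof (hh_pos t). field. lra. Qed.

Lemma stepq_bounds a t : 0 <= a <= 3 -> 16 <= t ->
  1 + a * hh t ^ 3 / 6 <= stepq a t <= 1 + a * hh t ^ 3 / 6 + a ^ 2 * hh t ^ 6 / 4.
Proof.
intros Ha Ht. pose proof (hh_ratio_expand a t Ha Ht) as H. cbv zeta in H. fold (stepq a t) in H.
replace (a ^ 2 * hh t ^ 6 / 4) with ((a * hh t ^ 3 / 2) ^ 2) by field. lra.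
Qed.

Lemma Ex_stepq a : 0 <= a <= 3 ->
  Ex (fun t _ => stepq a t) (fun _ _ => 1) (fun _ _ => 0) (fun _ _ => 0) (fun _ _ => a / 6).
Proof.
intros Ha. eapply Ex_rem with (r := fun t k => (stepq a t - 1 - a * hh t ^ 3 / 6) / hh t ^ 4); try solve [bd].
- apply Bd_bounded with 3. intros t k D. destruct (Dom_z t k D) as [[h0 h1] _].
  destruct D as [Dt _]. pose proof (stepq_bounds a t Ha ltac:(lra)).
  rewrite Rabs_pos_eq by (apply Rmult_le_pos; [lra|left; apply Rinv_0_lt_compat, pow_lt, h0]).
  apply Rmult_le_reg_r with (hh t ^ 4); [apply pow_lt, h0|].
  unfold Rdiv at 1. rewrite Rmult_assoc, Rinv_l by (apply pow_nonzero; lra).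
  apply Rle_trans with (a ^ 2 * hh t ^ 6 / 4); [lra|].
  assert (a ^ 2 <= 9) by nra. assert (hh t ^ 2 <= 1) by nra. assert (0 < hh t ^ 4) by (apply pow_lt, h0).
  assert (0 < hh t ^ 6) by (apply pow_lt, h0).
  replace (hh t ^ 6) with (hh t ^ 4 * hh t ^ 2) in * by ring. nra.
- intros t k D. pose proof (hh_pos t). field. lra.
Qed.

(** Dividing [Ex_stepq] by h would leave an unknown term of order h^3. The true remainder of [stepq]
    is O(h^6), so the division loses nothing. *)
Lemma Ex_stepe a : 0 <= a <= 3 ->
  Ex (fun t _ => (stepq a t - 1) / hh t) (fun _ _ => 0) (fun _ _ => 0) (fun _ _ => a / 6) (fun _ _ => 0).
Proof.
intros Ha. eapply Ex_rem with (r := fun t k => (stepq a t - 1 - a * hh t ^ 3 / 6) / hh t ^ 5); try solve [bd].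
- apply Bd_bounded with 3. intros t k D. destruct (Dom_z t k D) as [[h0 h1] _].
  destruct D as [Dt _]. pose proof (stepq_bounds a t Ha ltac:(lra)).
  rewrite Rabs_pos_eq by (apply Rmult_le_pos; [lra|left; apply Rinv_0_lt_compat, pow_lt, h0]).
  apply Rmult_le_reg_r with (hh t ^ 5); [apply pow_lt, h0|].
  unfold Rdiv at 1. rewrite Rmult_assoc, Rinv_l by (apply pow_nonzero; lra).
  apply Rle_trans with (a ^ 2 * hh t ^ 6 / 4); [lra|].
  assert (a ^ 2 <= 9) by nra. assert (hh t <= 1) by nra. assert (0 < hh t ^ 5) by (apply pow_lt, h0).
  assert (0 < hh t ^ 6) by (apply pow_lt, h0).
  replace (hh t ^ 6) with (hh t ^ 5 * hh t) in * by ring. nra.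
- intros t k D. pose proof (hh_pos t). field. lra.
Qed.

(** The displacement of z in units of h when t drops by [a] and k moves by [s]: [s] plus the effect
    of the change of scale. *)
Definition dhat (a s t k : R) : R := hh t * k * ((stepq a t - 1) / hh t) + s * stepq a t.

Lemma dhat_spec a s t k : hh (t - a) * (k + s) = hh t * k + hh t * dhat a s t k.
Proof. rewrite hh_step. unfold dhat. pose proof (hh_pos t). field. lra. Qed.

Lemma Ex_dhat a s : 0 <= a <= 3 ->
  Ex (dhat a s) (fun _ _ => s) (fun _ _ => 0) (fun t k => hh t * k * (a / 6)) (fun _ _ => s * (a / 6)).
Proof.
intros Ha. eapply Ex_ext; [..|eapply Ex_plus; [eapply Ex_mult|eapply Ex_mult]].
6: apply Ex_Bd, Bd_z. 6: apply Ex_stepe, Ha. 6: apply Ex_Bd, (Bd_const s). 6: apply Ex_stepq, Ha.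
all: intros; simpl; unfold dhat; ring.
Qed.

Lemma Bd_dhat a s : 0 <= a <= 3 -> Bd (dhat a s).
Proof.
intros Ha. destruct (Ex_dhat a s Ha) as [_ _ _ _ [r [Br H]]].
eapply Bd_ext; [apply H|]. bd.
Qed.

(** Keeps the Taylor segment at nonnegative heights and at most one unit below z, where the
    exponential bounds apply. *)
Lemma dhat_range a s t k : 0 <= a <= 3 -> s = 1 \/ s = -1 -> Dom t k ->
  0 <= hh t * k + hh t * dhat a s t k /\ -1 <= hh t * dhat a s t k.
Proof.
intros Ha Hs D. destruct (Dom_z t k D) as [[h0 h1] [h2 h3]].
pose proof (stepq_bounds a t Ha ltac:(destruct D; lra)) as B.
assert (0 <= a * hh t ^ 3 / 6) by (apply Rmult_le_pos; [apply Rmult_le_pos; [lra|apply pow_le; lra]|lra]).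
assert (stepq a t <= 2).
{ assert (hh t ^ 3 <= / 8) by (replace (/8) with ((/2) ^ 3) by field; apply pow_incr; lra).
  assert (hh t ^ 6 <= / 64) by (replace (/64) with ((/2) ^ 6) by field; apply pow_incr; lra).
  assert (a ^ 2 <= 9) by nra. assert (0 < hh t ^ 6) by (apply pow_lt, h0). assert (0 < hh t ^ 3) by (apply pow_lt, h0).
  nra. }
split.
- rewrite <- dhat_spec. apply Rmult_le_pos; [left; apply hh_pos|]. destruct D; lra.
- unfold dhat.
  replace (hh t * (hh t * k * ((stepq a t - 1) / hh t) + s * stepq a t))
    with (hh t * k * (stepq a t - 1) + s * (hh t * stepq a t)) by (field; lra).
  assert (0 <= hh t * k * (stepq a t - 1)) by (apply Rmult_le_pos; lra). nra.
Qed.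

(** * Taylor expansion of the Airy function along a step *)

Section Taylor.

Variables (y y' : R -> R) (a1 M : R).
Hypothesis dy : forall x, is_derive y x (y' x).
Hypothesis dy' : forall x, is_derive y' x (x * y x).
Hypothesis M_pos : 0 < M.
Hypothesis bound : forall z, 0 <= z ->
  Rabs (y (a1 + z)) <= M * exp (- z) /\ Rabs (y' (a1 + z)) <= M * exp (- z).

(* The expression bounded is the fifth derivative of [y]. *)
Lemma airy_fifth_derivative_bound :
  exists K, 0 <= K /\ forall z u, 0 <= u -> z - 1 <= u ->
    let x := a1 + u in Rabs (4 * x * y x + x ^ 2 * y' x) <= K * exp (- z / 2).
Proof.
set (A := 4 * (Rabs a1 + 1) + (Rabs a1 + 1) ^ 2).
destruct (pow_mult_exp_bounded 2) as [C [C0 HC]].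
assert (A0 : 0 <= A) by (unfold A; pose proof (Rabs_pos a1); nra).
exists (A * M * C * exp (1/2)). split.
{ apply Rmult_le_pos; [|left; apply exp_pos]. apply Rmult_le_pos; [|easy]. nra. }
intros z u u0 uz x.
destruct (bound u u0) as [B1 B2]. fold x in B1, B2.
assert (Ax : Rabs x <= (Rabs a1 + 1) * (1 + u)).
{ unfold x. eapply Rle_trans; [apply Rabs_triang|]. rewrite (Rabs_pos_eq u) by easy. pose proof (Rabs_pos a1). nra. }
assert (E1 : exp (- u / 2) <= exp (1/2) * exp (- z / 2)).
{ rewrite <- exp_plus. destruct (Rle_lt_or_eq_dec (- u / 2) (1/2 + - z/2)) as [L| ->]; [lra| |lra].
  left; now apply exp_increasing. }
apply Rle_trans with (A * (1 + u) ^ 2 * (M * exp (- u))).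
- eapply Rle_trans; [apply Rabs_triang|].
  rewrite !Rabs_mult, <- RPow_abs, (Rabs_pos_eq 4) by lra.
  assert (0 <= Rabs x) by apply Rabs_pos.
  assert (T1 : 4 * Rabs x * Rabs (y x) <= 4 * (Rabs a1 + 1) * (1 + u) ^ 2 * (M * exp (- u))).
  { apply Rmult_le_compat; [lra|apply Rabs_pos| |easy]. pose proof (Rabs_pos a1). 
    assert ((1 + u) <= (1 + u) ^ 2) by nra. nra. }
  assert (T2 : Rabs x ^ 2 * Rabs (y' x) <= ((Rabs a1 + 1) * (1 + u)) ^ 2 * (M * exp (- u))).
  { apply Rmult_le_compat; [apply pow_le; lra|apply Rabs_pos| |easy]. apply pow_incr. lra. }
  unfold A. rewrite Rpow_mult_distr in T2. lra.
- specialize (HC u u0).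
  replace (exp (- u)) with (exp (- u / 2) * exp (- u / 2)) by (rewrite <- exp_plus; f_equal; field).
  pose proof (exp_pos (- u / 2)).
  replace (A * (1 + u) ^ 2 * (M * (exp (- u / 2) * exp (- u / 2))))
    with (A * M * (((1 + u) ^ 2 * exp (- u / 2)) * exp (- u / 2))) by ring.
  replace (A * M * C * exp (1 / 2) * exp (- z / 2)) with (A * M * (C * (exp (1 / 2) * exp (- z / 2)))) by ring.
  apply Rmult_le_compat_l; [nra|]. apply Rmult_le_compat; try lra.
  apply Rmult_le_pos; [apply pow_le|]; lra.
Qed.

(** The assertions [H4] to [H0] integrate the bound on the fifth derivative; y'' = x y reduces all
    derivatives to [y] and [y']. *)
Lemma airy_taylor x d K :
  (forall u, 0 <= u <= d \/ d <= u <= 0 -> Rabs (4 * (x + u) * y (x + u) + (x + u) ^ 2 * y' (x + u)) <= K) ->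
  Rabs (y (x + d) - (y x * (1 + x * d ^ 2 / 2 + d ^ 3 / 6 + x ^ 2 * d ^ 4 / 24)
     + y' x * (d + x * d ^ 3 / 6 + d ^ 4 / 12))) <= K * Rabs d ^ 5.
Proof.
intros H5.
assert (Dy : forall t, Derive (fun x => y x) t = y' t) by (intros; apply is_derive_unique, dy).
assert (Dy' : forall t, Derive (fun x => y' x) t = t * y t) by (intros; apply is_derive_unique, dy').
assert (exy : forall t, ex_derive (fun x => y x) t) by (intros; eexists; apply dy).
assert (exy' : forall t, ex_derive (fun x => y' x) t) by (intros; eexists; apply dy').
assert (H4 : forall u, 0 <= u <= d \/ d <= u <= 0 ->
  Rabs (2 * y' (x + u) + (x + u) ^ 2 * y (x + u) - (2 * y' x + x ^ 2 * y x)) <= K * Rabs d).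
{ intros u Hu. apply (increment_bound (fun u => 2 * y' (x + u) + (x + u) ^ 2 * y (x + u) - (2 * y' x + x ^ 2 * y x))
   (fun u => 4 * (x + u) * y (x + u) + (x + u) ^ 2 * y' (x + u)) d); [|rewrite !Rplus_0_r; ring|easy|easy].
  intros v. auto_derive; [auto|]. rewrite Dy, Dy'. ring. }
assert (H3 : forall u, 0 <= u <= d \/ d <= u <= 0 ->
  Rabs (y (x + u) + (x + u) * y' (x + u) - (y x + x * y' x) - (2 * y' x + x ^ 2 * y x) * u) <= K * Rabs d * Rabs d).
{ intros u Hu. apply (increment_bound (fun u => y (x + u) + (x + u) * y' (x + u) - (y x + x * y' x) - (2 * y' x + x ^ 2 * y x) * u)
   (fun u => 2 * y' (x + u) + (x + u) ^ 2 * y (x + u) - (2 * y' x + x ^ 2 * y x)) d); [|rewrite !Rplus_0_r; ring|easy|easy].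
  intros v. auto_derive; [auto|]. rewrite Dy, Dy'. ring. }
assert (H2 : forall u, 0 <= u <= d \/ d <= u <= 0 ->
  Rabs ((x + u) * y (x + u) - x * y x - (y x + x * y' x) * u - (2 * y' x + x ^ 2 * y x) * u ^ 2 / 2) <= K * Rabs d * Rabs d * Rabs d).
{ intros u Hu. apply (increment_bound (fun u => (x + u) * y (x + u) - x * y x - (y x + x * y' x) * u - (2 * y' x + x ^ 2 * y x) * u ^ 2 / 2)
   (fun u => y (x + u) + (x + u) * y' (x + u) - (y x + x * y' x) - (2 * y' x + x ^ 2 * y x) * u) d); [|rewrite !Rplus_0_r; field|easy|easy].
  intros v. auto_derive; [auto|]. rewrite Dy. field. }
assert (H1 : forall u, 0 <= u <= d \/ d <= u <= 0 ->
  Rabs (y' (x + u) - y' x - x * y x * u - (y x + x * y' x) * u ^ 2 / 2 - (2 * y' x + x ^ 2 * y x) * u ^ 3 / 6) <= K * Rabs d * Rabs d * Rabs d * Rabs d).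
{ intros u Hu. apply (increment_bound (fun u => y' (x + u) - y' x - x * y x * u - (y x + x * y' x) * u ^ 2 / 2 - (2 * y' x + x ^ 2 * y x) * u ^ 3 / 6)
   (fun u => (x + u) * y (x + u) - x * y x - (y x + x * y' x) * u - (2 * y' x + x ^ 2 * y x) * u ^ 2 / 2) d); [|rewrite !Rplus_0_r; field|easy|easy].
  intros v. auto_derive; [auto|]. rewrite Dy'. field. }
assert (H0 : Rabs (y (x + d) - y x - y' x * d - x * y x * d ^ 2 / 2 - (y x + x * y' x) * d ^ 3 / 6 - (2 * y' x + x ^ 2 * y x) * d ^ 4 / 24) <= K * Rabs d * Rabs d * Rabs d * Rabs d * Rabs d).
{ apply (increment_bound (fun u => y (x + u) - y x - y' x * u - x * y x * u ^ 2 / 2 - (y x + x * y' x) * u ^ 3 / 6 - (2 * y' x + x ^ 2 * y x) * u ^ 4 / 24)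
   (fun u => y' (x + u) - y' x - x * y x * u - (y x + x * y' x) * u ^ 2 / 2 - (2 * y' x + x ^ 2 * y x) * u ^ 3 / 6) d); [|rewrite !Rplus_0_r; field|easy|].
  - intros v. auto_derive; [auto|]. rewrite Dy. field.
  - destruct (Rle_or_lt 0 d); lra. }
replace (K * Rabs d ^ 5) with (K * Rabs d * Rabs d * Rabs d * Rabs d * Rabs d) by ring.
match goal with |- Rabs ?a <= _ => match type of H0 with Rabs ?b <= _ => replace a with b by field end end.
exact H0.
Qed.

(** [coefy] and h times [coefy'] are the parts of the Taylor polynomial along [y] and [y']. *)
Definition coefy (a s t k : R) : R :=
  1 + (a1 + hh t * k) * (hh t ^ 2 * dhat a s t k ^ 2) / 2 + hh t ^ 3 * dhat a s t k ^ 3 / 6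
  + (a1 + hh t * k) ^ 2 * (hh t ^ 4 * dhat a s t k ^ 4) / 24.
Definition coefy' (a s t k : R) : R :=
  dhat a s t k + (a1 + hh t * k) * (hh t ^ 2 * dhat a s t k ^ 3) / 6 + hh t ^ 3 * dhat a s t k ^ 4 / 12.

Lemma airy_step_expand a s : 0 <= a <= 3 -> s = 1 \/ s = -1 ->
  exists r, Be r /\ forall t k, Dom t k ->
    y (a1 + hh (t - a) * (k + s)) =
      y (a1 + hh t * k) * coefy a s t k + y' (a1 + hh t * k) * (hh t * coefy' a s t k) + hh t ^ 5 * r t k.
Proof.
intros Ha Hs. destruct airy_fifth_derivative_bound as [K [K0 HK]].
exists (fun t k => (y (a1 + hh (t - a) * (k + s)) - 
      (y (a1 + hh t * k) * coefy a s t k + y' (a1 + hh t * k) * (hh t * coefy' a s t k))) / hh t ^ 5).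
split; [|intros t k D; pose proof (hh_pos t); field; lra].
apply Be_le with (fun t k => dhat a s t k ^ 5 * (K * exp (- (hh t * k / 2)))).
2:{ apply Be_mult; [apply Bd_pow, Bd_dhat, Ha|apply Be_exp]. }
intros t k D. destruct (Dom_z t k D) as [[h0 h1] [h2 h3]]. destruct (dhat_range a s t k Ha Hs D) as [R1 R2].
set (d := hh t * dhat a s t k) in *.
assert (T := airy_taylor (a1 + hh t * k) d (K * exp (- (hh t * k / 2)))).
unfold Rdiv at 1. rewrite Rabs_mult, (Rabs_pos_eq (/ _)) by (left; apply Rinv_0_lt_compat, pow_lt, h0).
apply Rmult_le_reg_r with (hh t ^ 5); [apply pow_lt, h0|].
rewrite Rmult_assoc, Rinv_l, Rmult_1_r by (apply pow_nonzero; lra).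
rewrite dhat_spec. fold d. rewrite <- Rplus_assoc.
rewrite Rabs_mult, (Rabs_pos_eq (K * _)) by (apply Rmult_le_pos; [easy|left; apply exp_pos]).
rewrite <- RPow_abs.
replace (Rabs (dhat a s t k) ^ 5 * (K * exp (- (hh t * k / 2))) * hh t ^ 5) with
  (K * exp (- (hh t * k / 2)) * Rabs d ^ 5).
2:{ unfold d. rewrite Rabs_mult, (Rabs_pos_eq (hh t)) by lra. ring. }
eapply Rle_trans; [|apply T].
- right. f_equal. unfold coefy, coefy', d. field.
- intros u Hu. replace (- (hh t * k / 2)) with (- (hh t * k) / 2) by field.
  replace (a1 + hh t * k + u) with (a1 + (hh t * k + u)) by ring. apply HK; lra.
Qed.

End Taylor.

(** * The recurrence on the Airy profile *)

(* The values of [beta] and [kappa] are forced by the cancellations in [residual_y'_order] and [residual_y_order]. *)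
Definition beta (s : R) : R := 11 / 12 - s / 8.
Definition kappa (s : R) : R := 4 / 3 - s / 4.
Definition gauge (sg b z : R) : R := 1 - b * z ^ 2 / 3 + beta sg * b ^ 2 * z.
Definition profile (sg : R) (y : R -> R) (a1 t k : R) : R :=
  gauge sg (hh t) (hh t * k) * y (a1 + hh t * k).
(* [(m + 1) / n] in the variables [t = n + m], [k = n - m + 1]. *)
Definition wup (t k : R) : R := (t - k + 3) / (t + k - 1).
(** Equals [rho] up to the margin of order h^(7/2) and O(h^4), by [rho_expand]. *)
Definition growth (sg a1 t : R) : R := 2 + a1 * hh t ^ 2 + kappa sg * hh t ^ 3.

Lemma Ex_const c : Ex (fun _ _ => c) (fun _ _ => c) (fun _ _ => 0) (fun _ _ => 0) (fun _ _ => 0).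
Proof. apply Ex_Bd, Bd_const. Qed.

Lemma Ex_z : Ex (fun t k => hh t * k) (fun t k => hh t * k) (fun _ _ => 0) (fun _ _ => 0) (fun _ _ => 0).
Proof. apply Ex_Bd, Bd_z. Qed.

Lemma Ex_div_const F c0 c1 c2 c3 c : Ex F c0 c1 c2 c3 ->
  Ex (fun t k => F t k / c) (fun t k => c0 t k / c) (fun t k => c1 t k / c)
    (fun t k => c2 t k / c) (fun t k => c3 t k / c).
Proof.
intros H. eapply Ex_ext; [..|eapply Ex_mult; [apply H|apply (Ex_const (/ c))]]; intros; simpl; unfold Rdiv; ring.
Qed.

Lemma Ex_pow2 F c0 c1 c2 c3 : Ex F c0 c1 c2 c3 ->
  Ex (fun t k => F t k ^ 2) (fun t k => c0 t k * c0 t k)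
    (fun t k => c0 t k * c1 t k + c1 t k * c0 t k)
    (fun t k => c0 t k * c2 t k + c1 t k * c1 t k + c2 t k * c0 t k)
    (fun t k => c0 t k * c3 t k + c1 t k * c2 t k + c2 t k * c1 t k + c3 t k * c0 t k).
Proof.
intros H. eapply Ex_ext; [..|apply (Ex_mult _ _ _ _ _ _ _ _ _ _ H H)]; intros; simpl; ring.
Qed.

Ltac exs := repeat first
  [ eassumption
  | match goal with |- Ex (fun _ _ => ?c) _ _ _ _ => apply (Ex_const c) end
  | apply Ex_h | apply Ex_z
  | eapply Ex_div_const | eapply Ex_plus | eapply Ex_minus | eapply Ex_mult | eapply Ex_opp
  | eapply Ex_pow2 ].

Section Expansions.

Variables (a1 sg : R).

Lemma Ex_gauge a s : 0 <= a <= 3 ->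
  Ex (fun t k => gauge sg (hh (t - a)) (hh (t - a) * (k + s)))
    (fun _ _ => 1) (fun t k => - (hh t * k) ^ 2 / 3)
    (fun t k => (beta sg - 2 / 3 * s) * (hh t * k)) (fun _ _ => beta sg * s - s ^ 2 / 3).
Proof.
intros Ha. pose proof (Ex_stepq a Ha) as Eq. pose proof (Ex_dhat a s Ha) as Ed.
eapply Ex_ext with (G := fun t k => 1 - hh t * stepq a t * (hh t * k + hh t * dhat a s t k) ^ 2 / 3
   + beta sg * (hh t * stepq a t) ^ 2 * (hh t * k + hh t * dhat a s t k)); [..|exs].
all: intros t k D; simpl.
- unfold gauge. rewrite dhat_spec, hh_step. field.
- field.
- field.
- field.
- field.
Qed.

Lemma Ex_gauge0 :
  Ex (fun t k => gauge sg (hh t) (hh t * k))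
    (fun _ _ => 1) (fun t k => - (hh t * k) ^ 2 / 3)
    (fun t k => beta sg * (hh t * k)) (fun _ _ => 0).
Proof.
eapply Ex_ext with (G := fun t k => 1 - hh t * (hh t * k) ^ 2 / 3
   + beta sg * hh t ^ 2 * (hh t * k)); [..|exs].
all: intros t k D; simpl; try field. reflexivity.
Qed.

Lemma Ex_coefy a s : 0 <= a <= 3 ->
  Ex (coefy a1 a s) (fun _ _ => 1) (fun _ _ => 0)
    (fun t k => (a1 + hh t * k) * s ^ 2 / 2) (fun _ _ => s ^ 3 / 6).
Proof.
intros Ha. pose proof (Ex_dhat a s Ha) as Ed.
eapply Ex_ext with (G := fun t k => 1 + (a1 + hh t * k) * (hh t * dhat a s t k) ^ 2 / 2
   + (hh t * dhat a s t k) * (hh t * dhat a s t k) ^ 2 / 6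
   + (a1 + hh t * k) ^ 2 * ((hh t * dhat a s t k) ^ 2) ^ 2 / 24); [..|exs].
all: intros t k D; simpl; try field. unfold coefy; field.
Qed.

Lemma Ex_coefy' a s : 0 <= a <= 3 ->
  Ex (coefy' a1 a s) (fun _ _ => s) (fun _ _ => 0)
    (fun t k => hh t * k * (a / 6) + (a1 + hh t * k) * s ^ 3 / 6) (fun _ _ => s * (a / 6) + s ^ 4 / 12).
Proof.
intros Ha. pose proof (Ex_dhat a s Ha) as Ed.
eapply Ex_ext with (G := fun t k => dhat a s t k + (a1 + hh t * k) * (hh t ^ 2 * (dhat a s t k * dhat a s t k ^ 2)) / 6
   + hh t * hh t ^ 2 * (dhat a s t k ^ 2) ^ 2 / 12); [..|exs].
all: intros t k D; simpl; try field. unfold coefy'; field.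
Qed.

Lemma Ex_wup : Ex wup (fun _ _ => 1) (fun _ _ => 0) (fun t k => - (hh t * k)) (fun _ _ => 2).
Proof.
eapply Ex_rem with (r := fun t k => ((hh t * k) ^ 2 - 3 * hh t * (hh t * k) + 2 * hh t ^ 2) *
   / (2 + hh t ^ 2 * (hh t * k) - hh t ^ 3)); try solve [bd].
- apply Bd_mult; [bd|]. apply Bd_bounded with 1. intros t k D. destruct (Dom_z t k D) as [[h0 h1] [h2 h3]].
  assert (hh t ^ 3 <= hh t ^ 2 * (hh t * k)) by (replace (hh t ^ 3) with (hh t ^ 2 * hh t) by ring; apply Rmult_le_compat_l; nra).
  rewrite Rabs_pos_eq by (left; apply Rinv_0_lt_compat; lra).
  rewrite <- Rinv_1. apply Rinv_le_contravar; lra.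
- intros t k D. destruct (Dom_z t k D) as [[h0 h1] [h2 h3]].
  assert (hh t ^ 3 <= hh t ^ 2 * (hh t * k)) by (replace (hh t ^ 3) with (hh t ^ 2 * hh t) by ring; apply Rmult_le_compat_l; nra).
  unfold wup. destruct D as [Dt Dk].
  replace ((t - k + 3) / (t + k - 1)) with
   ((2 - hh t ^ 2 * (hh t * k) + 3 * hh t ^ 3) / (2 + hh t ^ 2 * (hh t * k) - hh t ^ 3)).
  + field. lra.
  + pose proof (hh_cube_mul t ltac:(lra)) as T.
    replace (2 - hh t ^ 2 * (hh t * k) + 3 * hh t ^ 3) with (hh t ^ 3 * (t - k + 3)) by (rewrite <- T; ring).
    replace (2 + hh t ^ 2 * (hh t * k) - hh t ^ 3) with (hh t ^ 3 * (t + k - 1)) by (rewrite <- T; ring).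
    field. split; [lra|apply Rgt_not_eq; lra].
Qed.

Lemma Ex_growth : Ex (fun t _ => growth sg a1 t) (fun _ _ => 2) (fun _ _ => 0) (fun _ _ => a1) (fun _ _ => kappa sg).
Proof.
eapply Ex_rem with (r := fun _ _ => 0); bd. intros; unfold growth; ring.
Qed.

(** Stands for the weight of the cherry term, whose exact form involves [rho]; at the order
    considered only its leading term h^3/4 matters. *)
Variable vw : R -> R -> R.
Hypothesis Ex_vw : Ex vw (fun _ _ => 0) (fun _ _ => 0) (fun _ _ => 0) (fun _ _ => / 4).

(** After Taylor expansion the recurrence applied to the profile leaves [residual_y] times [y], plus
    [residual_y'] times h y', plus O(h^5) remainders. *)
Definition residual_y (t k : R) : R :=
  wup t k * (gauge sg (hh (t - 1)) (hh (t - 1) * (k + -1)) * coefy a1 1 (-1) t k)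
  + gauge sg (hh (t - 1)) (hh (t - 1) * (k + 1)) * coefy a1 1 1 t k
  - sg * (vw t k * (gauge sg (hh (t - 3)) (hh (t - 3) * (k + -1)) * coefy a1 3 (-1) t k))
  - growth sg a1 t * gauge sg (hh t) (hh t * k).

Definition residual_y' (t k : R) : R :=
  wup t k * (gauge sg (hh (t - 1)) (hh (t - 1) * (k + -1)) * coefy' a1 1 (-1) t k)
  + gauge sg (hh (t - 1)) (hh (t - 1) * (k + 1)) * coefy' a1 1 1 t k
  - sg * (vw t k * (gauge sg (hh (t - 3)) (hh (t - 3) * (k + -1)) * coefy' a1 3 (-1) t k)).

(** Order h^2 is the Airy equation: the second difference gives a1 + z, the loss in [wup] gives - z,
    and the remaining a1 is the growth. Order h^3 determines [kappa]. *)
Lemma residual_y_order :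
  Ex residual_y (fun _ _ => 0) (fun _ _ => 0) (fun _ _ => 0) (fun _ _ => 0).
Proof.
pose proof Ex_wup as Ew. pose proof Ex_growth as Eg. pose proof Ex_gauge0 as E0.
pose proof (Ex_gauge 1 (-1) ltac:(lra)) as Em. pose proof (Ex_gauge 1 1 ltac:(lra)) as Ep.
pose proof (Ex_gauge 3 (-1) ltac:(lra)) as E3.
pose proof (Ex_coefy 1 (-1) ltac:(lra)) as Cm. pose proof (Ex_coefy 1 1 ltac:(lra)) as Cp.
pose proof (Ex_coefy 3 (-1) ltac:(lra)) as C3.
eapply Ex_ext; [intros; reflexivity| | | | |unfold residual_y; exs].
all: intros; cbv beta; unfold beta, kappa; field.
Qed.

(** Order h^2 is the drift cancelled by the quadratic gauge, and the constant part of order h^3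
    determines [beta]. The term left over is harmless: [y'] carries a further factor h, and z^3
    vanishes at the boundary. *)
Lemma residual_y'_order :
  Ex residual_y' (fun _ _ => 0) (fun _ _ => 0) (fun _ _ => 0) (fun t k => - 4 / 9 * (hh t * k) ^ 3).
Proof.
pose proof Ex_wup as Ew.
pose proof (Ex_gauge 1 (-1) ltac:(lra)) as Em. pose proof (Ex_gauge 1 1 ltac:(lra)) as Ep.
pose proof (Ex_gauge 3 (-1) ltac:(lra)) as E3.
pose proof (Ex_coefy' 1 (-1) ltac:(lra)) as Cm. pose proof (Ex_coefy' 1 1 ltac:(lra)) as Cp.
pose proof (Ex_coefy' 3 (-1) ltac:(lra)) as C3.
eapply Ex_ext; [intros; reflexivity| | | | |unfold residual_y'; exs].
all: intros; cbv beta; unfold beta, kappa; field.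
Qed.

Variables (y y' : R -> R) (M : R).
Hypothesis dy : forall x, is_derive y x (y' x).
Hypothesis dy' : forall x, is_derive y' x (x * y x).
Hypothesis y_a1 : y a1 = 0.
Hypothesis M_pos : 0 < M.
Hypothesis bound : forall z, 0 <= z ->
  Rabs (y (a1 + z)) <= M * exp (- z) /\ Rabs (y' (a1 + z)) <= M * exp (- z).

Lemma Be_of_exp_bound (F : R -> R) C :
  (forall z, 0 <= z -> Rabs (F z) <= C * exp (- z)) -> Be (fun t k => F (hh t * k)).
Proof.
intros H. apply Be_le with (fun t k => C * exp (- (hh t * k / 2))); [|apply Be_exp].
intros t k D. destruct (Dom_z t k D) as [[h0 _] [h2 _]].
eapply Rle_trans; [apply H; lra|].
assert (0 <= C).
{ specialize (H 0 ltac:(lra)). rewrite Ropp_0, exp_0 in H. pose proof (Rabs_pos (F 0)). lra. }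
rewrite Rabs_pos_eq by (apply Rmult_le_pos; [easy|left; apply exp_pos]).
apply Rmult_le_compat_l; [easy|]. left. apply exp_increasing. lra.
Qed.

(** As [y] vanishes at [a1], the quotient stays bounded near z = 0; this extracts a factor z from
    the error along [y]. *)
Lemma airy_div_z_decay : Be (fun t k => y (a1 + hh t * k) / (hh t * k)).
Proof.
apply Be_le with (fun t k => M * exp (1/2) * exp (- (hh t * k / 2))); [|apply Be_exp].
intros t k D. destruct (Dom_z t k D) as [[h0 _] [h2 _]]. set (z := hh t * k) in *.
assert (z0 : 0 < z) by lra.
rewrite (Rabs_pos_eq (_ * exp _)) by (apply Rmult_le_pos; [apply Rmult_le_pos; [lra|]|]; left; apply exp_pos).
unfold Rdiv at 1. rewrite Rabs_mult, Rabs_inv, (Rabs_pos_eq z) by lra.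
apply Rmult_le_reg_r with z; [easy|]. rewrite Rmult_assoc, Rinv_l, Rmult_1_r by lra.
destruct (Rle_or_lt z 1) as [Z|Z].
- destruct (mean_value y y' a1 (a1 + z)) as [c [Hc E]]; [lra|intros; apply dy|].
  rewrite y_a1, Rminus_0_r in E. rewrite E, Rabs_mult.
  replace (a1 + z - a1) with z by ring. rewrite (Rabs_pos_eq z) by lra.
  apply Rmult_le_compat_r; [lra|].
  destruct (bound (c - a1)) as [_ B]; [lra|]. replace (a1 + (c - a1)) with c in B by ring.
  assert (exp (- (c - a1)) <= 1) by (rewrite <- exp_0; destruct (Req_dec c a1) as [-> |];
    [rewrite Rminus_diag, Ropp_0; lra|left; apply exp_increasing; lra]).
  assert (1 <= exp (1/2) * exp (- (z / 2))).
  { rewrite <- exp_plus. pose proof (exp_ineq1_le (1/2 + - (z / 2))). lra. }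
  apply Rle_trans with (M * 1); [nra|]. rewrite Rmult_assoc. apply Rmult_le_compat_l; lra.
- destruct (bound z) as [B _]; [lra|].
  assert (exp (- z) <= exp (- (z / 2))) by (left; apply exp_increasing; lra).
  assert (1 <= exp (1/2)) by (pose proof (exp_ineq1_le (1/2)); lra).
  pose proof (exp_pos (- (z / 2))).
  apply Rle_trans with (M * exp (- (z / 2))); [nra|].
  replace (M * exp (1/2) * exp (- (z/2)) * z) with (M * exp (- (z / 2)) * (exp (1/2) * z)) by ring.
  rewrite <- (Rmult_1_r (M * exp (- (z / 2)))) at 1. apply Rmult_le_compat_l; [|nra].
  apply Rmult_le_pos; lra.
Qed.

Lemma profile_recursion_error :
  exists C, 0 <= C /\ forall t k, Dom t k ->
    let E := wup t k * profile sg y a1 (t - 1) (k - 1) + profile sg y a1 (t - 1) (k + 1)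
      - sg * (vw t k * profile sg y a1 (t - 3) (k - 1)) - growth sg a1 t * profile sg y a1 t k in
    Rabs E <= C * hh t ^ 4 /\ Rabs E <= C * hh t ^ 4 * (hh t * k).
Proof.
destruct (airy_step_expand y y' a1 M dy dy' M_pos bound 1 (-1)) as [rm [Bm Hm]]; [lra|now right|].
destruct (airy_step_expand y y' a1 M dy dy' M_pos bound 1 1) as [rp [Bp Hp]]; [lra|now left|].
destruct (airy_step_expand y y' a1 M dy dy' M_pos bound 3 (-1)) as [r3 [B3 H3]]; [lra|now right|].
destruct residual_y_order as [_ _ _ _ [r1 [Br1 H1]]].
destruct residual_y'_order as [_ _ _ _ [r2 [Br2 H2]]].
pose proof (Ex_gauge 1 (-1) ltac:(lra)) as Gm. pose proof (Ex_gauge 1 1 ltac:(lra)) as Gp.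
pose proof (Ex_gauge 3 (-1) ltac:(lra)) as G3.
assert (BdEx : forall F c0 c1 c2 c3, Ex F c0 c1 c2 c3 -> Bd F).
{ intros F c0 c1 c2 c3 [? ? ? ? [r [Br H]]]. eapply Bd_ext; [apply H|]. bd. }
apply BdEx in Gm, Gp, G3. pose proof (BdEx _ _ _ _ _ Ex_wup) as Bw. pose proof (BdEx _ _ _ _ _ Ex_vw) as Bv.
assert (Bk : Bd (fun t k => / k)).
{ apply Bd_bounded with 1. intros t k [_ D]. rewrite Rabs_pos_eq by (left; apply Rinv_0_lt_compat; lra).
  rewrite <- Rinv_1. apply Rinv_le_contravar; lra. }
assert (Bf' : Be (fun t k => y' (a1 + hh t * k))).
{ apply (Be_of_exp_bound (fun z => y' (a1 + z)) M). intros; now apply bound. }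
set (S := fun t k => wup t k * (gauge sg (hh (t - 1)) (hh (t - 1) * (k + -1)) * rm t k)
  + (gauge sg (hh (t - 1)) (hh (t - 1) * (k + 1)) * rp t k
  + - sg * (vw t k * (gauge sg (hh (t - 3)) (hh (t - 3) * (k + -1)) * r3 t k)))).
assert (BS : Be S).
{ unfold S. apply Be_plus; [apply Be_mult; [easy|apply Be_mult; easy]|].
  apply Be_plus; [apply Be_mult; easy|]. apply Be_mult; [bd|]. apply Be_mult; [easy|]. now apply Be_mult. }
(* The error divided by h^4 z. Terms with a surplus factor h = z/k contribute with the bounded
   factor 1/k. *)
set (G := fun t k => r1 t k * (y (a1 + hh t * k) / (hh t * k))
   + ((- 4 / 9 * (hh t * k) ^ 2 + / k * r2 t k) * y' (a1 + hh t * k) + / k * S t k)).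
assert (BG : Be G).
{ unfold G. apply Be_plus; [apply Be_mult; [easy|apply airy_div_z_decay]|].
  apply Be_plus; apply Be_mult; try easy. bd. }
assert (BzG : Be (fun t k => hh t * k * G t k)) by (apply Be_mult; [bd|easy]).
destruct (Be_bounded _ BG) as [C [C0 HC]]. destruct (Be_bounded _ BzG) as [C' [C0' HC']].
exists (C + C'). split; [lra|]. intros t k D E.
destruct (Dom_z t k D) as [[h0 _] [h2 _]].
assert (EE : E = hh t ^ 4 * (hh t * k * G t k)).
{ unfold E, profile. replace (k - 1) with (k + -1) by ring.
  rewrite (Hm t k D), (Hp t k D), (H3 t k D).
  unfold residual_y in H1. unfold residual_y' in H2. unfold G, S.
  specialize (H1 t k D). specialize (H2 t k D).
  assert (k0 : k <> 0) by (destruct D; lra).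
  set (f := y (a1 + hh t * k)) in *. set (f1 := y' (a1 + hh t * k)) in *.
  replace (hh t ^ 4 * _) with (f * (hh t ^ 4 * r1 t k) +
     f1 * (hh t * (- 4 / 9 * (hh t * k) ^ 3 * hh t ^ 3 + hh t ^ 4 * r2 t k)) + hh t ^ 5 * S t k)
    by (unfold S; field; split; lra).
  replace (hh t ^ 4 * r1 t k) with (0 + 0 * hh t + 0 * hh t ^ 2 + 0 * hh t ^ 3 + hh t ^ 4 * r1 t k) by ring.
  rewrite <- H1.
  replace (- 4 / 9 * (hh t * k) ^ 3 * hh t ^ 3 + hh t ^ 4 * r2 t k) with
    (0 + 0 * hh t + 0 * hh t ^ 2 + - 4 / 9 * (hh t * k) ^ 3 * hh t ^ 3 + hh t ^ 4 * r2 t k) by ring.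
  rewrite <- H2. unfold S. ring. }
rewrite EE. specialize (HC t k D). specialize (HC' t k D).
assert (0 < hh t ^ 4) by (apply pow_lt, h0).
rewrite Rabs_mult, (Rabs_pos_eq (hh t ^ 4)) by lra. split.
- rewrite (Rmult_comm (C + C')). apply Rmult_le_compat_l; lra.
- rewrite Rabs_mult, (Rabs_pos_eq (hh t * k)) by lra.
  replace ((C + C') * hh t ^ 4 * (hh t * k)) with (hh t ^ 4 * (hh t * k * (C + C'))) by ring.
  apply Rmult_le_compat_l; [lra|]. apply Rmult_le_compat_l; lra.
Qed.

End Expansions.

(** * The growth factor of a step *)

Lemma exp_sub_affine_bound x : Rabs (exp x - 1 - x) <= x ^ 2 * exp (Rabs x).
Proof.
pose proof (exp_ineq1_le x) as L. rewrite Rabs_pos_eq by lra.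
destruct (Rle_or_lt (-1) x) as [H|H].
- assert (E : exp x * exp (- x) = 1) by (rewrite <- exp_plus, Rplus_opp_r; apply exp_0).
  pose proof (exp_ineq1_le (- x)) as L'. pose proof (exp_pos x).
  assert (exp x - 1 - x = exp x * (1 - (1 + x) * exp (- x))).
  { rewrite Rmult_minus_distr_l, Rmult_1_r. replace (exp x * ((1 + x) * exp (- x))) with ((1 + x) * (exp x * exp (- x))) by ring. rewrite E. ring. }
  assert (exp x <= exp (Rabs x)) by (destruct (Rle_lt_or_eq_dec x (Rabs x) (Rle_abs x)) as [q|q]; [left; now apply exp_increasing|rewrite <- q; lra]).
  assert (exp x * (1 - (1 + x) * exp (- x)) <= exp x * x ^ 2).
  { apply Rmult_le_compat_l; [lra|]. nra. }
  assert (0 <= x ^ 2) by nra. nra.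
- assert (exp x < 1) by (rewrite <- exp_0; apply exp_increasing; lra).
  assert (1 <= exp (Rabs x)) by (pose proof (exp_ineq1_le (Rabs x)); pose proof (Rabs_pos x); lra).
  nra.
Qed.

Lemma ln_one_plus_bounds d : 0 <= d -> d - d ^ 2 <= ln (1 + d) <= d.
Proof.
intros Hd. split.
- assert (H := exp_ineq1_le (- ln (1 + d))). rewrite exp_Ropp, exp_ln in H by lra.
  assert (/ (1 + d) <= 1 - d + d ^ 2).
  { apply Rmult_le_reg_r with (1 + d); [lra|]. rewrite Rinv_l by lra.
    replace ((1 - d + d ^ 2) * (1 + d)) with (1 + d ^ 3) by ring. pose proof (pow_le d 3 Hd). lra. }
  lra.
- assert (H := exp_ineq1_le (ln (1 + d))). rewrite exp_ln in H by lra. lra.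
Qed.

Lemma sqrt_one_plus_bounds d : 0 <= d -> d / 2 - d ^ 2 / 4 <= sqrt (1 + d) - 1 <= d / 2.
Proof.
intros Hd. pose proof (sqrt_sqrt (1 + d) ltac:(lra)) as S. pose proof (sqrt_pos (1 + d)).
set (s := sqrt (1 + d)) in *. 
assert (1 <= s) by nra. split; nra.
Qed.

(** The last term has increments of about ep h^(7/2)/12, larger than the O(h^4) errors; yet it is
    bounded itself, so it changes the total growth only by a bounded factor. *)
Definition phi (sg a1 ep t : R) : R := 3 * a1 / hh t - 3 * kappa sg * ln (hh t) - ep * sqrt (hh t).
Definition rho (sg a1 ep t : R) : R := 2 * exp (phi sg a1 ep t - phi sg a1 ep (t - 1)).

Section Growth.
Variables (sg a1 ep : R).
Hypothesis ep_sign : ep = 1 \/ ep = -1.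

Lemma hh_pow_le n m t : 16 <= t -> (n <= m)%nat -> hh t ^ m <= hh t ^ n.
Proof.
intros Ht nm. pose proof (hh_pos t). pose proof (hh_le_half t Ht).
replace m with (n + (m - n))%nat by lia. rewrite pow_add.
rewrite <- (Rmult_1_r (hh t ^ n)) at 2. apply Rmult_le_compat_l; [apply pow_le; lra|].
rewrite <- (pow1 (m - n)). apply pow_incr. lra.
Qed.

Lemma phi_increment : exists C, 0 <= C /\ forall t, 16 <= t ->
  Rabs (phi sg a1 ep t - phi sg a1 ep (t - 1)
    - (a1 * hh t ^ 2 / 2 + kappa sg * hh t ^ 3 / 2 + ep * (hh t ^ 3 * sqrt (hh t)) / 12)) <= C * hh t ^ 4.
Proof.
exists (3 * Rabs a1 + 3 * Rabs (kappa sg) + 1).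
split; [pose proof (Rabs_pos a1); pose proof (Rabs_pos (kappa sg)); lra|].
intros t Ht. pose proof (hh_pos t) as h0. pose proof (hh_le_half t Ht) as h1.
pose proof (stepq_bounds 1 t ltac:(lra) Ht) as B.
set (d := stepq 1 t - 1). set (h := hh t) in *.
assert (Q : stepq 1 t = 1 + d) by (unfold d; ring).
assert (Hd : h ^ 3 / 6 <= d <= h ^ 3 / 6 + h ^ 6 / 4) by (unfold d; lra).
assert (h3 : 0 < h ^ 3) by (apply pow_lt, h0).
assert (h6 : h ^ 6 = h ^ 3 * h ^ 3) by ring.
assert (h38 : h ^ 3 <= / 8) by (replace (/8) with ((/2) ^ 3) by field; apply pow_incr; lra).
assert (d2 : 0 <= d ^ 2 <= h ^ 6).
{ split; [nra|]. rewrite h6. assert (d <= h ^ 3) by nra. nra. }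
assert (S : hh (t - 1) = h * (1 + d)) by (rewrite hh_step, Q; easy).
assert (d0 : 0 < d) by lra.
assert (sq1 : sqrt h <= 1) by (rewrite <- sqrt_1; apply sqrt_le_1_alt; lra).
assert (sq0 : 0 < sqrt h) by now apply sqrt_lt_R0.
assert (E : phi sg a1 ep t - phi sg a1 ep (t - 1) =
   3 * a1 * (/ h * (1 - / (1 + d))) + 3 * kappa sg * ln (1 + d) + ep * (sqrt h * (sqrt (1 + d) - 1))).
{ unfold phi. rewrite S. fold h. rewrite ln_mult, sqrt_mult by lra. field. lra. }
rewrite E.
replace (3 * a1 * (/ h * (1 - / (1 + d))) + 3 * kappa sg * ln (1 + d) + ep * (sqrt h * (sqrt (1 + d) - 1))
   - (a1 * h ^ 2 / 2 + kappa sg * h ^ 3 / 2 + ep * (h ^ 3 * sqrt h) / 12))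
  with (3 * a1 * (/ h * (1 - / (1 + d) - h ^ 3 / 6)) + 3 * kappa sg * (ln (1 + d) - h ^ 3 / 6)
     + ep * (sqrt h * (sqrt (1 + d) - 1 - h ^ 3 / 12))) by (field; lra).
assert (h46 : h ^ 6 <= h ^ 4) by (apply hh_pow_le; [easy|lia]).
assert (h45 : h ^ 5 <= h ^ 4) by (apply hh_pow_le; [easy|lia]).
assert (T1 : Rabs (/ h * (1 - / (1 + d) - h ^ 3 / 6)) <= h ^ 4).
{ rewrite Rabs_mult, (Rabs_pos_eq (/ h)) by (left; now apply Rinv_0_lt_compat).
  apply Rle_trans with (/ h * h ^ 6); [|replace (/ h * h ^ 6) with (h ^ 5) by (field; lra); lra].
  apply Rmult_le_compat_l; [left; now apply Rinv_0_lt_compat|].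
  assert (I : d - d ^ 2 <= 1 - / (1 + d) <= d).
  { replace (1 - / (1 + d)) with (d * / (1 + d)) by (field; lra).
    assert (1 - d <= / (1 + d) <= 1).
    { split.
      - apply Rmult_le_reg_r with (1 + d); [lra|]. rewrite Rinv_l by lra. nra.
      - rewrite <- Rinv_1 at 2. apply Rinv_le_contravar; lra. }
    split; nra. }
  apply Rabs_le. lra. }
assert (T2 : Rabs (ln (1 + d) - h ^ 3 / 6) <= h ^ 4).
{ pose proof (ln_one_plus_bounds d ltac:(lra)). apply Rabs_le. lra. }
assert (T3 : Rabs (sqrt h * (sqrt (1 + d) - 1 - h ^ 3 / 12)) <= h ^ 4).
{ rewrite Rabs_mult, (Rabs_pos_eq (sqrt h)) by lra.
  assert (Rabs (sqrt (1 + d) - 1 - h ^ 3 / 12) <= h ^ 4).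
  { pose proof (sqrt_one_plus_bounds d ltac:(lra)). apply Rabs_le. lra. }
  pose proof (Rabs_pos (sqrt (1 + d) - 1 - h ^ 3 / 12)). nra. }
eapply Rle_trans; [apply Rabs_triang|]. eapply Rle_trans; [apply Rplus_le_compat_r, Rabs_triang|].
rewrite !Rabs_mult in *. rewrite !(Rabs_pos_eq 3) by lra.
assert (Rabs ep = 1) as -> by (destruct ep_sign as [-> | ->]; [apply Rabs_R1|rewrite Rabs_left; lra]).
pose proof (Rabs_pos a1). pose proof (Rabs_pos (kappa sg)).
assert (3 * Rabs a1 * (Rabs (/ h) * Rabs (1 - / (1 + d) - h ^ 3 / 6)) <= 3 * Rabs a1 * h ^ 4) by (apply Rmult_le_compat_l; lra).
assert (3 * Rabs (kappa sg) * Rabs (ln (1 + d) - h ^ 3 / 6) <= 3 * Rabs (kappa sg) * h ^ 4) by (apply Rmult_le_compat_l; lra).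
lra.
Qed.

Lemma phi_increment_small : exists C, 0 <= C /\ forall t, 16 <= t ->
  Rabs (phi sg a1 ep t - phi sg a1 ep (t - 1)) <= C * hh t ^ 2.
Proof.
destruct phi_increment as [C [C0 H]].
exists (C + Rabs a1 + Rabs (kappa sg) + 1).
split; [pose proof (Rabs_pos a1); pose proof (Rabs_pos (kappa sg)); lra|].
intros t Ht. specialize (H t Ht).
pose proof (hh_pos t) as h0. pose proof (hh_le_half t Ht) as h1. set (h := hh t) in *.
set (P := phi sg a1 ep t - phi sg a1 ep (t - 1)) in *.
assert (h42 : h ^ 4 <= h ^ 2) by (apply hh_pow_le; [easy|lia]).
assert (h32 : h ^ 3 <= h ^ 2) by (apply hh_pow_le; [easy|lia]).
assert (h2 : 0 < h ^ 2) by (apply pow_lt, h0). assert (h3 : 0 < h ^ 3) by (apply pow_lt, h0).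
assert (sq1 : sqrt h <= 1) by (rewrite <- sqrt_1; apply sqrt_le_1_alt; lra).
assert (sq0 : 0 < sqrt h) by now apply sqrt_lt_R0.
replace P with (P - (a1 * h ^ 2 / 2 + kappa sg * h ^ 3 / 2 + ep * (h ^ 3 * sqrt h) / 12)
   + (a1 * (h ^ 2 / 2) + kappa sg * (h ^ 3 / 2) + ep * (h ^ 3 * sqrt h / 12))) by field.
eapply Rle_trans; [apply Rabs_triang|].
eapply Rle_trans; [apply Rplus_le_compat_l; eapply Rle_trans; [apply Rabs_triang|apply Rplus_le_compat_r, Rabs_triang]|].
rewrite !(Rabs_mult a1), !(Rabs_mult (kappa sg)), !(Rabs_mult ep).
assert (Rabs ep = 1) as -> by (destruct ep_sign as [-> | ->]; [apply Rabs_R1|rewrite Rabs_left; lra]).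
rewrite (Rabs_pos_eq (h ^ 2 / 2)), (Rabs_pos_eq (h ^ 3 / 2)), (Rabs_pos_eq (h ^ 3 * sqrt h / 12)) by nra.
pose proof (Rabs_pos a1). pose proof (Rabs_pos (kappa sg)).
assert (h ^ 3 * sqrt h / 12 <= h ^ 2) by nra.
assert (Rabs a1 * (h ^ 2 / 2) <= Rabs a1 * h ^ 2) by (apply Rmult_le_compat_l; lra).
assert (Rabs (kappa sg) * (h ^ 3 / 2) <= Rabs (kappa sg) * h ^ 2) by (apply Rmult_le_compat_l; lra).
assert (C * h ^ 4 <= C * h ^ 2) by (apply Rmult_le_compat_l; lra).
lra.
Qed.

Lemma exp_small_bound C t x : 16 <= t -> 0 <= C -> Rabs x <= C * hh t ^ 2 ->
  Rabs (exp x - 1) <= (C + C ^ 2 * exp C) * hh t ^ 2 /\ Rabs (exp x - 1 - x) <= C ^ 2 * exp C * hh t ^ 4.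
Proof.
intros Ht C0 H. pose proof (hh_pos t) as h0. pose proof (hh_le_half t Ht) as h1. set (h := hh t) in *.
assert (h42 : h ^ 4 <= h ^ 2) by (apply hh_pow_le; [easy|lia]).
assert (h2 : 0 < h ^ 2) by (apply pow_lt, h0).
assert (h21 : h ^ 2 <= 1) by nra.
assert (R : Rabs (exp x - 1 - x) <= C ^ 2 * exp C * h ^ 4).
{ eapply Rle_trans; [apply exp_sub_affine_bound|].
  assert (exp (Rabs x) <= exp C).
  { assert (Rabs x <= C) by nra. destruct (Rle_lt_or_eq_dec _ _ H0) as [L|L]; [left; now apply exp_increasing|rewrite L; lra]. }
  assert (x ^ 2 <= C ^ 2 * h ^ 4).
  { rewrite <- (pow2_abs x). replace (C ^ 2 * h ^ 4) with ((C * h ^ 2) ^ 2) by ring.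
    apply pow_incr. split; [apply Rabs_pos|easy]. }
  replace (C ^ 2 * exp C * h ^ 4) with (C ^ 2 * h ^ 4 * exp C) by ring.
  apply Rmult_le_compat; try easy; [nra|left; apply exp_pos]. }
split; [|easy].
replace (exp x - 1) with ((exp x - 1 - x) + x) by ring.
eapply Rle_trans; [apply Rabs_triang|].
assert (0 <= C ^ 2 * exp C) by (apply Rmult_le_pos; [nra|left; apply exp_pos]).
assert (C ^ 2 * exp C * h ^ 4 <= C ^ 2 * exp C * h ^ 2) by (apply Rmult_le_compat_l; lra). lra.
Qed.

Lemma rho_expand : exists C, 0 <= C /\ forall t, 16 <= t ->
  Rabs (rho sg a1 ep t - (growth sg a1 t + ep * (hh t ^ 3 * sqrt (hh t)) / 6)) <= C * hh t ^ 4.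
Proof.
destruct phi_increment as [C [C0 H]]. destruct phi_increment_small as [C' [C0' H']].
exists (2 * C + 2 * (C' ^ 2 * exp C')). split.
{ assert (0 <= C' ^ 2 * exp C') by (apply Rmult_le_pos; [nra|left; apply exp_pos]). lra. }
intros t Ht. specialize (H t Ht). specialize (H' t Ht).
destruct (exp_small_bound C' t _ Ht C0' H') as [_ E].
unfold rho, growth. set (P := phi sg a1 ep t - phi sg a1 ep (t - 1)) in *. set (h := hh t) in *.
replace (2 * exp P - _) with
  (2 * (P - (a1 * h ^ 2 / 2 + kappa sg * h ^ 3 / 2 + ep * (h ^ 3 * sqrt h) / 12)) + 2 * (exp P - 1 - P)) by field.
eapply Rle_trans; [apply Rabs_triang|].
rewrite !(Rabs_mult 2), (Rabs_pos_eq 2) by lra. lra.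
Qed.

Lemma rho_pos t : 0 < rho sg a1 ep t.
Proof. apply Rmult_lt_0_compat; [lra|apply exp_pos]. Qed.

Lemma inv_rho_expand a : 0 <= a <= 3 ->
  exists r, Bd r /\ forall t k, Dom t k -> / rho sg a1 ep (t - a) = / 2 + hh t ^ 2 * r t k.
Proof.
intros Ha. destruct phi_increment_small as [C [C0 H]].
exists (fun t k => (/ rho sg a1 ep (t - a) - / 2) / hh t ^ 2).
split; [|intros t k D; pose proof (hh_pos t); pose proof (rho_pos (t - a)); field; lra].
set (A := C + C ^ 2 * exp C).
assert (A0 : 0 <= A).
{ assert (0 <= C ^ 2 * exp C) by (apply Rmult_le_pos; [nra|left; apply exp_pos]). unfold A; lra. }
apply Bd_bounded with (2 * A). intros t k D. destruct (Dom_z t k D) as [[h0 h1] _]. destruct D as [Dt _].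
specialize (H (t - a) ltac:(lra)).
set (P := phi sg a1 ep (t - a) - phi sg a1 ep (t - a - 1)) in *.
rewrite <- (Rabs_Ropp P) in H.
destruct (exp_small_bound C (t - a) (- P) ltac:(lra) C0 H) as [E _]. fold A in E.
unfold rho. fold P. rewrite Rinv_mult, <- exp_Ropp.
replace (/ 2 * exp (- P) - / 2) with (/ 2 * (exp (- P) - 1)) by field.
unfold Rdiv. rewrite !Rabs_mult, (Rabs_pos_eq (/ 2)), (Rabs_pos_eq (/ _ ^ 2)) by
  (try (left; apply Rinv_0_lt_compat, pow_lt); lra).
apply Rmult_le_reg_r with (hh t ^ 2); [apply pow_lt, h0|].
rewrite (Rmult_assoc _ (/ hh t ^ 2)), Rinv_l, Rmult_1_r by (apply pow_nonzero; lra).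
assert (S : hh (t - a) <= 2 * hh t).
{ rewrite hh_step. pose proof (stepq_bounds a t Ha ltac:(lra)) as B.
  assert (hh t ^ 3 <= / 8) by (replace (/8) with ((/2) ^ 3) by field; apply pow_incr; lra).
  assert (hh t ^ 6 <= / 64) by (replace (/64) with ((/2) ^ 6) by field; apply pow_incr; lra).
  assert (a ^ 2 <= 9) by nra. assert (0 < hh t ^ 6) by (apply pow_lt, h0). assert (0 < hh t ^ 3) by (apply pow_lt, h0).
  assert (stepq a t <= 2) by nra. nra. }
pose proof (hh_pos (t - a)).
assert (hh (t - a) ^ 2 <= 4 * hh t ^ 2) by nra.
assert (A * hh (t - a) ^ 2 <= A * (4 * hh t ^ 2)) by (apply Rmult_le_compat_l; lra). lra.
Qed.

(* [(m - 1) / (n (n - 1))] in the variables [t = n + m], [k = n - m + 1]. *)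
Definition vcherry (t k : R) : R := 2 * (t - k - 1) / ((t + k - 1) * (t + k - 3)).
(** The cherry term lives at t - 3, two steps below the level t - 1 of the other terms, whence two
    inverse growth factors. *)
Definition vweight (t k : R) : R := vcherry t k * / rho sg a1 ep (t - 1) * / rho sg a1 ep (t - 2).

Lemma Ex_vcherry : Ex vcherry (fun _ _ => 0) (fun _ _ => 0) (fun _ _ => 0) (fun _ _ => 1).
Proof.
assert (Aux : forall t k, Dom t k -> 1 <= 2 + hh t ^ 2 * (hh t * k) - 3 * hh t ^ 3 /\ 1 <= 2 + hh t ^ 2 * (hh t * k) - hh t ^ 3).
{ intros t k D. destruct (Dom_z t k D) as [[h0 h1] [h2 h3]].
  assert (hh t ^ 3 <= / 8) by (replace (/8) with ((/2) ^ 3) by field; apply pow_incr; lra).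
  assert (0 <= hh t ^ 2 * (hh t * k)) by (apply Rmult_le_pos; nra). lra. }
eapply Ex_rem with (r := fun t k => hh t * (-6 * (hh t * k) + 6 * hh t - hh t ^ 2 * (hh t * k) ^ 2
    + 4 * hh t ^ 3 * (hh t * k) - 3 * hh t ^ 4) *
   / (2 + hh t ^ 2 * (hh t * k) - hh t ^ 3) * / (2 + hh t ^ 2 * (hh t * k) - 3 * hh t ^ 3)); try solve [bd].
- assert (K : forall x, 1 <= x -> Rabs (/ x) <= 1).
  { intros x Hx. rewrite Rabs_pos_eq by (left; apply Rinv_0_lt_compat; lra).
    rewrite <- Rinv_1. apply Rinv_le_contravar; lra. }
  apply Bd_mult; [apply Bd_mult; [bd|]|]; apply Bd_bounded with 1; intros t k D; apply K, Aux, D.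
- intros t k D. destruct (Dom_z t k D) as [[h0 h1] [h2 h3]]. destruct (Aux t k D) as [A1 A2].
  unfold vcherry. destruct D as [Dt Dk].
  replace (2 * (t - k - 1) / ((t + k - 1) * (t + k - 3))) with
   (2 * hh t ^ 3 * (2 - hh t ^ 2 * (hh t * k) - hh t ^ 3) /
     ((2 + hh t ^ 2 * (hh t * k) - hh t ^ 3) * (2 + hh t ^ 2 * (hh t * k) - 3 * hh t ^ 3))).
  + field. lra.
  + pose proof (hh_cube_mul t ltac:(lra)) as T.
    replace (2 - hh t ^ 2 * (hh t * k) - hh t ^ 3) with (hh t ^ 3 * (t - k - 1)) by (rewrite <- T; ring).
    replace (2 + hh t ^ 2 * (hh t * k) - hh t ^ 3) with (hh t ^ 3 * (t + k - 1)) by (rewrite <- T; ring).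
    replace (2 + hh t ^ 2 * (hh t * k) - 3 * hh t ^ 3) with (hh t ^ 3 * (t + k - 3)) by (rewrite <- T; ring).
    field. repeat split; lra.
Qed.

Lemma Ex_vweight : Ex vweight (fun _ _ => 0) (fun _ _ => 0) (fun _ _ => 0) (fun _ _ => / 4).
Proof.
destruct (inv_rho_expand 1 ltac:(lra)) as [r1 [B1 H1]].
destruct (inv_rho_expand 2 ltac:(lra)) as [r2 [B2 H2]].
assert (E1 : Ex (fun t _ => / rho sg a1 ep (t - 1)) (fun _ _ => / 2) (fun _ _ => 0) r1 (fun _ _ => 0)).
{ eapply Ex_rem with (r := fun _ _ => 0); bd. intros t k D. rewrite (H1 t k D). ring. }
assert (E2 : Ex (fun t _ => / rho sg a1 ep (t - 2)) (fun _ _ => / 2) (fun _ _ => 0) r2 (fun _ _ => 0)).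
{ eapply Ex_rem with (r := fun _ _ => 0); bd. intros t k D. rewrite (H2 t k D). ring. }
pose proof Ex_vcherry as Ev.
eapply Ex_ext; [..|unfold vweight; eapply Ex_mult; [eapply Ex_mult; [exact Ev|exact E1]|exact E2]];
  intros; cbv beta; try reflexivity; field.
Qed.

End Growth.

(** * Super- and subsolutions *)

Lemma hh_small d : 0 < d -> exists T, 32 <= T /\ forall t, T <= t -> hh t <= d.
Proof.
intros Hd. exists (Rmax 32 (2 / d ^ 3)). split; [apply Rmax_l|].
intros t Ht. pose proof (Rmax_l 32 (2 / d ^ 3)). pose proof (Rmax_r 32 (2 / d ^ 3)).
assert (d3 : 0 < d ^ 3) by now apply pow_lt.
apply pow3_le_reg; [lra|]. rewrite hh_cube by lra.
apply Rmult_le_reg_r with t; [lra|]. unfold Rdiv. rewrite Rmult_assoc, Rinv_l by lra.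
assert (2 / d ^ 3 <= t) by lra. apply Rmult_le_compat_l with (r := d ^ 3) in H1; [|lra].
replace (d ^ 3 * (2 / d ^ 3)) with 2 in H1 by (field; lra). lra.
Qed.

Lemma sqrt_small x d : 0 <= x -> 0 < d -> x <= d * d -> sqrt x <= d.
Proof.
intros Hx Hd H. rewrite <- (sqrt_square d) by lra. now apply sqrt_le_1_alt.
Qed.

Lemma Rinv_unit_interval x : 1 <= x -> 0 < / x <= 1.
Proof.
intros Hx. split; [apply Rinv_0_lt_compat; lra|].
rewrite <- Rinv_1. apply Rinv_le_contravar; lra.
Qed.

(* A linear correction of relative size [h^(3/2)]: it dominates every error term at bounded-below [z]. *)
Definition lin (t k : R) : R := hh t ^ 2 * sqrt (hh t) * k.

(** The recurrence divided by n! and by the growth up to t - 1; [weight_step] makes the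
    translation. *)
Definition stepop (sg a1 ep : R) (F : R -> R -> R) (t k : R) : R :=
  wup t k * F (t - 1) (k - 1) + F (t - 1) (k + 1) - sg * (vweight sg a1 ep t k * F (t - 3) (k - 1)).

(* [ep = 1] gives the supersolution, [ep = -1] the subsolution. *)
Section Barrier.

Variables (sg a1 ep : R).
Hypothesis sg_range : 0 <= sg <= 1.
Hypothesis ep_sign : ep = 1 \/ ep = -1.

Lemma rho_large : exists T, 32 <= T /\ forall t, T <= t -> 1 <= rho sg a1 ep t.
Proof.
destruct (rho_expand sg a1 ep ep_sign) as [C [C0 H]].
set (A := Rabs a1 + Rabs (kappa sg) + 1 + C).
assert (A0 : 0 < A) by (unfold A; pose proof (Rabs_pos a1); pose proof (Rabs_pos (kappa sg)); lra).
destruct (hh_small (/ A)) as [T [T0 HT]]; [now apply Rinv_0_lt_compat|].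
exists T. split; [easy|]. intros t Ht. specialize (HT t Ht). specialize (H t ltac:(lra)).
pose proof (hh_pos t) as h0. pose proof (hh_le_half t ltac:(lra)) as h1. set (h := hh t) in *.
assert (AH : A * h <= 1).
{ apply Rmult_le_compat_l with (r := A) in HT; [|lra]. rewrite Rinv_r in HT; lra. }
assert (sq1 : sqrt h <= 1) by (rewrite <- sqrt_1; apply sqrt_le_1_alt; lra).
assert (sq0 : 0 < sqrt h) by now apply sqrt_lt_R0.
apply Rabs_le_between in H. destruct H as [H _]. unfold growth in H. fold h in H.
assert (h21 : h ^ 2 <= h) by nra. assert (h31 : h ^ 3 <= h) by nra. assert (h41 : h ^ 4 <= h) by (assert (h^4 = h^2*h^2) by ring; nra).
assert (h2 : 0 < h ^ 2) by nra. assert (h3 : 0 < h ^ 3) by nra.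
assert (B1 : - (Rabs a1 * h) <= a1 * h ^ 2).
{ pose proof (Rle_abs (- a1)). rewrite Rabs_Ropp in *. pose proof (Rabs_pos a1). nra. }
assert (B2 : - (Rabs (kappa sg) * h) <= kappa sg * h ^ 3).
{ pose proof (Rle_abs (- kappa sg)). rewrite Rabs_Ropp in *. pose proof (Rabs_pos (kappa sg)). nra. }
assert (B3 : - h <= ep * (h ^ 3 * sqrt h) / 6).
{ assert (0 <= h ^ 3 * sqrt h <= h) by nra. destruct ep_sign as [-> | ->]; lra. }
assert (C * h ^ 4 <= C * h) by (apply Rmult_le_compat_l; lra).
unfold A in AH. lra.
Qed.

(** The denominator 2 + h^2 z - h^3 lies between 1 and 5, so up to O(h^3) the loss 1 - wup is of
    order h^2 z at all heights. *)
Lemma wup_bounds t k : Dom t k ->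
  2 / 5 * (hh t ^ 2 * (hh t * k)) - 4 * hh t ^ 3 <= 1 - wup t k <= 2 * (hh t ^ 2 * (hh t * k)) /\ 0 <= wup t k <= 2.
Proof.
intros D. destruct (Dom_z t k D) as [[h0 h1] [h2 h3]].
assert (h38 : hh t ^ 3 <= / 8) by (replace (/8) with ((/2) ^ 3) by field; apply pow_incr; lra).
assert (h30 : 0 < hh t ^ 3) by now apply pow_lt.
pose proof (hh_cube_mul t ltac:(destruct D; lra)) as T.
set (a := hh t ^ 2 * (hh t * k)) in *.
assert (a0 : 0 < a) by (unfold a; apply Rmult_lt_0_compat; [now apply pow_lt|lra]).
assert (E : wup t k = (2 - a + 3 * hh t ^ 3) / (2 + a - hh t ^ 3)).
{ destruct D as [Dt Dk]. unfold wup.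
  replace (2 - a + 3 * hh t ^ 3) with (hh t ^ 3 * (t - k + 3)) by (unfold a; rewrite <- T; ring).
  replace (2 + a - hh t ^ 3) with (hh t ^ 3 * (t + k - 1)) by (unfold a; rewrite <- T; ring).
  field. split; lra. }
set (b := hh t ^ 3) in *. set (den := 2 + a - b) in *.
assert (D1 : 1 <= den <= 5) by (unfold den; lra).
assert (W : 1 - wup t k = (2 * a - 4 * b) * / den) by (rewrite E; unfold den; field; unfold den in D1; lra).
assert (I : / 5 <= / den <= 1).
{ split; [apply Rinv_le_contravar; lra|]. rewrite <- Rinv_1. apply Rinv_le_contravar; lra. }
rewrite W. split; [split; nra|].
assert (0 <= wup t k).
{ unfold wup. destruct D as [Dt Dk]. apply Rmult_le_pos; [lra|left; apply Rinv_0_lt_compat; lra]. }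
assert (- (4 * b) <= (2 * a - 4 * b) * / den) by nra. lra.
Qed.

Lemma lin_step b t s k : lin (t - b) (k + s) = hh t ^ 2 * sqrt (hh t) * (stepq b t ^ 2 * sqrt (stepq b t) * (k + s)).
Proof.
unfold lin. rewrite hh_step. pose proof (hh_pos t). pose proof (hh_pos (t - b)).
rewrite sqrt_mult; [ring|lra|]. unfold stepq. left. now apply Rdiv_lt_0_compat.
Qed.

Lemma lin_ratio_bounds b t : 0 <= b <= 3 -> 32 <= t ->
  1 <= stepq b t ^ 2 * sqrt (stepq b t) <= 1 + 20 * hh t ^ 3.
Proof.
intros Hb Ht. pose proof (stepq_bounds b t Hb ltac:(lra)) as B.
pose proof (hh_pos t) as h0. pose proof (hh_le_half t ltac:(lra)) as h1.
assert (h38 : hh t ^ 3 <= / 16).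
{ pose proof (hh_cube_mul t ltac:(lra)). nra. }
assert (h30 : 0 < hh t ^ 3) by now apply pow_lt.
replace (hh t ^ 6) with (hh t ^ 3 * hh t ^ 3) in B by ring. set (c := hh t ^ 3) in *.
assert (Q : 1 <= stepq b t <= 1 + c).
{ assert (b ^ 2 <= 9) by nra. assert (b ^ 2 * (c * c) <= 9 * (c * c)) by (apply Rmult_le_compat_r; nra).
  assert (0 <= b * c <= 3 * c) by (split; nra). split; nra. }
assert (S : 1 <= sqrt (stepq b t) <= stepq b t).
{ pose proof (sqrt_sqrt (stepq b t) ltac:(lra)). pose proof (sqrt_pos (stepq b t)). split; nra. }
set (q := stepq b t) in *. set (r := sqrt q) in *.
assert (1 <= q ^ 2 <= 1 + 3 * c) by nra. split; [nra|].
assert (q ^ 2 * r <= (1 + 3 * c) * (1 + c)) by (apply Rmult_le_compat; lra). nra.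
Qed.

(** On a linear function the Airy curvature is absent, and the loss in [wup] is a gain of order h^2
    z. It beats the deficit |a1| h^2 of the growth factor once z is large. *)
Lemma lin_barrier : exists T, 32 <= T /\ forall t k, T <= t -> Dom t k ->
  hh t ^ 3 * sqrt (hh t) * (hh t * k) * (hh t * k / 5 - Rabs a1 - 1) <=
  rho sg a1 ep t * lin t k - stepop sg a1 ep lin t k.
Proof.
destruct (rho_expand sg a1 ep ep_sign) as [C [C0 HR]].
destruct rho_large as [T1 [T10 HT1]].
(* The 100 covers the numerical multiples of h^3 lost below: 64 in [N3], and 8 in [N1] and [N2]
   together. *)
set (A := Rabs (kappa sg) + 1 + C + 100).
assert (A0 : 0 < A) by (unfold A; pose proof (Rabs_pos (kappa sg)); lra).
destruct (hh_small (/ A)) as [T2 [T20 HT2]]; [now apply Rinv_0_lt_compat|].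
exists (T1 + T2). split; [lra|]. intros t k Ht D.
specialize (HT2 t ltac:(lra)). specialize (HR t ltac:(lra)).
pose proof (HT1 (t - 1) ltac:(lra)) as R1. pose proof (HT1 (t - 2) ltac:(lra)) as R2.
destruct (Dom_z t k D) as [[h0 h1] [h2 h3]].
destruct (wup_bounds t k D) as [[W1 W2] [W3 W4]].
pose proof (lin_ratio_bounds 1 t ltac:(lra) ltac:(lra)) as G1.
pose proof (lin_ratio_bounds 3 t ltac:(lra) ltac:(lra)) as G3.
unfold stepop. replace (k - 1) with (k + -1) by ring.
pose proof (lin_step 1 t (-1) k) as L1. pose proof (lin_step 1 t 1 k) as L2. pose proof (lin_step 3 t (-1) k) as L3.
rewrite L1, L2, L3. clear L1 L2 L3.
assert (V : - hh t ^ 3 <= vweight sg a1 ep t k).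
{ unfold vweight, vcherry. destruct D as [Dt Dk].
  assert (I1 : 0 < / rho sg a1 ep (t - 1) <= 1) by (apply Rinv_unit_interval; lra).
  assert (I2 : 0 < / rho sg a1 ep (t - 2) <= 1) by (apply Rinv_unit_interval; lra).
  rewrite (hh_cube t) by lra.
  assert (P : 0 < (t + k - 1) * (t + k - 3)) by (apply Rmult_lt_0_compat; lra).
  assert (Q : - (2 / t) <= 2 * (t - k - 1) / ((t + k - 1) * (t + k - 3))).
  { apply Rmult_le_reg_r with ((t + k - 1) * (t + k - 3)); [easy|].
    unfold Rdiv at 2. rewrite Rmult_assoc, Rinv_l, Rmult_1_r by lra.
    apply Rle_trans with (- (2 / t) * (t * 2)).
    - assert (t * 2 <= (t + k - 1) * (t + k - 3)) by nra. assert (0 < 2 / t) by (apply Rdiv_lt_0_compat; lra). nra.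
    - replace (- (2 / t) * (t * 2)) with (-4) by (field; lra). lra. }
  assert (0 < 2 / t) by (apply Rdiv_lt_0_compat; lra).
  set (x := 2 * (t - k - 1) / ((t + k - 1) * (t + k - 3))) in *.
  assert (- (2 / t) <= x * / rho sg a1 ep (t - 1)) by nra. nra. }
set (G := stepq 1 t ^ 2 * sqrt (stepq 1 t)) in *. set (G' := stepq 3 t ^ 2 * sqrt (stepq 3 t)) in *.
set (w := wup t k) in *. set (v := vweight sg a1 ep t k) in *. set (r := rho sg a1 ep t) in *.
unfold lin. set (h := hh t) in *.
replace (h ^ 3 * sqrt h * (h * k) * (h * k / 5 - Rabs a1 - 1)) with
  (h ^ 2 * sqrt h * (k * (h ^ 2 * (h * k / 5 - Rabs a1 - 1)))) by ring.
match goal with |- _ <= ?a => replace a with (h ^ 2 * sqrt h * (k * (r - (1 + w) * G) - G * (1 - w) + sg * (v * (G' * (k - 1))))) by ring end.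
assert (sq1 : sqrt h <= 1) by (rewrite <- sqrt_1; apply sqrt_le_1_alt; lra).
assert (sq0 : 0 < sqrt h) by now apply sqrt_lt_R0.
apply Rmult_le_compat_l; [apply Rmult_le_pos; [nra|lra]|].
assert (k1 : 1 <= k) by (destruct D; lra).
assert (h2' : 0 < h ^ 2) by nra. assert (h3' : 0 < h ^ 3) by nra.
assert (h316 : h ^ 3 <= / 16) by (unfold h; pose proof (hh_cube_mul t ltac:(lra)); nra).
assert (Z : h ^ 2 * (h * k) = h ^ 3 * k) by ring.
assert (N1 : G * (1 - w) <= 5 * h ^ 3 * k).
{ rewrite Z in *. destruct (Rle_or_lt 0 (1 - w)); [|nra].
  apply Rle_trans with (9 / 4 * (2 * (h ^ 3 * k))); [apply Rmult_le_compat; lra|nra]. }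
assert (N2 : - (3 * h ^ 3 * k) <= sg * (v * (G' * (k - 1)))).
{ assert (0 <= G' * (k - 1) <= 3 * k) by (split; nra).
  set (m := G' * (k - 1)) in *.
  assert (- h ^ 3 * (3 * k) <= v * m).
  { apply Rle_trans with (- h ^ 3 * m); [nra|]. apply Rmult_le_compat_r; lra. }
  assert (0 <= h ^ 3 * k) by nra. nra. }
assert (N3 : (1 + w) * G <= 2 - 2 / 5 * (h ^ 2 * (h * k)) + 4 * h ^ 3 + 60 * h ^ 3).
{ replace ((1 + w) * G) with ((1 + w) + (1 + w) * (G - 1)) by ring.
  assert ((1 + w) * (G - 1) <= 3 * (20 * h ^ 3)) by (apply Rmult_le_compat; lra). lra. }
assert (N4 : 2 - Rabs a1 * h ^ 2 - (Rabs (kappa sg) + 1 + C) * h ^ 3 <= r).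
{ apply Rabs_le_between in HR. destruct HR as [HR _]. unfold growth in HR. fold h in HR.
  assert (h43 : h ^ 4 <= h ^ 3) by (apply hh_pow_le; [lra|lia]).
  assert (B1 : - (Rabs a1 * h ^ 2) <= a1 * h ^ 2).
  { pose proof (Rle_abs (- a1)). rewrite Rabs_Ropp in *. nra. }
  assert (B2 : - (Rabs (kappa sg) * h ^ 3) <= kappa sg * h ^ 3).
  { pose proof (Rle_abs (- kappa sg)). rewrite Rabs_Ropp in *. nra. }
  assert (B3 : - h ^ 3 <= ep * (h ^ 3 * sqrt h) / 6).
  { assert (0 <= h ^ 3 * sqrt h <= h ^ 3) by nra. destruct ep_sign as [-> | ->]; lra. }
  assert (C * h ^ 4 <= C * h ^ 3) by (apply Rmult_le_compat_l; lra). lra. }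
assert (AH : A * h <= 1).
{ apply Rmult_le_compat_l with (r := A) in HT2; [|lra]. rewrite Rinv_r in HT2; lra. }
assert (AH3 : A * h ^ 3 <= h ^ 2) by (replace (A * h ^ 3) with (A * h * h ^ 2) by ring; nra).
assert (F : h ^ 2 * (h * k / 5 - Rabs a1 - 1) + 8 * h ^ 3 <= r - (1 + w) * G).
{ unfold A in AH3. assert (0 <= h ^ 2 * (h * k)) by (apply Rmult_le_pos; lra). lra. }
apply Rmult_le_compat_l with (r := k) in F; [|lra]. lra.
Qed.

Variables (y y' : R -> R) (M : R).
Hypothesis dy : forall x, is_derive y x (y' x).
Hypothesis dy' : forall x, is_derive y' x (x * y x).
Hypothesis y_a1 : y a1 = 0.
Hypothesis y_pos : forall x, a1 < x -> 0 < y x.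
Hypothesis M_pos : 0 < M.
Hypothesis bound : forall z, 0 <= z ->
  Rabs (y (a1 + z)) <= M * exp (- z) /\ Rabs (y' (a1 + z)) <= M * exp (- z).
Hypothesis lower : forall B, exists c, 0 < c /\ forall z, 0 <= z <= B -> c * z <= y (a1 + z).

Lemma airy_nonneg z : 0 <= z -> 0 <= y (a1 + z).
Proof.
intros [H|<-]; [left; apply y_pos; lra|rewrite Rplus_0_r, y_a1; lra].
Qed.

Lemma airy_pow_bound p : exists C, 0 <= C /\ forall z, 0 <= z -> (1 + z) ^ p * y (a1 + z) <= C * exp (- z / 2).
Proof.
destruct (pow_mult_exp_bounded p) as [C [C0 H]]. exists (M * C). split; [nra|].
intros z Hz. specialize (H z Hz). destruct (bound z Hz) as [B _].
pose proof (Rle_abs (y (a1 + z))). pose proof (exp_pos (- z / 2)).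
assert (0 <= (1 + z) ^ p) by (apply pow_le; lra).
apply Rle_trans with ((1 + z) ^ p * (M * exp (- z))); [apply Rmult_le_compat_l; lra|].
replace (exp (- z)) with (exp (- z / 2) * exp (- z / 2)) by (rewrite <- exp_plus; f_equal; field).
replace ((1 + z) ^ p * (M * (exp (- z / 2) * exp (- z / 2)))) with (M * ((1 + z) ^ p * exp (- z / 2)) * exp (- z / 2)) by ring.
apply Rmult_le_compat_r; [lra|]. apply Rmult_le_compat_l; lra.
Qed.

Lemma gauge_lower b z : 0 <= z -> 1 - b * z ^ 2 / 3 <= gauge sg b z.
Proof.
intros Hz. unfold gauge, beta. assert (0 <= (11 / 12 - sg / 8) * b ^ 2 * z); [|lra].
apply Rmult_le_pos; [apply Rmult_le_pos|]; nra.
Qed.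

(** The profile can be negative only where s = h z^2/3 exceeds 1. There - s >= - s^3, and
    boundedness of z^6 y turns s^3 y into O(h^3). *)
Lemma profile_lower : exists C, 0 <= C /\ forall t k, 0 <= k -> - C * hh t ^ 3 <= profile sg y a1 t k.
Proof.
destruct (airy_pow_bound 6) as [C [C0 H]]. exists C. split; [easy|].
intros t k Hk. pose proof (hh_pos t) as h0. set (h := hh t) in *.
assert (z0 : 0 <= h * k) by nra. set (z := h * k) in *. unfold profile. fold h. fold z.
pose proof (airy_nonneg z z0) as F. pose proof (gauge_lower h z z0) as G.
set (s := h * z ^ 2 / 3) in *. assert (s0 : 0 <= s) by (unfold s; nra).
assert (h3 : 0 < h ^ 3) by now apply pow_lt.
destruct (Rle_or_lt s 1) as [S|S].
- assert (0 <= gauge sg h z * y (a1 + z)) by (apply Rmult_le_pos; lra). nra.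
- assert (S3 : s <= s ^ 3) by nra.
  specialize (H z z0).
  assert (exp (- z / 2) <= 1) by (rewrite <- exp_0; destruct z0 as [z0| <-]; [left; apply exp_increasing; lra|right; f_equal; field]).
  assert (H' : (1 + z) ^ 6 * y (a1 + z) <= C) by nra.
  assert (P : s ^ 3 <= h ^ 3 * (1 + z) ^ 6).
  { unfold s. replace ((h * z ^ 2 / 3) ^ 3) with (h ^ 3 * (z ^ 6 / 27)) by field.
    apply Rmult_le_compat_l; [lra|]. assert (z ^ 6 <= (1 + z) ^ 6) by (apply pow_incr; lra).
    assert (0 <= z ^ 6) by (apply pow_le; lra). lra. }
  apply Rle_trans with (- s ^ 3 * y (a1 + z)); [|apply Rmult_le_compat_r; lra].
  assert (s ^ 3 * y (a1 + z) <= h ^ 3 * (1 + z) ^ 6 * y (a1 + z)) by (apply Rmult_le_compat_r; lra).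
  assert (h ^ 3 * ((1 + z) ^ 6 * y (a1 + z)) <= h ^ 3 * C) by (apply Rmult_le_compat_l; lra). lra.
Qed.

Definition barrier (eta t k : R) : R := profile sg y a1 t k + ep * eta * lin t k.

(** Put u = h^(7/2). For z < B the margin on the profile is at least c u z/24 and pays for the
    linear term and for the O(h^4 z) error. For z >= B the linear term gains at least eta u z, which
    pays for the O(h^4) error and for a negative profile. *)
Lemma barrier_inequality : exists eta T, 0 < eta /\ 32 <= T /\ forall t k, T <= t -> Dom t k ->
  0 <= ep * (rho sg a1 ep t * barrier eta t k - stepop sg a1 ep (barrier eta) t k).
Proof.
destruct (profile_recursion_error a1 sg (vweight sg a1 ep) (Ex_vweight sg a1 ep ep_sign) y y' M dy dy' y_a1 M_pos bound) as [C [C0 HE]].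
destruct (rho_expand sg a1 ep ep_sign) as [C1 [C10 HR]].
destruct lin_barrier as [T1 [T10 HL]].
destruct profile_lower as [C3 [C30 HX]].
(* So that z/5 - |a1| - 1 >= 1 for z >= B. *)
set (B := 5 * (Rabs a1 + 2)). assert (B0 : 10 <= B) by (unfold B; pose proof (Rabs_pos a1); lra).
destruct (lower B) as [c [c0 Hc]].
(* At bounded z the linear term costs eta (|a1| + 1) u z = c u z/48, half of the margin. *)
set (eta := c / (48 * (Rabs a1 + 1))).
assert (A1 : 0 < 48 * (Rabs a1 + 1)) by (pose proof (Rabs_pos a1); lra).
assert (eta0 : 0 < eta) by (unfold eta; now apply Rdiv_lt_0_compat).
(* With sqrt h <= m, the error of [rho] takes at most half of u/6, the profile error fits into the
   other c/48, and for z >= B all errors stay below eta u. *)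
set (m := Rmin (Rmin (/ (12 * C1 + 1)) (c / (48 * (C + 1)))) (eta / (C3 + C + 1))).
assert (m1 : m <= / (12 * C1 + 1)) by (unfold m; eapply Rle_trans; [apply Rmin_l|apply Rmin_l]).
assert (m2 : m <= c / (48 * (C + 1))) by (unfold m; eapply Rle_trans; [apply Rmin_l|apply Rmin_r]).
assert (m3 : m <= eta / (C3 + C + 1)) by apply Rmin_r.
assert (m0 : 0 < m).
{ unfold m. repeat apply Rmin_pos; [apply Rinv_0_lt_compat|apply Rdiv_lt_0_compat|apply Rdiv_lt_0_compat]; lra. }
destruct (hh_small (m * m) ltac:(nra)) as [T2 [T20 HT2]].
destruct (hh_small (/ (B * B))) as [T3 [T30 HT3]]; [apply Rinv_0_lt_compat; nra|].
exists eta, (T1 + T2 + T3). split; [easy|]. split; [lra|]. intros t k Ht D.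
specialize (HL t k ltac:(lra) D). specialize (HE t k D). cbv zeta in HE.
specialize (HR t ltac:(lra)). specialize (HT2 t ltac:(lra)). specialize (HT3 t ltac:(lra)).
destruct (Dom_z t k D) as [[h0 h1] [h2 h3]].
specialize (HX t k ltac:(destruct D; lra)).
set (X := profile sg y a1 t k) in *.
set (E := wup t k * profile sg y a1 (t - 1) (k - 1) + profile sg y a1 (t - 1) (k + 1)
      - sg * (vweight sg a1 ep t k * profile sg y a1 (t - 3) (k - 1)) - growth sg a1 t * X) in *.
assert (epp : ep * ep = 1) by (destruct ep_sign as [-> | ->]; ring).
assert (eq : ep * (rho sg a1 ep t * barrier eta t k - stepop sg a1 ep (barrier eta) t k) =
  ep * (rho sg a1 ep t - growth sg a1 t) * X - ep * E + eta * (rho sg a1 ep t * lin t k - stepop sg a1 ep lin t k)).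
{ transitivity (ep * (rho sg a1 ep t - growth sg a1 t) * X - ep * E + ep * ep * eta * (rho sg a1 ep t * lin t k - stepop sg a1 ep lin t k)).
  - unfold barrier, stepop, E. fold X. ring.
  - rewrite epp. ring. }
rewrite eq. clear eq.
set (L := rho sg a1 ep t * lin t k - stepop sg a1 ep lin t k) in *.
set (h := hh t) in *. set (z := h * k) in *.
assert (sq0 : 0 < sqrt h) by now apply sqrt_lt_R0.
assert (sqm : sqrt h <= m) by (apply sqrt_small; lra).
assert (sqq : sqrt h * sqrt h = h) by (apply sqrt_sqrt; lra).
assert (h3' : 0 < h ^ 3) by now apply pow_lt.
set (u := h ^ 3 * sqrt h) in *. assert (u0 : 0 < u) by (unfold u; now apply Rmult_lt_0_compat).
assert (h4 : h ^ 4 = u * sqrt h) by (unfold u; replace (h ^ 4) with (h ^ 3 * h) by ring; rewrite <- sqq at 2; ring).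
rewrite h4 in *.
assert (R : u / 12 <= ep * (rho sg a1 ep t - growth sg a1 t) <= u / 3).
{ assert (K : Rabs (ep * (rho sg a1 ep t - growth sg a1 t) - u / 6) <= u / 12).
  { replace (ep * (rho sg a1 ep t - growth sg a1 t) - u / 6) with (ep * (rho sg a1 ep t - (growth sg a1 t + ep * u / 6))).
    - rewrite Rabs_mult. assert (Rabs ep = 1) as -> by (destruct ep_sign as [-> | ->]; [apply Rabs_R1|rewrite Rabs_left; lra]).
      rewrite Rmult_1_l. eapply Rle_trans; [apply HR|].
      assert ((12 * C1 + 1) * sqrt h <= 1).
      { apply Rle_trans with ((12 * C1 + 1) * / (12 * C1 + 1)); [apply Rmult_le_compat_l; lra|rewrite Rinv_r; lra]. }
      nra.
    - transitivity (ep * (rho sg a1 ep t - growth sg a1 t) - ep * ep * u / 6); [field|rewrite epp; field]. }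
  apply Rabs_le_between in K. lra. }
set (r := ep * (rho sg a1 ep t - growth sg a1 t)) in *.
assert (EE : ep * E <= Rabs E) by (destruct ep_sign as [-> | ->]; [pose proof (Rle_abs E)|pose proof (Rle_abs (- E)); rewrite Rabs_Ropp in *]; lra).
destruct HE as [HE1 HE2].
assert (F2 : (C3 + C) * sqrt h <= eta).
{ apply Rle_trans with ((C3 + C + 1) * (eta / (C3 + C + 1))); [apply Rmult_le_compat; lra|right; field; lra]. }
assert (F3 : (C + 1) * sqrt h <= c / 48).
{ apply Rle_trans with ((C + 1) * (c / (48 * (C + 1)))); [apply Rmult_le_compat_l; lra|right; field; lra]. }
assert (F4 : h * (B * B) <= 1).
{ apply Rle_trans with (/ (B * B) * (B * B)); [apply Rmult_le_compat_r; [apply Rmult_le_pos|]; lra|].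
  rewrite Rinv_l; [lra|]. apply Rmult_integral_contrapositive_currified; lra. }
assert (N3 : eta * (Rabs a1 + 1) = c / 48) by (unfold eta; field; lra).
clear m1 m2 m3 m0 sqm HT2 HT3 T10 T20 T30 Ht HR D h4 epp.
clearbody eta L r u E m.
destruct (Rle_or_lt B z) as [Z|Z].
- assert (N1 : eta * (u * B) <= eta * L).
  { apply Rmult_le_compat_l; [lra|]. eapply Rle_trans; [|apply HL].
    assert (1 <= z / 5 - Rabs a1 - 1) by (unfold B in Z; lra).
    assert (u * B <= u * z) by (apply Rmult_le_compat_l; lra).
    rewrite <- (Rmult_1_r (u * B)). apply Rmult_le_compat; try lra. apply Rmult_le_pos; lra. }
  assert (N2 : - (C3 * (u * sqrt h)) <= r * X).
  { destruct (Rle_or_lt 0 X) as [P|P].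
    - assert (0 <= r * X) by (apply Rmult_le_pos; lra).
      assert (0 <= C3 * (u * sqrt h)) by (apply Rmult_le_pos; [|apply Rmult_le_pos]; lra). lra.
    - assert (u / 3 * X <= r * X) by (clear -P R; nra).
      assert (H3 : h ^ 3 <= sqrt h).
      { assert (h ^ 3 <= h) by (clear -h0 h1; nra). assert (sqrt h <= 1) by (rewrite <- sqrt_1; apply sqrt_le_1_alt; lra).
        clear -sqq sq0 H0 H1; nra. }
      assert (X3 : - C3 * sqrt h <= X) by (clear -HX H3 C30; nra).
      assert (u * (- C3 * sqrt h) <= u * X) by (apply Rmult_le_compat_l; lra).
      assert (0 <= u * (C3 * sqrt h)) by (repeat apply Rmult_le_pos; lra). lra. }
  assert (u * ((C3 + C) * sqrt h) <= u * (eta * B)).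
  { apply Rmult_le_compat_l; [lra|]. assert (eta * 1 <= eta * B) by (apply Rmult_le_compat_l; lra). lra. }
  lra.
- specialize (Hc z ltac:(lra)).
  assert (XL : c * z / 2 <= X).
  { unfold X, profile. fold h. fold z.
    assert (G : / 2 <= gauge sg h z).
    { pose proof (gauge_lower h z ltac:(lra)).
      assert (h * z ^ 2 <= h * (B * B)) by (apply Rmult_le_compat_l; [lra|]; assert (0 <= z) by lra; clear -Z H0; nra).
      lra. }
    assert (0 <= c * z) by (apply Rmult_le_pos; lra).
    apply Rle_trans with (/ 2 * (c * z)); [lra|]. apply Rmult_le_compat; lra. }
  assert (N1 : - (eta * (Rabs a1 + 1)) * (u * z) <= eta * L).
  { apply Rle_trans with (eta * (u * z * (z / 5 - Rabs a1 - 1))); [|apply Rmult_le_compat_l; [lra|easy]].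
    assert (0 <= u * z) by (apply Rmult_le_pos; lra).
    assert (0 <= eta * (u * z * (z / 5))) by (apply Rmult_le_pos; [lra|apply Rmult_le_pos; lra]). lra. }
  assert (N2 : u / 12 * (c * z / 2) <= r * X).
  { apply Rmult_le_compat; try lra. apply Rmult_le_pos; [apply Rmult_le_pos|]; lra. }
  rewrite N3 in N1.
  assert (uz : 0 < u * z) by (apply Rmult_lt_0_compat; lra).
  assert (u * z * ((C + 1) * sqrt h) <= u * z * (c / 48)) by (apply Rmult_le_compat_l; lra).
  assert (0 <= u * z * sqrt h) by (apply Rmult_le_pos; lra).
  lra.
Qed.

End Barrier.

(** * Signs and boundary values of the barriers *)

Section BarrierSigns.

Variables (sg a1 ep : R).
Hypothesis sg_range : 0 <= sg <= 1.
Hypothesis ep_sign : ep = 1 \/ ep = -1.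
Variables (y y' : R -> R) (M : R).
Hypothesis y_a1 : y a1 = 0.
Hypothesis y_pos : forall x, a1 < x -> 0 < y x.
Hypothesis M_pos : 0 < M.
Hypothesis bound : forall z, 0 <= z ->
  Rabs (y (a1 + z)) <= M * exp (- z) /\ Rabs (y' (a1 + z)) <= M * exp (- z).
Hypothesis dy : forall x, is_derive y x (y' x).
Hypothesis lower : forall B, exists c, 0 < c /\ forall z, 0 <= z <= B -> c * z <= y (a1 + z).
Hypothesis ratio : exists C, 0 < C /\ forall z z', 0 <= z' <= z ->
    y (a1 + z') <= y (a1 + z) * exp (C * (z - z') * (1 + z)).

Let X := profile sg y a1.

Lemma lin_as_z t k : hh t * sqrt (hh t) * (hh t * k) = lin t k.
Proof. unfold lin. ring. Qed.

Lemma gauge_upper t k : 16 <= t -> 0 <= k -> hh t ^ 2 * (hh t * k) <= 3 -> gauge sg (hh t) (hh t * k) <= 4.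
Proof.
intros Ht Hk H. pose proof (hh_pos t) as h0. unfold gauge.
assert (0 <= hh t * (hh t * k) ^ 2 / 3).
{ apply Rmult_le_pos; [|lra]. apply Rmult_le_pos; [lra|]. apply pow2_ge_0. }
assert (0 <= beta sg <= 1) by (unfold beta; lra).
assert (beta sg * (hh t ^ 2 * (hh t * k)) <= 1 * 3).
{ apply Rmult_le_compat; try lra. apply Rmult_le_pos; [apply pow_le; lra|]. apply Rmult_le_pos; lra. }
lra.
Qed.

Lemma profile_nonneg_small t k : 16 <= t -> 0 <= k -> hh t * k <= 1 -> 0 <= X t k.
Proof.
intros Ht Hk H. pose proof (hh_pos t) as h0. pose proof (hh_le_half t Ht) as h1.
assert (0 <= hh t * k) by (apply Rmult_le_pos; lra).
apply Rmult_le_pos; [|now apply (airy_nonneg a1 y)].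
pose proof (gauge_lower sg sg_range (hh t) (hh t * k) ltac:(easy)).
assert ((hh t * k) ^ 2 <= 1) by (rewrite <- (pow1 2); apply pow_incr; lra).
assert (hh t * (hh t * k) ^ 2 <= hh t * 1) by (apply Rmult_le_compat_l; lra). lra.
Qed.

(** For z > 1 the linear term exceeds eta h^(3/2), which outweighs the negative part C h^3 of the
    profile. Positivity allows the counts to be divided by the weights on the initial band. *)
Lemma barrier_super_nonneg eta : 0 < eta -> ep = 1 -> exists T, 32 <= T /\ forall t k, T <= t -> 0 <= k ->
  0 <= barrier sg a1 ep y eta t k /\ (0 < k -> 0 < barrier sg a1 ep y eta t k).
Proof.
intros eta0 ->. destruct (profile_lower sg a1 sg_range y y' M y_a1 y_pos M_pos bound) as [C [C0 H]].
destruct (hh_small (eta / (C + 1))) as [T [T0 HT]]; [apply Rdiv_lt_0_compat; lra|].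
exists T. split; [easy|]. intros t k Ht Hk. specialize (HT t Ht). specialize (H t k Hk).
pose proof (hh_pos t) as h0. pose proof (hh_le_half t ltac:(lra)) as h1.
assert (sq0 : 0 < sqrt (hh t)) by now apply sqrt_lt_R0.
assert (L : 0 < k -> 0 < lin t k) by (intros; unfold lin; apply Rmult_lt_0_compat; [apply Rmult_lt_0_compat; [now apply pow_lt|]|]; easy).
assert (L0 : 0 <= lin t k) by (destruct Hk as [Hk| <-]; [left; now apply L|unfold lin; lra]).
unfold barrier. fold X in H |- *. rewrite Rmult_1_l.
destruct (Rle_or_lt (hh t * k) 1) as [Z|Z].
- pose proof (profile_nonneg_small t k ltac:(lra) Hk Z). split; [|intros K; specialize (L K)]; nra.
- enough (0 < X t k + eta * lin t k) by lra.
  rewrite <- lin_as_z. set (h := hh t) in *. set (z := h * k) in *.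
  assert (sqq : sqrt h * sqrt h = h) by (apply sqrt_sqrt; lra).
  assert (h <= sqrt h) by nra.
  assert (0 < h * sqrt h) by nra. assert (h * h <= h * sqrt h * z) by nra.
  assert ((C + 1) * h <= eta).
  { apply Rle_trans with ((C + 1) * (eta / (C + 1))); [apply Rmult_le_compat_l; lra|right; field; lra]. }
  assert (0 < h * h) by nra.
  assert (C * h ^ 3 < eta * (h * h)) by (replace (C * h ^ 3) with (C * h * (h * h)) by ring; apply Rmult_lt_compat_r; lra).
  assert (eta * (h * h) <= eta * (h * sqrt h * z)) by (apply Rmult_le_compat_l; lra).
  lra.
Qed.

Lemma profile_upper t k : Dom t k -> X t k <= 4 * M.
Proof.
intros D. destruct (Dom_z t k D) as [[h0 h1] [h2 h3]].
assert (z0 : 0 <= hh t * k) by lra.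
pose proof (gauge_upper t k ltac:(destruct D; lra) ltac:(destruct D; lra) h3).
unfold X, profile. pose proof (airy_nonneg a1 y y_a1 y_pos (hh t * k) z0).
destruct (bound (hh t * k) z0) as [B _]. pose proof (Rle_abs (y (a1 + hh t * k))).
assert (exp (- (hh t * k)) <= 1) by (rewrite <- exp_0; left; apply exp_increasing; lra).
assert (y (a1 + hh t * k) <= M) by nra. nra.
Qed.

Lemma rho_ge_19_10 : exists T, 32 <= T /\ forall t, T <= t -> 19 / 10 <= rho sg a1 ep t.
Proof.
destruct (phi_increment_small sg a1 ep ep_sign) as [C [C0 H]].
destruct (hh_small (/ (40 * (C + 1)))) as [T [T0 HT]]; [apply Rinv_0_lt_compat; lra|].
exists T. split; [easy|]. intros t Ht. specialize (H t ltac:(lra)). specialize (HT t Ht).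
pose proof (hh_pos t) as h0. pose proof (hh_le_half t ltac:(lra)) as h1.
unfold rho. set (P := phi sg a1 ep t - phi sg a1 ep (t - 1)) in *.
pose proof (exp_ineq1_le P). pose proof (Rle_abs (- P)). rewrite Rabs_Ropp in *.
assert (C * hh t <= / 40).
{ apply Rle_trans with ((C + 1) * / (40 * (C + 1))); [apply Rmult_le_compat; lra|right; field; lra]. }
assert (C * hh t ^ 2 <= / 40) by nra. lra.
Qed.

(** Up to a positive factor this is [weightD]. As wup/rho <= 6/10, the barrier only must not drop
    too fast between neighbours. While h z^2 <= 1/10 the ratio bound on [y] ensures this; beyond,
    the lower neighbour has y = O(h^2), less than the linear term. *)
Lemma barrier_super_D_pos eta : 0 < eta -> ep = 1 -> exists T, 32 <= T /\ forall t k, T <= t -> Dom t k ->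
  0 < barrier sg a1 ep y eta t k - wup t k / rho sg a1 ep t * barrier sg a1 ep y eta (t - 1) (k - 1).
Proof.
intros eta0 ep1.
destruct (barrier_super_nonneg eta eta0 ep1) as [T1 [T10 HT1]].
destruct rho_ge_19_10 as [T2 [T20 HT2]].
destruct (profile_lower sg a1 sg_range y y' M y_a1 y_pos M_pos bound) as [C3 [C30 HX]].
destruct (airy_pow_bound a1 y y' M M_pos bound 4) as [C4 [C40 H4]].
destruct ratio as [C [C0 HC]].
(* 240 = 6/10 * 4 * 100: the bound on wup/rho, the bound on the gauge and the constant in [V]. *)
set (A := 240 * C4 + C3).
assert (A0 : 0 <= A) by (unfold A; lra).
set (d := Rmin (eta / (4 * (A + 1))) (/ (100 * (C + 1)))).
assert (d0 : 0 < d) by (unfold d; apply Rmin_pos; [apply Rdiv_lt_0_compat|apply Rinv_0_lt_compat]; lra).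
assert (d1 : d <= eta / (4 * (A + 1))) by apply Rmin_l.
assert (d2 : d <= / (100 * (C + 1))) by apply Rmin_r.
destruct (hh_small (d * d) ltac:(nra)) as [T3 [T30 HT3]].
destruct (hh_small (/ 100)) as [T4 [T40 HT4]]; [lra|].
exists (T1 + T2 + T3 + T4). split; [lra|]. intros t k Ht D.
specialize (HT2 t ltac:(lra)). specialize (HT3 t ltac:(lra)). specialize (HT4 t ltac:(lra)).
destruct (HT1 (t - 1) (k - 1) ltac:(lra) ltac:(destruct D; lra)) as [P1 _].
destruct (Dom_z t k D) as [[h0 h1] [h2 h3]].
destruct (wup_bounds t k D) as [[W _] [W0 _]].
pose proof (lin_ratio_bounds 1 t ltac:(lra) ltac:(lra)) as LR.
pose proof (stepq_bounds 1 t ltac:(lra) ltac:(lra)) as SQ.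
specialize (HX t k ltac:(destruct D; lra)). fold X in HX.
set (h := hh t) in *.
assert (hh3 : h ^ 3 <= / 1000000) by (replace (/ 1000000) with ((/ 100) ^ 3) by field; apply pow_incr; lra).
assert (h30 : 0 < h ^ 3) by now apply pow_lt.
assert (a0 : 0 <= h ^ 2 * (h * k)) by (apply Rmult_le_pos; [apply pow_le|]; lra).
assert (WR : wup t k / rho sg a1 ep t <= 6 / 10).
{ apply Rmult_le_reg_r with (rho sg a1 ep t); [lra|]. unfold Rdiv at 1. rewrite Rmult_assoc, Rinv_l, Rmult_1_r by lra.
  apply Rle_trans with (6 / 10 * (19 / 10)); [lra|]. apply Rmult_le_compat_l; lra. }
assert (Q : 1 <= stepq 1 t <= 1 + h ^ 3 / 5).
{ replace (h ^ 6) with (h ^ 3 * h ^ 3) in SQ by ring. nra. }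
assert (zm : hh (t - 1) * (k - 1) = h * (stepq 1 t * (k - 1))) by (rewrite hh_step; fold h; ring).
assert (k1 : 1 <= k) by (destruct D; lra).
assert (hk : h ^ 3 * k <= 3) by (replace (h ^ 3 * k) with (h ^ 2 * (h * k)) by ring; easy).
assert (Zr : h * k - h <= hh (t - 1) * (k - 1) <= h * k).
{ rewrite zm. split; [nra|]. apply Rmult_le_compat_l; [lra|]. nra. }
assert (z0' : 0 <= hh (t - 1) * (k - 1)) by (rewrite zm; apply Rmult_le_pos; nra).
assert (L : lin (t - 1) (k - 1) <= 12 / 10 * lin t k).
{ pose proof (lin_step 1 t (-1) k) as E. replace (k + -1) with (k - 1) in E by ring. rewrite E.
  fold h in E |- *. fold h in LR.
  assert (sq0 : 0 < sqrt h) by now apply sqrt_lt_R0.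
  unfold lin. fold h.
  replace (12 / 10 * (h ^ 2 * sqrt h * k)) with (h ^ 2 * sqrt h * (12 / 10 * k)) by ring.
  apply Rmult_le_compat_l; [apply Rmult_le_pos; [apply pow_le|]; lra|].
  apply Rmult_le_compat; lra. }
assert (sq0 : 0 < sqrt h) by now apply sqrt_lt_R0.
assert (sqd : sqrt h <= d) by (apply sqrt_small; lra).
assert (sqq : sqrt h * sqrt h = h) by (apply sqrt_sqrt; lra).
assert (Lz : lin t k = h * sqrt h * (h * k)) by (rewrite <- lin_as_z; easy).
assert (Lpos : 0 < lin t k) by (rewrite Lz; repeat apply Rmult_lt_0_compat; lra).
(* Of the linear part 1 - 6/10 * 12/10 = 28/100 is left; the subtracted 1/1000 makes the conclusion
   strict. *)
enough (K : 6 / 10 * X (t - 1) (k - 1) <= X t k + 28 / 100 * (eta * lin t k) - / 1000 * (eta * lin t k)).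
{ unfold barrier in P1 |- *. fold X in P1 |- *. rewrite ep1 in WR, P1 |- *. rewrite !Rmult_1_l in P1 |- *.
  assert (wup t k / rho sg a1 1 t * (X (t - 1) (k - 1) + eta * lin (t - 1) (k - 1)) <= 6 / 10 * (X (t - 1) (k - 1) + eta * lin (t - 1) (k - 1)))
    by (apply Rmult_le_compat_r; lra).
  assert (eta * lin (t - 1) (k - 1) <= eta * (12 / 10 * lin t k)) by (apply Rmult_le_compat_l; lra).
  assert (0 < eta * lin t k) by now apply Rmult_lt_0_compat.
  lra. }
assert (el : 0 < eta * lin t k) by now apply Rmult_lt_0_compat.
unfold X at 1, profile. set (zp := hh (t - 1) * (k - 1)) in *. set (z := h * k) in *.
assert (Gm : gauge sg (hh (t - 1)) zp <= 1 + 2 * (h ^ 2 * z)).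
{ unfold gauge. assert (0 <= hh (t - 1) * zp ^ 2 / 3).
  { apply Rmult_le_pos; [|lra]. apply Rmult_le_pos; [left; apply hh_pos|apply pow2_ge_0]. }
  assert (B : 0 <= beta sg <= 1) by (unfold beta; lra).
  assert (hh (t - 1) ^ 2 <= 2 * h ^ 2).
  { rewrite hh_step. fold h. rewrite Rpow_mult_distr. rewrite (Rmult_comm 2). apply Rmult_le_compat_l; [apply pow_le; lra|]. nra. }
  assert (beta sg * (hh (t - 1) ^ 2 * zp) <= 1 * (2 * h ^ 2 * z)).
  { apply Rmult_le_compat; try lra; [apply Rmult_le_pos; [apply pow_le; left; apply hh_pos|easy]|].
    apply Rmult_le_compat; try lra. apply pow_le. left; apply hh_pos. }
  lra. }
pose proof (airy_nonneg a1 y y_a1 y_pos zp z0') as Fp.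
pose proof (airy_nonneg a1 y y_a1 y_pos z ltac:(lra)) as F.
destruct (Rle_or_lt (h * z ^ 2) (/ 10)) as [S|S].
- assert (hz : h * z <= sqrt h).
  { assert (z ^ 2 = z * z) by ring. assert ((h * z) * (h * z) <= h) by (replace ((h*z)*(h*z)) with (h * (h * z ^ 2)) by ring; clear -h0 S; nra).
    rewrite <- (sqrt_square (h * z)) by nra. now apply sqrt_le_1_alt. }
  assert (R : y (a1 + zp) <= 11 / 10 * y (a1 + z)).
  { eapply Rle_trans; [apply (HC z zp); lra|]. rewrite Rmult_comm. apply Rmult_le_compat_r; [easy|].
    assert (U : C * (z - zp) * (1 + z) <= / 20).
    { apply Rle_trans with (C * (h * (1 + z))).
      - rewrite Rmult_assoc. apply Rmult_le_compat_l; [lra|]. apply Rmult_le_compat_r; lra.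
      - assert (h * (1 + z) <= 2 * d) by (assert (h <= sqrt h) by (clear -sqq sq0 HT4; nra); lra).
        apply Rle_trans with ((C + 1) * (2 * / (100 * (C + 1))));
          [|replace ((C + 1) * (2 * / (100 * (C + 1)))) with (/ 50) by (field; lra); lra].
        apply Rmult_le_compat; try lra. apply Rmult_le_pos; lra. }
    set (x := C * (z - zp) * (1 + z)) in *.
    assert (E : exp x * exp (- x) = 1) by (rewrite <- exp_plus, Rplus_opp_r; apply exp_0).
    pose proof (exp_ineq1_le (- x)). pose proof (exp_pos x).
    assert (exp x * (19 / 20) <= 1) by (rewrite <- E; apply Rmult_le_compat_l; lra). lra. }
  assert (G : 9 / 10 <= gauge sg h z).
  { pose proof (gauge_lower sg sg_range h z ltac:(lra)). lra. }
  assert (Xl : 9 / 10 * y (a1 + z) <= X t k) by (unfold X, profile; apply Rmult_le_compat_r; easy).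
  assert (G2 : gauge sg (hh (t - 1)) zp <= 11 / 10).
  { assert (sqrt h <= / 10) by (apply sqrt_small; lra). assert (h ^ 2 * z <= h * sqrt h) by (replace (h ^ 2 * z) with (h * (h * z)) by ring; apply Rmult_le_compat_l; lra).
    assert (h * sqrt h <= / 100 * / 10) by (apply Rmult_le_compat; lra). lra. }
  assert (gauge sg (hh (t - 1)) zp * y (a1 + zp) <= 11 / 10 * (11 / 10 * y (a1 + z))).
  { apply Rle_trans with (11 / 10 * y (a1 + zp)); [apply Rmult_le_compat_r; easy|apply Rmult_le_compat_l; lra]. }
  lra.
- assert (Z1 : 1 <= z ^ 2) by (clear -h0 S HT4; nra). assert (Z2 : 1 <= z) by (assert (0 <= z) by lra; clear -Z1 H; nra).
  specialize (H4 zp z0').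
  assert (E1 : exp (- zp / 2) <= 1).
  { rewrite <- exp_0. destruct z0' as [q|q]; [left; apply exp_increasing; lra|right; f_equal; rewrite <- q; field]. }
  assert (U : z ^ 4 * y (a1 + zp) <= C4).
  { apply Rle_trans with ((1 + zp) ^ 4 * y (a1 + zp)); [|eapply Rle_trans; [apply H4|]; rewrite <- (Rmult_1_r C4) at 2; apply Rmult_le_compat_l; lra].
    apply Rmult_le_compat_r; [easy|]. apply pow_incr. lra. }
  assert (V : y (a1 + zp) <= 100 * C4 * h ^ 2).
  { assert (/ 100 <= h ^ 2 * z ^ 4) by (replace (h ^ 2 * z ^ 4) with ((h * z ^ 2) * (h * z ^ 2)) by ring; clear -S; nra).
    assert (h ^ 2 * (z ^ 4 * y (a1 + zp)) <= h ^ 2 * C4) by (apply Rmult_le_compat_l; [apply pow_le; lra|easy]).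
    assert (/ 100 * y (a1 + zp) <= h ^ 2 * z ^ 4 * y (a1 + zp)) by (apply Rmult_le_compat_r; easy). lra. }
  assert (G4 : gauge sg (hh (t - 1)) zp <= 4).
  { pose proof (gauge_upper (t - 1) (k - 1)) as G. fold zp in G. apply G; try lra.
    apply Rle_trans with (hh (t - 1) ^ 3 * (k - 1)); [right; unfold zp; ring|].
    rewrite hh_cube by lra. destruct D as [D1 D2]. 
    apply Rmult_le_reg_r with (t - 1); [lra|]. replace (2 / (t - 1) * (k - 1) * (t - 1)) with (2 * (k - 1)) by (field; lra). lra. }
  assert (gauge sg (hh (t - 1)) zp * y (a1 + zp) <= 4 * (100 * C4 * h ^ 2)).
  { apply Rle_trans with (4 * y (a1 + zp)); [apply Rmult_le_compat_r; easy|apply Rmult_le_compat_l; lra]. }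
  assert (A * h ^ 2 <= 25 / 100 * (eta * lin t k)).
  { rewrite Lz. replace (A * h ^ 2) with (A * sqrt h * (h * sqrt h)) by (replace (h ^ 2) with (h * (sqrt h * sqrt h)) by (rewrite sqq; ring); ring).
    assert (A * sqrt h <= eta / 4).
    { apply Rle_trans with ((A + 1) * (eta / (4 * (A + 1)))); [apply Rmult_le_compat; lra|right; field; lra]. }
    assert (P : 0 < h * sqrt h) by now apply Rmult_lt_0_compat.
    assert (h * sqrt h <= h * sqrt h * z) by (clear -P Z2; nra).
    apply Rle_trans with (eta / 4 * (h * sqrt h)); [apply Rmult_le_compat_r; lra|].
    apply Rle_trans with (eta / 4 * (h * sqrt h * z)); [apply Rmult_le_compat_l; lra|]. lra. }
  assert (C3 * h ^ 3 <= C3 * h ^ 2) by (apply Rmult_le_compat_l; [easy|]; clear -h0 HT4; nra).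
  unfold A in *. lra.
Qed.

Lemma lin_edge_large t : 32 <= t -> / sqrt (hh t) <= lin t (t + 1).
Proof.
intros Ht. pose proof (hh_pos t) as h0. pose proof (hh_cube_mul t ltac:(lra)) as T.
set (h := hh t) in *. assert (sq0 : 0 < sqrt h) by now apply sqrt_lt_R0.
assert (sqq : sqrt h * sqrt h = h) by (apply sqrt_sqrt; lra).
unfold lin. fold h. apply Rmult_le_reg_r with (sqrt h); [easy|]. rewrite Rinv_l by lra.
replace (h ^ 2 * sqrt h * (t + 1) * sqrt h) with (h ^ 2 * (sqrt h * sqrt h) * (t + 1)) by ring.
rewrite sqq. assert (0 < h ^ 3) by now apply pow_lt. nra.
Qed.

(** At m = 0 the count [uD] is 0, so [weightD] must have the sign of [ep]. For the subsolution the
    linear term, at least h^(-1/2) at k = t + 1 by [lin_edge_large], outweighs the bounded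
    profile. *)
Lemma barrier_edge eta : 0 < eta -> exists T, 32 <= T /\ forall t, T <= t ->
  0 <= ep * (barrier sg a1 ep y eta t (t + 1) - wup t (t + 1) / rho sg a1 ep t * barrier sg a1 ep y eta (t - 1) (t + 1 - 1)).
Proof.
intros eta0.
destruct ep_sign as [ep1|ep1].
{ destruct (barrier_super_D_pos eta eta0 ep1) as [T [T0 HT]]. exists T. split; [easy|].
  intros t Ht. assert (D : Dom t (t + 1)) by (split; lra). specialize (HT t (t + 1) Ht D). 
  rewrite ep1 in *. lra. }
destruct rho_ge_19_10 as [T2 [T20 HT2]].
destruct (profile_lower sg a1 sg_range y y' M y_a1 y_pos M_pos bound) as [C3 [C30 HX]].
set (d := eta / (16 * M + 4 * C3 + 1)).
assert (d0 : 0 < d) by (unfold d; apply Rdiv_lt_0_compat; lra).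
destruct (hh_small (d * d) ltac:(nra)) as [T3 [T30 HT3]].
exists (T2 + T3). split; [lra|]. intros t Ht.
assert (D : Dom t (t + 1)) by (split; lra).
specialize (HT2 t ltac:(lra)). specialize (HT3 t ltac:(lra)).
pose proof (profile_upper t (t + 1) D) as U. specialize (HX (t - 1) (t + 1 - 1) ltac:(lra)). fold X in HX.
pose proof (lin_edge_large t ltac:(lra)) as L. pose proof (lin_ratio_bounds 1 t ltac:(lra) ltac:(lra)) as LR.
pose proof (hh_pos t) as h0. pose proof (hh_le_half t ltac:(lra)) as h1.
pose proof (hh_pos (t - 1)) as h0'. pose proof (hh_le_half (t - 1) ltac:(lra)) as h1'.
assert (sq0 : 0 < sqrt (hh t)) by now apply sqrt_lt_R0.
assert (sqd : sqrt (hh t) <= d) by (apply sqrt_small; lra).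
assert (L1 : lin (t - 1) (t + 1 - 1) <= 4 * lin t (t + 1)).
{ pose proof (lin_step 1 t (-1) (t + 1)) as E. replace (t + 1 + -1) with (t + 1 - 1) in E by ring. rewrite E.
  unfold lin. replace (4 * (hh t ^ 2 * sqrt (hh t) * (t + 1))) with (hh t ^ 2 * sqrt (hh t) * (4 * (t + 1))) by ring.
  apply Rmult_le_compat_l; [apply Rmult_le_pos; [apply pow_le|]; lra|].
  assert (hh t ^ 3 <= / 8) by (replace (/8) with ((/2) ^ 3) by field; apply pow_incr; lra).
  apply Rmult_le_compat; lra. }
assert (Big : 16 * M + 4 * C3 + 1 <= eta * lin t (t + 1)).
{ apply Rle_trans with (eta * / sqrt (hh t)); [|apply Rmult_le_compat_l; lra].
  apply Rmult_le_reg_r with (sqrt (hh t)); [easy|]. rewrite Rmult_assoc, Rinv_l, Rmult_1_r by lra.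
  apply Rle_trans with ((16 * M + 4 * C3 + 1) * d); [apply Rmult_le_compat_l; lra|].
  right. unfold d. field. lra. }
assert (W : 0 <= wup t (t + 1) / rho sg a1 ep t <= / 16).
{ unfold wup. replace ((t - (t + 1) + 3) / (t + (t + 1) - 1)) with (/ t) by (field; lra).
  assert (0 < / t <= / 32) by (split; [apply Rinv_0_lt_compat|apply Rinv_le_contravar]; lra).
  assert (0 < / rho sg a1 ep t <= 1) by (apply Rinv_unit_interval; lra).
  unfold Rdiv. split; nra. }
pose proof (pow_incr (hh (t - 1)) 1 3 ltac:(lra)) as h3. rewrite pow1 in h3.
assert (B : barrier sg a1 ep y eta (t - 1) (t + 1 - 1) >= - C3 - 4 * (eta * lin t (t + 1))).
{ unfold barrier. fold X. rewrite ep1.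
  assert (eta * lin (t - 1) (t + 1 - 1) <= eta * (4 * lin t (t + 1))) by (apply Rmult_le_compat_l; lra).
  nra. }
set (w := wup t (t + 1) / rho sg a1 ep t) in *.
set (b := barrier sg a1 ep y eta (t - 1) (t + 1 - 1)) in *.
unfold barrier. fold X. rewrite ep1.
assert (w * b >= - (/ 16) * (C3 + 4 * (eta * lin t (t + 1)))) by nra.
lra.
Qed.

(** At k = 1 the height is z = h: the simple zero of [y] gives order h, while the linear term is
    only h^(5/2). *)
Lemma barrier_at_one eta : 0 < eta -> exists T c C, 32 <= T /\ 0 < c /\ 0 < C /\ forall t, T <= t ->
  c * hh t <= barrier sg a1 ep y eta t 1 <= C * hh t.
Proof.
intros eta0. destruct (lower 1) as [c [c0 Hc]].
destruct (hh_small (c / (4 * eta + 4 * c))) as [T [T0 HT]]; [apply Rdiv_lt_0_compat; lra|].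
exists T, (c / 4), (4 * M + eta). split; [easy|]. split; [lra|]. split; [lra|].
intros t Ht. specialize (HT t Ht).
pose proof (hh_pos t) as h0. pose proof (hh_le_half t ltac:(lra)) as h1.
unfold barrier, profile. rewrite Rmult_1_r. set (h := hh t) in *.
specialize (Hc h ltac:(lra)).
assert (sq0 : 0 < sqrt h) by now apply sqrt_lt_R0.
assert (sq1 : sqrt h <= 1) by (rewrite <- sqrt_1; apply sqrt_le_1_alt; lra).
assert (L : 0 <= lin t 1 <= h * h).
{ unfold lin. fold h. split; nra. }
assert (LE : eta * (h * h) <= c / 4 * h).
{ assert (eta * h <= c / 4); [|nra].
  apply Rle_trans with ((eta + c) * (c / (4 * eta + 4 * c))); [apply Rmult_le_compat; lra|right; field; lra]. }
assert (EL : - (c / 4 * h) <= ep * eta * lin t 1 <= eta * h).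
{ assert (0 <= eta * lin t 1 <= eta * (h * h)) by (split; [apply Rmult_le_pos|apply Rmult_le_compat_l]; lra).
  assert (eta * (h * h) <= eta * h) by (apply Rmult_le_compat_l; nra).
  destruct ep_sign as [-> | ->]; lra. }
assert (Y : y (a1 + h) <= M * h).
{ destruct (mean_value y y' a1 (a1 + h)) as [x [Hx E]]; [lra|intros; apply dy|].
  rewrite y_a1, Rminus_0_r in E. rewrite E. replace (a1 + h - a1) with h by ring.
  apply Rmult_le_compat_r; [lra|]. destruct (bound (x - a1)) as [_ B]; [lra|].
  replace (a1 + (x - a1)) with x in B by ring. pose proof (Rle_abs (y' x)).
  assert (exp (- (x - a1)) <= 1) by (rewrite <- exp_0; destruct (Req_dec x a1) as [-> |];
    [rewrite Rminus_diag, Ropp_0; lra|left; apply exp_increasing; lra]).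
  nra. }
assert (G1 : / 2 <= gauge sg h h).
{ pose proof (gauge_lower sg sg_range h h ltac:(lra)). nra. }
assert (G2 : gauge sg h h <= 4).
{ pose proof (gauge_upper t 1) as G. rewrite !Rmult_1_r in G. apply G; try lra. fold h. nra. }
assert (0 <= c * h) by nra.
split.
- assert (/ 2 * (c * h) <= gauge sg h h * y (a1 + h)) by (apply Rmult_le_compat; lra). lra.
- assert (gauge sg h h * y (a1 + h) <= 4 * (M * h)) by (apply Rmult_le_compat; lra). lra.
Qed.

End BarrierSigns.

(** * Comparison and asymptotics *)

(** A discrete maximum principle. The system looks back by at most three in [n + m], whence an
    initial band of three values; the entries [a n (S n)] form the boundary k = 0. *)
Lemma positive_system_nonneg (sg : R) (a aD : nat -> nat -> R) (I : nat) :
  0 <= sg <= 1 -> (2 <= I)%nat ->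
  (forall n m, (m <= n)%nat -> (I + 3 <= n + m)%nat ->
     (INR m + 1) * a (n - 1)%nat m + aD n m <= a n m) ->
  (forall n m, (1 <= m <= n)%nat -> (I + 3 <= n + m)%nat ->
     aD n (m - 1)%nat + INR m * aD (n - 1)%nat (m - 1)%nat
     + (INR m ^ 2 - sg * (INR m - 1)) * a (n - 2)%nat (m - 1)%nat <= aD n m) ->
  (forall n, (I <= n)%nat -> 0 <= aD n 0%nat) ->
  (forall n, 0 <= a n (S n)) ->
  (forall n m, (m <= n)%nat -> (I <= n + m <= I + 2)%nat -> 0 <= a n m /\ 0 <= aD n m) ->
  forall n m, (m <= n)%nat -> (I <= n + m)%nat -> 0 <= a n m /\ 0 <= aD n m.
Proof.
intros Hsg HI H1 H2 H0 HE Hinit.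
assert (K : forall i n m, (n + m <= i)%nat -> (m <= n)%nat -> (I <= n + m)%nat -> 0 <= a n m /\ 0 <= aD n m).
2:{ intros n m. apply (K (n + m)%nat); lia. }
induction i as [|i IH]; intros n m Hi Hm HIi; [lia|].
destruct (le_lt_dec (n + m) (I + 2)) as [L|L]; [apply Hinit; lia|].
assert (N : forall m', (m' <= n)%nat -> (n + m' <= S i)%nat -> (I + 1 <= n + m')%nat -> 0 <= a (n - 1)%nat m').
{ intros m' ? ? ?. destruct (Nat.eq_dec m' n) as [-> |].
  - replace n with (S (n - 1)) at 2 by lia. apply HE.
  - apply IH; lia. }
assert (DD : 0 <= aD n m).
{ destruct m as [|m']; [apply H0; lia|].
  eapply Rle_trans; [|apply H2; lia]. replace (S m' - 1)%nat with m' by lia.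
  destruct (IH n m') as [_ A1]; [lia..|]. destruct (IH (n - 1)%nat m') as [_ A2]; [lia..|].
  assert (A3 : 0 <= a (n - 2)%nat m').
  { destruct (Nat.eq_dec (S m') n) as [E|E].
    - subst n. replace m' with (S (S m' - 2)) at 2 by lia. apply HE.
    - apply IH; lia. }
  assert (1 <= INR (S m')) by (apply (le_INR 1); lia).
  assert (0 <= INR (S m') ^ 2 - sg * (INR (S m') - 1)) by nra.
  assert (0 <= INR (S m') * aD (n - 1)%nat m') by (apply Rmult_le_pos; lra).
  assert (0 <= (INR (S m') ^ 2 - sg * (INR (S m') - 1)) * a (n - 2)%nat m') by (apply Rmult_le_pos; lra).
  lra. }
split; [|easy]. eapply Rle_trans; [|apply H1; lia].
pose proof (pos_INR m). specialize (N m ltac:(lia) ltac:(lia) ltac:(lia)).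
assert (0 <= (INR m + 1) * a (n - 1)%nat m) by (apply Rmult_le_pos; lra). lra.
Qed.

Lemma finite_upper_bound (r : nat -> nat -> R) (N : nat) :
  exists K, 0 < K /\ forall n m, (n <= N)%nat -> (m <= N)%nat -> r n m <= K.
Proof.
assert (F : forall (f : nat -> R) N, exists K, 0 < K /\ forall n, (n <= N)%nat -> f n <= K).
{ intros f M. induction M as [|M [K [K0 H]]].
  - exists (Rabs (f 0%nat) + 1). pose proof (Rle_abs (f 0%nat)). pose proof (Rabs_pos (f 0%nat)).
    split; [lra|]. intros n Hn. replace n with 0%nat by lia. lra.
  - exists (K + Rabs (f (S M))). pose proof (Rle_abs (f (S M))). pose proof (Rabs_pos (f (S M))).
    split; [lra|]. intros n Hn. destruct (Nat.eq_dec n (S M)) as [-> |]; [lra|].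
    specialize (H n ltac:(lia)). lra. }
assert (G : forall M, exists K, 0 < K /\ forall n m, (n <= M)%nat -> (m <= N)%nat -> r n m <= K).
{ induction M as [|M [K [K0 H]]].
  - destruct (F (r 0%nat) N) as [K [K0 H]]. exists K. split; [easy|]. intros n m Hn Hm.
    replace n with 0%nat by lia. auto.
  - destruct (F (r (S M)) N) as [K' [K0' H']]. exists (K + K'). split; [lra|]. intros n m Hn Hm.
    destruct (Nat.eq_dec n (S M)) as [-> |]; [specialize (H' m Hm)|specialize (H n m ltac:(lia) Hm)]; lra. }
apply G.
Qed.

(* [uD] counts the prefixes whose last letter is an internal node. *)
Record cherry_recurrence (sg : R) (u uD : nat -> nat -> R) : Prop := {
  rec_outside : forall n m, (n < m)%nat -> u n m = 0;
  rec_origin : u 0%nat 0%nat = 1;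
  rec_step : forall n m, (1 <= n)%nat -> (m <= n)%nat ->
    u n m = (INR m + 1) * u (n - 1)%nat m + uD n m;
  rec_D_bottom : forall n, (1 <= n)%nat -> uD n 0%nat = 0;
  rec_D : forall n m, (2 <= n)%nat -> (1 <= m <= n)%nat ->
    uD n m = u n (m - 1)%nat - sg * (INR m - 1) * u (n - 2)%nat (m - 1)%nat;
  rec_nonneg : forall n m, 0 <= u n m /\ 0 <= uD n m }.

Section Counting.

Variables (sg : R) (u uD : nat -> nat -> R).
Hypothesis sg_range : 0 <= sg <= 1.
Hypothesis Hu : cherry_recurrence sg u uD.

(* Eliminating [u] from [rec_D] leaves only nonnegative coefficients. *)
Lemma rec_D_positive n m : (2 <= n)%nat -> (1 <= m <= n)%nat ->
  uD n m = uD n (m - 1)%nat + INR m * uD (n - 1)%nat (m - 1)%nat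
    + (INR m ^ 2 - sg * (INR m - 1)) * u (n - 2)%nat (m - 1)%nat.
Proof.
intros Hn Hm. rewrite (rec_D _ _ _ Hu) by lia.
rewrite (rec_step _ _ _ Hu n (m - 1)) by lia.
rewrite (rec_step _ _ _ Hu (n - 1) (m - 1)) by lia.
replace (n - 1 - 1)%nat with (n - 2)%nat by lia. rewrite minus_INR by lia. simpl (INR 1). ring.
Qed.

Lemma rec_bottom n : u n 0%nat = 1.
Proof.
induction n as [|n IH]; [apply (rec_origin _ _ _ Hu)|].
rewrite (rec_step _ _ _ Hu), (rec_D_bottom _ _ _ Hu) by lia. simpl (S n - 1)%nat.
rewrite Nat.sub_0_r, IH. simpl. ring.
Qed.

(** Strict positivity lets a multiple of the subsolution be placed below the counts on the initial
    band. *)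
Lemma rec_D_pos n m : (2 <= n)%nat -> (1 <= m <= n)%nat -> 0 < uD n m.
Proof.
intros Hn. induction m as [|m IH]; intros Hm; [lia|].
destruct (Nat.eq_dec m 0) as [-> |].
- rewrite (rec_D _ _ _ Hu) by lia. simpl (1 - 1)%nat. rewrite rec_bottom. simpl (INR 1). lra.
- rewrite rec_D_positive by lia. replace (S m - 1)%nat with m by lia.
  specialize (IH ltac:(lia)). destruct (rec_nonneg _ _ _ Hu (n - 1) m) as [_ A].
  destruct (rec_nonneg _ _ _ Hu (n - 2) m) as [B _].
  assert (1 <= INR (S m)) by (apply (le_INR 1); lia).
  assert (0 <= INR (S m) ^ 2 - sg * (INR (S m) - 1)) by nra.
  assert (0 <= INR (S m) * uD (n - 1)%nat m) by (apply Rmult_le_pos; lra).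
  assert (0 <= (INR (S m) ^ 2 - sg * (INR (S m) - 1)) * u (n - 2)%nat m) by (apply Rmult_le_pos; lra).
  lra.
Qed.

Lemma rec_pos n m : (2 <= n)%nat -> (m <= n)%nat -> 0 < u n m.
Proof.
intros Hn Hm. destruct m as [|m]; [rewrite rec_bottom; lra|].
rewrite (rec_step _ _ _ Hu) by lia. pose proof (rec_D_pos n (S m) Hn ltac:(lia)).
destruct (rec_nonneg _ _ _ Hu (n - 1) (S m)) as [A _]. pose proof (pos_INR (S m)).
assert (0 <= (INR (S m) + 1) * u (n - 1)%nat (S m)) by (apply Rmult_le_pos; lra). lra.
Qed.

(** * Comparison weights built from a barrier *)

Variables (a1 ep : R) (b : R -> R -> R).
Hypothesis b_zero : forall t, b t 0 = 0.

Definition scale (i : nat) : R := 2 ^ i * exp (phi sg a1 ep (INR i)).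
Definition height (n m : nat) : R := INR n - INR m + 1.
Definition weight (n m : nat) : R := INR (fact n) * scale (n + m) * b (INR (n + m)) (height n m).
(** Mirrors [rec_step], so that the differences with the counts satisfy the first relation of the
    system with equality. *)
Definition weightD (n m : nat) : R := weight n m - (INR m + 1) * weight (n - 1) m.

Lemma scale_pos i : 0 < scale i.
Proof. apply Rmult_lt_0_compat; [apply pow_lt; lra|apply exp_pos]. Qed.

Lemma scale_step i : scale (S i) = rho sg a1 ep (INR (S i)) * scale i.
Proof.
unfold scale, rho. replace (INR (S i) - 1) with (INR i) by (rewrite S_INR; ring).
replace (phi sg a1 ep (INR (S i))) with (phi sg a1 ep (INR (S i)) - phi sg a1 ep (INR i) + phi sg a1 ep (INR i)) at 1 by ring.
rewrite exp_plus. simpl. ring.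
Qed.

Lemma weight_outside n : weight n (S n) = 0.
Proof.
unfold weight, height. rewrite S_INR. replace (INR n - (INR n + 1) + 1) with 0 by ring.
rewrite b_zero. ring.
Qed.

Lemma fact_pred n : (1 <= n)%nat -> INR (fact n) = INR n * INR (fact (n - 1)).
Proof.
intros Hn. destruct n; [lia|]. replace (S n - 1)%nat with n by lia. rewrite <- mult_INR. easy.
Qed.

Lemma weightD_eq n m : (1 <= n)%nat -> (m <= n)%nat ->
  weightD n m = INR (fact n) * scale (n + m) *
    (b (INR (n + m)) (height n m)
     - wup (INR (n + m)) (height n m) / rho sg a1 ep (INR (n + m)) * b (INR (n + m) - 1) (height n m - 1)).
Proof.
intros Hn Hm. unfold weightD, weight.
replace (n - 1 + m)%nat with (n + m - 1)%nat by lia.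
assert (E : scale (n + m) = rho sg a1 ep (INR (n + m)) * scale (n + m - 1)).
{ replace (n + m)%nat with (S (n + m - 1)) at 1 2 by lia. apply scale_step. }
rewrite E, (fact_pred n Hn).
replace (INR (n + m - 1)) with (INR (n + m) - 1) by (rewrite (minus_INR (n + m)) by lia; simpl; ring).
replace (height (n - 1) m) with (height n m - 1) by (unfold height; rewrite (minus_INR n) by lia; simpl; ring).
assert (W : INR n * wup (INR (n + m)) (height n m) = INR m + 1).
{ unfold wup, height. rewrite plus_INR. assert (1 <= INR n) by now apply (le_INR 1). field. lra. }
rewrite <- W. pose proof (rho_pos sg a1 ep (INR (n + m))). field. lra.
Qed.

(** The defect of the weight in the recurrence is a positive multiple of the defect of the barrier,
    hence inherits its sign. *)
Lemma weight_step n m : (2 <= n)%nat -> (1 <= m <= n)%nat ->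
  weight n m - (INR m + 1) * weight (n - 1) m - weight n (m - 1) + sg * (INR m - 1) * weight (n - 2) (m - 1) =
  INR (fact n) * scale (n + m - 1) *
    (rho sg a1 ep (INR (n + m)) * b (INR (n + m)) (height n m) - stepop sg a1 ep b (INR (n + m)) (height n m)).
Proof.
intros Hn Hm. unfold weight, stepop.
replace (n - 1 + m)%nat with (n + m - 1)%nat by lia.
replace (n + (m - 1))%nat with (n + m - 1)%nat by lia.
replace (n - 2 + (m - 1))%nat with (n + m - 3)%nat by lia.
set (i := (n + m)%nat).
assert (E1 : scale i = rho sg a1 ep (INR i) * scale (i - 1)).
{ replace i with (S (i - 1)) at 1 2 by lia. apply scale_step. }
assert (E2 : scale (i - 1) = rho sg a1 ep (INR i - 1) * rho sg a1 ep (INR i - 2) * scale (i - 3)).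
{ replace (INR i - 1) with (INR (S (S (i - 3)))) by (replace (S (S (i - 3))) with (i - 1)%nat by lia; rewrite minus_INR by lia; simpl; ring).
  replace (INR i - 2) with (INR (S (i - 3))) by (replace (S (i - 3)) with (i - 2)%nat by lia; rewrite minus_INR by lia; simpl; ring).
  replace (i - 1)%nat with (S (S (i - 3))) by lia. rewrite !scale_step. ring. }
rewrite E1. 
replace (INR (i - 1)) with (INR i - 1) by (rewrite (minus_INR i) by lia; simpl; ring).
replace (INR (i - 3)) with (INR i - 3) by (rewrite (minus_INR i) by lia; simpl; ring).
replace (height (n - 1) m) with (height n m - 1) by (unfold height; rewrite (minus_INR n) by lia; simpl; ring).
replace (height n (m - 1)) with (height n m + 1) by (unfold height; rewrite (minus_INR m) by lia; simpl; ring).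
replace (height (n - 2) (m - 1)) with (height n m - 1) by (unfold height; rewrite (minus_INR n), (minus_INR m) by lia; simpl; ring).
assert (n2 : 2 <= INR n) by (apply (le_INR 2); lia).
assert (F1 : INR (fact n) = INR n * INR (fact (n - 1))) by (apply fact_pred; lia).
assert (F2 : INR (fact (n - 1)) = (INR n - 1) * INR (fact (n - 2))).
{ rewrite (fact_pred (n - 1)) by lia. replace (n - 1 - 1)%nat with (n - 2)%nat by lia. rewrite (minus_INR n) by lia. easy. }
assert (W : wup (INR i) (height n m) = (INR m + 1) / INR n).
{ unfold wup, height, i. rewrite plus_INR. field. lra. }
assert (V : vweight sg a1 ep (INR i) (height n m) =
  (INR m - 1) / (INR n * (INR n - 1)) * / rho sg a1 ep (INR i - 1) * / rho sg a1 ep (INR i - 2)).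
{ unfold vweight, vcherry, height, i. rewrite plus_INR.
  pose proof (rho_pos sg a1 ep (INR n + INR m - 1)). pose proof (rho_pos sg a1 ep (INR n + INR m - 2)).
  field. repeat split; lra. }
rewrite W, V.
pose proof (rho_pos sg a1 ep (INR i - 1)). pose proof (rho_pos sg a1 ep (INR i - 2)).
rewrite E2, F1, F2. field. repeat split; lra.
Qed.

(** The factor [ep] on all differences lets one argument serve the upper and the lower bound. *)
Lemma comparison (K : R) (I : nat) :
  (ep = 1 \/ ep = -1) -> 0 <= K -> (4 <= I)%nat ->
  (forall n m, (1 <= m <= n)%nat -> (I + 3 <= n + m)%nat ->
     0 <= ep * (rho sg a1 ep (INR (n + m)) * b (INR (n + m)) (height n m)
                - stepop sg a1 ep b (INR (n + m)) (height n m))) ->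
  (forall n, (I <= n)%nat -> 0 <= ep * weightD n 0) ->
  (forall n m, (m <= n)%nat -> (I <= n + m <= I + 2)%nat ->
     0 <= ep * (K * weight n m - u n m) /\ 0 <= ep * (K * weightD n m - uD n m)) ->
  forall n m, (m <= n)%nat -> (I <= n + m)%nat -> 0 <= ep * (K * weight n m - u n m).
Proof.
intros Hep K0 HI HB HW Hinit n m Hm Hi.
destruct (positive_system_nonneg sg (fun n m => ep * (K * weight n m - u n m)) (fun n m => ep * (K * weightD n m - uD n m)) I) with (n := n) (m := m); try easy; [lia|..].
- clear n m Hm Hi. intros n m Hm Hi. rewrite (rec_step _ _ _ Hu n m) by lia. unfold weightD. right. ring.
- clear n m Hm Hi. intros n m Hm Hi. rewrite (rec_D_positive n m) by lia.
  assert (W := weight_step n m ltac:(lia) Hm). specialize (HB n m Hm Hi).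
  set (B := rho sg a1 ep (INR (n + m)) * b (INR (n + m)) (height n m) - stepop sg a1 ep b (INR (n + m)) (height n m)) in *.
  assert (P : 0 <= INR (fact n) * scale (n + m - 1)).
  { apply Rmult_le_pos; [apply pos_INR|left; apply scale_pos]. }
  unfold weightD. replace (n - 1 - 1)%nat with (n - 2)%nat by lia. rewrite (minus_INR m) by lia. simpl (INR 1).
  assert (0 <= K * (INR (fact n) * scale (n + m - 1) * (ep * B))) by (apply Rmult_le_pos; [easy|apply Rmult_le_pos; easy]).
  replace (K * (INR (fact n) * scale (n + m - 1) * (ep * B))) with (ep * K * (INR (fact n) * scale (n + m - 1) * B)) in H by ring.
  rewrite <- W in H. lra.
- clear n m Hm Hi. intros n Hn. rewrite (rec_D_bottom _ _ _ Hu) by lia.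
  specialize (HW n Hn). replace (ep * (K * weightD n 0 - 0)) with (K * (ep * weightD n 0)) by ring.
  now apply Rmult_le_pos.
- clear n m Hm Hi. intros n. rewrite weight_outside, (rec_outside _ _ _ Hu) by lia. right. ring.
Qed.

End Counting.

(** At t = 2 n one has h = n^(-1/3): the logarithmic term of [phi] becomes n^kappa, and the factor h
    lowers the exponent by 1/3. *)
Lemma scale_diagonal sg a1 ep n : (1 <= n)%nat ->
  scale sg a1 ep (n + n) * hh (INR (n + n)) =
  4 ^ n * exp (3 * a1 * Rpower (INR n) (1/3)) * Rpower (INR n) (kappa sg - 1/3)
   * exp (- (ep * sqrt (hh (INR (n + n))))).
Proof.
intros Hn. assert (n1 : 1 <= INR n) by now apply (le_INR 1).
assert (H : hh (INR (n + n)) = exp (- (1/3 * ln (INR n)))).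
{ unfold hh, Rpower. f_equal. rewrite plus_INR.
  replace (2 / (INR n + INR n)) with (/ INR n) by (field; lra). rewrite ln_Rinv by lra. ring. }
unfold scale, phi. rewrite H, ln_exp. rewrite pow_add, <- Rpow_mult_distr.
replace (2 * 2) with 4 by ring. unfold Rpower.
replace (3 * a1 / exp (- (1/3 * ln (INR n)))) with (3 * a1 * exp (1/3 * ln (INR n))).
2:{ rewrite exp_Ropp. field. apply Rgt_not_eq, exp_pos. }
rewrite !Rmult_assoc, <- !exp_plus. do 2 f_equal. field.
Qed.

Lemma exp_le_one x : x <= 0 -> exp x <= 1.
Proof.
intros Hx. rewrite <- exp_0. destruct Hx as [H| ->]; [left; now apply exp_increasing|lra].
Qed.

(** * Two-sided bounds on the diagonal *)

Section Theta.

Variables (y y' : R -> R) (a1 sg : R).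
Hypothesis dy : forall x, is_derive y x (y' x).
Hypothesis dy' : forall x, is_derive y' x (x * y x).
Hypothesis y_lim : is_lim y p_infty 0.
Hypothesis y_a1 : y a1 = 0.
Hypothesis y_pos : forall x, a1 < x -> 0 < y x.
Hypothesis sg_range : 0 <= sg <= 1.
Variables (u uD : nat -> nat -> R).
Hypothesis Hu : cherry_recurrence sg u uD.

Let target n := INR (fact n) * 4 ^ n * exp (3 * a1 * Rpower (INR n) (1/3)) * Rpower (INR n) (kappa sg - 1/3).

Lemma height_Dom n m : (m <= n)%nat -> 32 <= INR (n + m) -> Dom (INR (n + m)) (height n m).
Proof.
intros Hm H. apply le_INR in Hm. pose proof (pos_INR m). rewrite plus_INR in *. unfold Dom, height. lra.
Qed.

Lemma weightD_bottom_sign ep b n :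
  0 <= ep * (b (INR n) (INR n + 1) - wup (INR n) (INR n + 1) / rho sg a1 ep (INR n) * b (INR n - 1) (INR n + 1 - 1)) ->
  (1 <= n)%nat -> 0 <= ep * weightD sg a1 ep b n 0.
Proof.
intros H Hn. rewrite weightD_eq by lia. rewrite Nat.add_0_r.
replace (height n 0) with (INR n + 1) by (unfold height; simpl; ring).
rewrite <- Rmult_assoc, (Rmult_comm ep), Rmult_assoc. apply Rmult_le_pos; [|easy].
apply Rmult_le_pos; [apply pos_INR|left; apply scale_pos].
Qed.

Lemma nat_above (T : R) : exists N : nat, T <= INR N.
Proof. destruct (INR_unbounded T) as [N HN]. exists N. lra. Qed.

Lemma counting_upper : exists C N, 0 < C /\ forall n, (N <= n)%nat -> u n n <= C * target n.
Proof.
destruct (airy_exp_bound y y' a1 dy dy' y_lim y_a1 y_pos) as [M [M0 HM]].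
pose proof (airy_linear_lower y y' a1 dy dy' y_lim y_a1 y_pos) as HL.
pose proof (airy_ratio_bound y y' a1 dy dy' y_lim y_a1 y_pos) as HR.
assert (ep1 : 1 = 1 \/ 1 = -1) by now left.
destruct (barrier_inequality sg a1 1 sg_range ep1 y y' M dy dy' y_a1 y_pos M0 HM HL) as [eta [T1 [eta0 [T10 HT1]]]].
destruct (barrier_super_nonneg sg a1 1 sg_range ep1 y y' M y_a1 y_pos M0 HM eta eta0 eq_refl) as [T2 [T20 HT2]].
destruct (barrier_super_D_pos sg a1 1 sg_range ep1 y y' M y_a1 y_pos M0 HM HR eta eta0 eq_refl) as [T3 [T30 HT3]].
destruct (barrier_edge sg a1 1 sg_range ep1 y y' M y_a1 y_pos M0 HM HR eta eta0) as [T4 [T40 HT4]].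
destruct (barrier_at_one sg a1 1 sg_range ep1 y y' M y_a1 M0 HM dy HL eta eta0) as [T5 [c [C [T50 [c0 [C0 HT5]]]]]].
destruct (nat_above (T1 + T2 + T3 + T4 + T5)) as [I HI].
set (b := barrier sg a1 1 y eta) in *.
assert (I4 : (4 <= I)%nat) by (apply INR_le; simpl; lra).
assert (J : forall n m, (I <= n + m)%nat -> T1 + T2 + T3 + T4 + T5 <= INR (n + m)) by (intros n m H; apply le_INR in H; lra).
assert (bz : forall t, b t 0 = 0).
{ intros t. unfold b, barrier, profile, lin. rewrite !Rmult_0_r, !Rplus_0_r, y_a1. ring. }
assert (FP : forall n i, 0 < INR (fact n) * scale sg a1 1 i).
{ intros. apply Rmult_lt_0_compat; [apply lt_0_INR, lt_O_fact|apply scale_pos]. }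
assert (WP : forall n m, (m <= n)%nat -> (I <= n + m)%nat -> 0 < weight sg a1 1 b n m).
{ intros n m Hm Hi. specialize (J n m Hi). apply Rmult_lt_0_compat; [apply FP|].
  assert (0 < height n m) by (unfold height; apply le_INR in Hm; lra).
  apply HT2; lra. }
assert (WDP : forall n m, (m <= n)%nat -> (I <= n + m)%nat -> 0 < weightD sg a1 1 b n m).
{ intros n m Hm Hi. specialize (J n m Hi). rewrite weightD_eq by lia. apply Rmult_lt_0_compat; [apply FP|].
  apply HT3; [lra|]. apply height_Dom; [easy|lra]. }
(* On the band both quotients are nonnegative, so a bound on their sum bounds each of them. *)
destruct (finite_upper_bound (fun n m => u n m / weight sg a1 1 b n m + uD n m / weightD sg a1 1 b n m) (I + 2)) as [K [K0 HK]].
exists (K * C), I. split; [nra|]. intros n Hn.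
assert (P := comparison sg u uD sg_range Hu a1 1 b bz K I ep1 ltac:(lra) I4).
assert (Q : 0 <= 1 * (K * weight sg a1 1 b n n - u n n)).
{ apply P; try lia; clear P n Hn.
  - intros n m Hm Hi. specialize (J n m ltac:(lia)). apply HT1; [lra|]. apply height_Dom; [lia|lra].
  - intros n Hn. apply weightD_bottom_sign; [|lia]. apply HT4. specialize (J n 0%nat ltac:(lia)). rewrite Nat.add_0_r in J. lra.
  - intros n m Hm Hi. specialize (HK n m ltac:(lia) ltac:(lia)). cbv beta in HK.
    specialize (WP n m Hm ltac:(lia)). specialize (WDP n m Hm ltac:(lia)).
    destruct (rec_nonneg _ _ _ Hu n m) as [U1 U2].
    assert (A1 : 0 <= u n m / weight sg a1 1 b n m) by (apply Rdiv_le_0_compat; lra).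
    assert (A2 : 0 <= uD n m / weightD sg a1 1 b n m) by (apply Rdiv_le_0_compat; lra).
    split.
    + assert (u n m / weight sg a1 1 b n m * weight sg a1 1 b n m <= K * weight sg a1 1 b n m) by (apply Rmult_le_compat_r; lra).
      replace (u n m / weight sg a1 1 b n m * weight sg a1 1 b n m) with (u n m) in H by (field; lra). lra.
    + assert (uD n m / weightD sg a1 1 b n m * weightD sg a1 1 b n m <= K * weightD sg a1 1 b n m) by (apply Rmult_le_compat_r; lra).
      replace (uD n m / weightD sg a1 1 b n m * weightD sg a1 1 b n m) with (uD n m) in H by (field; lra). lra. }
assert (u n n <= K * weight sg a1 1 b n n) by lra.
eapply Rle_trans; [apply H|]. rewrite Rmult_assoc. apply Rmult_le_compat_l; [lra|].
specialize (J n n ltac:(lia)). unfold weight. replace (height n n) with 1 by (unfold height; ring).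
destruct (HT5 (INR (n + n)) ltac:(lra)) as [_ B].
apply Rle_trans with (INR (fact n) * scale sg a1 1 (n + n) * (C * hh (INR (n + n)))).
{ apply Rmult_le_compat_l; [left; apply FP|exact B]. }
replace (INR (fact n) * scale sg a1 1 (n + n) * (C * hh (INR (n + n)))) with
  (C * (INR (fact n) * (scale sg a1 1 (n + n) * hh (INR (n + n))))) by ring.
apply Rmult_le_compat_l; [lra|]. rewrite scale_diagonal by lia. unfold target.
rewrite !Rmult_assoc. apply Rmult_le_compat_l; [apply pos_INR|].
apply Rmult_le_compat_l; [apply pow_le; lra|]. apply Rmult_le_compat_l; [left; apply exp_pos|].
rewrite <- (Rmult_1_r (Rpower (INR n) (kappa sg - 1 / 3))) at 2. apply Rmult_le_compat_l; [left; apply exp_pos|].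
assert (0 < sqrt (hh (INR (n + n)))) by (apply sqrt_lt_R0, hh_pos).
apply exp_le_one. lra.
Qed.

Lemma counting_lower : exists c N, 0 < c /\ forall n, (N <= n)%nat -> c * target n <= u n n.
Proof.
destruct (airy_exp_bound y y' a1 dy dy' y_lim y_a1 y_pos) as [M [M0 HM]].
pose proof (airy_linear_lower y y' a1 dy dy' y_lim y_a1 y_pos) as HL.
pose proof (airy_ratio_bound y y' a1 dy dy' y_lim y_a1 y_pos) as HR.
assert (ep1 : -1 = 1 \/ -1 = -1) by now right.
destruct (barrier_inequality sg a1 (-1) sg_range ep1 y y' M dy dy' y_a1 y_pos M0 HM HL) as [eta [T1 [eta0 [T10 HT1]]]].
destruct (barrier_edge sg a1 (-1) sg_range ep1 y y' M y_a1 y_pos M0 HM HR eta eta0) as [T4 [T40 HT4]].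
destruct (barrier_at_one sg a1 (-1) sg_range ep1 y y' M y_a1 M0 HM dy HL eta eta0) as [T5 [c [C [T50 [c0 [C0 HT5]]]]]].
destruct (nat_above (T1 + T4 + T5)) as [I HI].
set (b := barrier sg a1 (-1) y eta) in *.
assert (I4 : (4 <= I)%nat) by (apply INR_le; simpl; lra).
assert (J : forall n m, (I <= n + m)%nat -> T1 + T4 + T5 <= INR (n + m)) by (intros n m H; apply le_INR in H; lra).
assert (bz : forall t, b t 0 = 0).
{ intros t. unfold b, barrier, profile, lin. rewrite !Rmult_0_r, !Rplus_0_r, y_a1. ring. }
assert (FP : forall n i, 0 < INR (fact n) * scale sg a1 (-1) i).
{ intros. apply Rmult_lt_0_compat; [apply lt_0_INR, lt_O_fact|apply scale_pos]. }
destruct (finite_upper_bound (fun n m => Rabs (weight sg a1 (-1) b n m) / u n m + Rabs (weightD sg a1 (-1) b n m) / uD n m) (I + 2)) as [K [K0 HK]].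
exists (/ K * c), I. split; [apply Rmult_lt_0_compat; [now apply Rinv_0_lt_compat|easy]|]. intros n Hn.
assert (W0 : forall n, (I <= n)%nat -> 0 <= -1 * weightD sg a1 (-1) b n 0).
{ clear n Hn. intros n Hn. apply weightD_bottom_sign; [|lia]. apply HT4. specialize (J n 0%nat ltac:(lia)). rewrite Nat.add_0_r in J. lra. }
assert (P := comparison sg u uD sg_range Hu a1 (-1) b bz (/ K) I ep1 ltac:(left; now apply Rinv_0_lt_compat) I4).
assert (Q : 0 <= -1 * (/ K * weight sg a1 (-1) b n n - u n n)).
{ apply P; try lia; clear P n Hn; [|exact W0|].
  - intros n m Hm Hi. specialize (J n m ltac:(lia)). apply HT1; [lra|]. apply height_Dom; [lia|lra].
  - intros n m Hm Hi. specialize (HK n m ltac:(lia) ltac:(lia)). cbv beta in HK.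
    assert (G : forall w v, 0 < v -> Rabs w / v <= K -> / K * w <= v).
    { intros w v v0 Hw. apply Rmult_le_reg_l with K; [easy|]. rewrite <- Rmult_assoc, Rinv_r, Rmult_1_l by lra.
      eapply Rle_trans; [apply Rle_abs|]. apply Rmult_le_reg_r with (/ v); [now apply Rinv_0_lt_compat|].
      replace (K * v * / v) with K by (field; lra). exact Hw. }
    assert (U := rec_pos sg u uD sg_range Hu n m ltac:(lia) Hm).
    assert (A1 : 0 <= Rabs (weight sg a1 (-1) b n m) / u n m) by (apply Rdiv_le_0_compat; [apply Rabs_pos|easy]).
    destruct (Nat.eq_dec m 0) as [E|E].
    (* At m = 0 the quotient by [uD] is a division by 0, worth 0; the sign of [weightD] comes from
       [W0] instead. *)
    + subst m. rewrite (rec_D_bottom _ _ _ Hu) in * by lia. specialize (W0 n ltac:(lia)).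
      split; [|apply Rmult_le_compat_l with (r := / K) in W0; [|left; now apply Rinv_0_lt_compat]; lra].
      assert (B : Rabs (weight sg a1 (-1) b n 0) / u n 0%nat <= K).
      { unfold Rdiv at 2 in HK. rewrite Rinv_0, Rmult_0_r in HK. lra. }
      specialize (G _ _ U B). lra.
    + assert (UD := rec_D_pos sg u uD sg_range Hu n m ltac:(lia) ltac:(lia)).
      assert (A2 : 0 <= Rabs (weightD sg a1 (-1) b n m) / uD n m) by (apply Rdiv_le_0_compat; [apply Rabs_pos|easy]).
      split.
      * specialize (G (weight sg a1 (-1) b n m) _ U ltac:(lra)). lra.
      * specialize (G (weightD sg a1 (-1) b n m) _ UD ltac:(lra)). lra. }
apply Rle_trans with (/ K * weight sg a1 (-1) b n n); [|lra].
rewrite Rmult_assoc. apply Rmult_le_compat_l; [left; now apply Rinv_0_lt_compat|].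
specialize (J n n ltac:(lia)). unfold weight. replace (height n n) with 1 by (unfold height; ring).
destruct (HT5 (INR (n + n)) ltac:(lra)) as [B _].
apply Rle_trans with (INR (fact n) * scale sg a1 (-1) (n + n) * (c * hh (INR (n + n)))).
2:{ apply Rmult_le_compat_l; [left; apply FP|exact B]. }
replace (INR (fact n) * scale sg a1 (-1) (n + n) * (c * hh (INR (n + n)))) with
  (c * (INR (fact n) * (scale sg a1 (-1) (n + n) * hh (INR (n + n))))) by ring.
apply Rmult_le_compat_l; [lra|]. rewrite scale_diagonal by lia. unfold target.
rewrite !Rmult_assoc. apply Rmult_le_compat_l; [apply pos_INR|].
apply Rmult_le_compat_l; [apply pow_le; lra|]. apply Rmult_le_compat_l; [left; apply exp_pos|].
rewrite <- (Rmult_1_r (Rpower (INR n) (kappa sg - 1 / 3))) at 1. apply Rmult_le_compat_l; [left; apply exp_pos|].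
assert (0 < sqrt (hh (INR (n + n)))) by (apply sqrt_lt_R0, hh_pos).
pose proof (exp_ineq1_le (- (-1 * sqrt (hh (INR (n + n)))))). lra.
Qed.

End Theta.

Lemma stack_count_recurrence (cp : bool) :
  cherry_recurrence (if cp then 1 else 0)
    (fun n m => INR (stack_count cp n m)) (fun n m => INR (node_count cp n m)).
Proof.
split.
- intros n m H. change 0 with (INR 0). f_equal.
  apply (has_card_unique (stack_ok cp n m)); [apply stack_count_spec|].
  apply has_card_empty. intros st. now apply stack_ok_outside.
- change 1 with (INR 1). f_equal.
  apply (has_card_unique (stack_ok cp 0 0)); [apply stack_count_spec|apply stack_ok_origin].
- intros n m Hn Hm. rewrite stack_count_step by easy. rewrite plus_INR, mult_INR, plus_INR. easy.
- intros n Hn. change 0 with (INR 0). f_equal.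
  apply (has_card_unique (fun st => stack_ok cp n 0 st /\ node_top st)); [apply node_count_spec|apply node_top_bottom].
- intros n m Hn Hm. destruct cp.
  + rewrite <- (node_count_compacted n m Hn Hm). rewrite plus_INR, mult_INR, (minus_INR m) by lia. simpl (INR 1). ring.
  + rewrite node_count_relaxed by easy. ring.
- intros n m. split; apply pos_INR.
Qed.

(** The given function is a multiple of Ai of unknown sign. By the intermediate value theorem its
    sign is constant to the right of the largest zero, and the opposite function serves if that sign
    is negative. *)
Lemma airy_like_normalize (f : R -> R) (a1 : R) : airy_like f -> largest_zero f a1 ->
  exists y y' : R -> R, (forall x, is_derive y x (y' x)) /\ (forall x, is_derive y' x (x * y x)) /\
    is_lim y p_infty 0 /\ y a1 = 0 /\ (forall x, a1 < x -> 0 < y x).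
Proof.
intros [[f' Hf] [Lf _]] [Za Hz].
assert (Sign : forall y y' : R -> R, (forall x, is_derive y x (y' x)) -> (forall x, a1 < x -> y x <> 0) ->
  0 < y (a1 + 1) -> forall x, a1 < x -> 0 < y x).
{ intros y y' Dy NZ P x Hx. destruct (Rlt_or_le 0 (y x)) as [|N]; [easy|exfalso].
  assert (Cy : continuity y).
  { intros t. apply derivable_continuous_pt. exists (y' t). now apply is_derive_Reals. }
  destruct (Rle_or_lt x (a1 + 1)) as [L|L].
  - destruct (IVT_cor y x (a1 + 1) Cy L) as [z [Bz Ez]]; [nra|]. apply (NZ z); lra.
  - destruct (IVT_cor y (a1 + 1) x Cy) as [z [Bz Ez]]; [lra|nra|]. apply (NZ z); lra. }
assert (NZ : forall x, a1 < x -> f x <> 0) by (intros x Hx E; specialize (Hz x E); lra).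
destruct (Rlt_or_le 0 (f (a1 + 1))) as [P|N].
- exists f, f'. split; [apply Hf|]. split; [apply Hf|]. split; [easy|]. split; [easy|].
  apply (Sign f f'); try easy. apply Hf.
- exists (fun x => - f x), (fun x => - f' x).
  assert (D : forall x, is_derive (fun x => - f x) x (- f' x)) by (intros; apply (is_derive_opp f), Hf).
  split; [easy|]. split; [|split; [|split]].
  + intros x. replace (x * - f x) with (- (x * f x)) by ring. apply (is_derive_opp f'), Hf.
  + replace (Finite 0) with (Rbar_opp 0) by (simpl; f_equal; ring). now apply is_lim_opp.
  + lra.
  + apply (Sign _ _ D).
    * intros x Hx E. apply (NZ x Hx). lra.
    * specialize (NZ (a1 + 1)). lra.
Qed.

Lemma stack_count_theta (Ai : R -> R) (a1 : R) (cp : bool) :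
  airy_like Ai -> largest_zero Ai a1 ->
  bigTheta (fun n => INR (stack_count cp n n))
    (fun n => INR (fact n) * 4 ^ n * exp (3 * a1 * Rpower (INR n) (1/3))
              * Rpower (INR n) (kappa (if cp then 1 else 0) - 1/3)).
Proof.
intros HA HZ. destruct (airy_like_normalize Ai a1 HA HZ) as [y [y' [D [D' [L [Z P]]]]]].
assert (S : 0 <= (if cp then 1 else 0) <= 1) by (destruct cp; lra).
pose proof (stack_count_recurrence cp) as Hu.
destruct (counting_upper y y' a1 _ D D' L Z P S _ _ Hu) as [C [N [C0 HC]]].
destruct (counting_lower y y' a1 _ D D' L Z P S _ _ Hu) as [c [N' [c0 Hc]]].
exists c, C. split; [easy|]. split; [easy|]. exists (N + N')%nat. intros n Hn.
split; [apply Hc|apply HC]; lia.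
Qed.

Lemma bigTheta_ext (u v g h : nat -> R) (N : nat) :
  (forall n, u n = v n) -> (forall n, (N <= n)%nat -> g n = h n) -> bigTheta u g -> bigTheta v h.
Proof.
intros Huv Hgh [C1 [C2 [P1 [P2 [M H]]]]]. exists C1, C2. split; [easy|]. split; [easy|].
exists (M + N)%nat. intros n Hn. rewrite <- Huv, <- Hgh by lia. apply H. lia.
Qed.

Theorem theorem1p1 (Ai : R -> R) (a1 : R) (r c : nat -> nat) :
  airy_like Ai -> largest_zero Ai a1 ->
  (forall n, has_card (is_relaxed n) (r n)) ->
  (forall n, has_card (is_compacted n) (c n)) ->
  bigTheta (fun n => INR (c n))
    (fun n => INR (fact n) * 4 ^ n * exp (3 * a1 * Rpower (INR n) (1/3))
              * Rpower (INR n) (3/4)) /\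
  bigTheta (fun n => INR (r n))
    (fun n => INR (fact n) * 4 ^ n * exp (3 * a1 * Rpower (INR n) (1/3))
              * INR n).
Proof.
intros HA HZ Hr Hc. split.
- refine (bigTheta_ext _ _ _ _ 0%nat _ _ (stack_count_theta Ai a1 true HA HZ)).
  + intros n. f_equal. apply (has_card_unique (fun t => stack_ok true n n (t :: nil))).
    * apply stack_singleton_card, stack_count_spec.
    * apply has_card_ext with (is_compacted n); [apply compacted_stack|apply Hc].
  + intros n _. cbv beta. do 2 f_equal. unfold kappa. field.
- refine (bigTheta_ext _ _ _ _ 1%nat _ _ (stack_count_theta Ai a1 false HA HZ)).
  + intros n. f_equal. apply (has_card_unique (fun t => stack_ok false n n (t :: nil))).
    * apply stack_singleton_card, stack_count_spec.
    * apply has_card_ext with (is_relaxed n); [apply relaxed_stack|apply Hr].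
  + intros n Hn. cbv beta. f_equal. replace (kappa 0 - 1 / 3) with 1 by (unfold kappa; field).
    apply Rpower_1. now apply lt_0_INR.
Qed.
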